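(* In the setting described in the context, let $j:\mathcal H(Y)\to\mathcal H(Y)$ be a non-affine holomorphic map with $j\circ j=\mathrm{id}$, $j(ie)=ie$ and derivative $dj(ie)=-I$. Suppose there are a zero-free holomorphic function $h:\mathcal H(Y)\to\mathbb C$, independent of the lattice, and for every full-rank lattice $\Lambda\subset\widehat U$ a constant $c_\Lambda$, such that $$\theta_{\Lambda^\rho}(j(z),0)=c_\Lambda\cdot h(z)\cdot\theta_\Lambda(z,0)\qquad\text{for all } z\in\mathcal H(Y).$$ Then $\mathcal H(Y)$ is a symmetric tube domain. Hence there exists a formally real Jordan algebra structure $\mathfrak A$ on $V$ with unit element $e$ such that: the positive definite symmetric bilinear form $\sigma$ on $V$ may be chosen as the trace form of $\mathfrak A$; with this choice $Y=Y^\sigma$, and $Y$ is the set of all squares of invertible elements of $\mathfrak A$; and $j(z)=-z^{-1}$ for all $z\in\mathcal H(Y)$, where $z^{-1}$ is the inverse in the complexification of $\mathfrak A$.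
   Context: All vector spaces are finite-dimensional. $\widehat U\neq\{0\}$ is a real vector space with complexification $U=\widehat U^{\mathbb C}$; $\rho$ is a positive definite symmetric bilinear form on $\widehat U$, extended $\mathbb C$-bilinearly to $U$. For a full-rank lattice $\Lambda\subset\widehat U$, $\Lambda^\rho=\{x\in\widehat U:\rho(\Lambda,x)\subseteq\mathbb Z\}$ is the dual lattice. $V$ is a real vector space with complexification $V^{\mathbb C}$, and $\psi:V^{\mathbb C}\to\mathrm{End}_{\mathbb C}(U)$ is an injective $\mathbb C$-linear map such that for every $x\in V$ the map $\psi(x)$ sends $\widehat U$ to itself and is self-adjoint with respect to $\rho$. Put $Y=\{x\in V:\rho(\psi(x)u,u)>0\text{ for all }u\in\widehat U\setminus\{0\}\}$; it is assumed that $Y\neq\emptyset$, and then $Y$ is an open convex cone in $V$ which is regular (contains no full line). A base point $e\in Y$ with $\psi(e)=I$ is fixed. $\mathcal H(Y)=V\oplus iY\subset V^{\mathbb C}$ is the tube domain over $Y$; it is called symmetric if it is a Hermitian symmetric domain. For a full-rank lattice $\Lambda$ in $\widehat U$ the theta series is $$\theta_\Lambda(z,u)=\sum_{l\in\Lambda^\rho}\exp\bigl(\pi i\,\rho(\psi(z)l+2u,l)\bigr),\qquad (z,u)\in\mathcal H(Y)\times U,$$ which converges absolutely; thus in $\theta_{\Lambda^\rho}$ the sum is over $(\Lambda^\rho)^\rho=\Lambda$. For a positive definite symmetric bilinear form $\sigma$ on $V$ the $\sigma$-dual cone is $Y^\sigma=\{x\in V:\sigma(x,y)>0\text{ for all }y\in\overline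 Y\setminus\{0\}\}$. The trace form of a formally real Jordan algebra is $(a,b)\mapsto\mathrm{tr}\,L(ab)$, where $L(a)$ is multiplication by $a$. *)

(* Defs.v *)
From HB Require Import structures.
From mathcomp Require Import all_boot all_order all_algebra.
From mathcomp Require Import complex.
From mathcomp Require Import all_classical all_reals all_analysis.
From mathcomp.analysis.showcase Require summability.

Set Implicit Arguments.
Unset Strict Implicit.
Unset Printing Implicit Defensive.
Import Order.TTheory GRing.Theory Num.Theory.
Import numFieldNormedType.Exports.

Local Open Scope classical_set_scope.
Local Open Scope ring_scope.
Local Open Scope complex_scope.

(* The topology and norm that every numFieldType carries, made available on the
   concrete type R[i]. *)
HB.instance Definition _ (R : realType) := NormedModule.copy R[i] R[i]^o.

(* A finite-dimensional real vector space is written in a basis as 'rV[R]_n, its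
   complexification is then 'rV[R[i]]_n.  Endomorphisms are matrices acting on row vectors from the right, so that
   "f u" is u *m f. *)

Section Complexification.
Context {R : realType}.

Definition cvec n (x : 'rV[R]_n) : 'rV[R[i]]_n := map_mx (real_complex R) x.

Definition Re_vec n (z : 'rV[R[i]]_n) : 'rV[R]_n := map_mx (@complex.Re R) z.
Definition Im_vec n (z : 'rV[R[i]]_n) : 'rV[R]_n := map_mx (@complex.Im R) z.

(* [form_ext] and [mul_ext] are the C-bilinear extensions of a bilinear form
   and of a bilinear product. *)
Definition form_ext n (b : 'rV[R]_n -> 'rV[R]_n -> R) (z w : 'rV[R[i]]_n)
    : R[i] :=
  (b (Re_vec z) (Re_vec w) - b (Im_vec z) (Im_vec w))
  +i* (b (Re_vec z) (Im_vec w) + b (Im_vec z) (Re_vec w)).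

Definition mul_ext n (mul : 'rV[R]_n -> 'rV[R]_n -> 'rV[R]_n)
    (z w : 'rV[R[i]]_n) : 'rV[R[i]]_n :=
  cvec (mul (Re_vec z) (Re_vec w) - mul (Im_vec z) (Im_vec w))
  + 'i *: cvec (mul (Re_vec z) (Im_vec w) + mul (Im_vec z) (Re_vec w)).

Definition cexp (z : R[i]) : R[i] :=
  (expR (complex.Re z))%:C * (cos (complex.Im z) +i* sin (complex.Im z)).

End Complexification.

(* Right linearity follows from symmetry. *)
Record posdef_symmetric_bilinear (R : realType) n
    (b : 'rV[R]_n -> 'rV[R]_n -> R) : Prop := PosdefSymmetricBilinear {
  psb_linear : forall a x y z, b (a *: x + y) z = a * b x z + b y z;
  psb_sym : forall x y, b x y = b y x;
  psb_pos : forall x, x != 0 -> 0 < b x x }.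

Section Theta.
Context {R : realType} {m n : nat}.
Variable rho : 'rV[R]_m -> 'rV[R]_m -> R.
Variable psi : {linear 'rV[R[i]]_n -> 'M[R[i]]_m}.

Definition full_rank_lattice (L : set 'rV[R]_m) : Prop :=
  exists2 B : 'M[R]_m, B \in unitmx &
    L = [set map_mx intr k *m B | k in [set: 'rV[int]_m]].

Definition dual_lattice (L : set 'rV[R]_m) : set 'rV[R]_m :=
  [set x | forall l, L l -> rho l x \is a Num.int].

Definition preserves_real_selfadjoint : Prop := forall x : 'rV[R]_n,
  (forall u : 'rV[R]_m, exists w : 'rV[R]_m,
     cvec u *m psi (cvec x) = cvec w) /\
  (forall u v : 'rV[R]_m,
     form_ext rho (cvec u *m psi (cvec x)) (cvec v) =
     form_ext rho (cvec u) (cvec v *m psi (cvec x))).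

(* The order of R[i] is partial: 0 < c means that c is real and positive. *)
Definition cone : set 'rV[R]_n :=
  [set x | forall u : 'rV[R]_m, u != 0 ->
     0 < form_ext rho (cvec u *m psi (cvec x)) (cvec u)].

(* Unordered sum over the dual lattice, i.e. the limit of the partial sums
   along the finite subsets of the lattice ordered by inclusion. *)
Definition theta (L : set 'rV[R]_m) (z : 'rV[R[i]]_n) (u : 'rV[R[i]]_m)
    : R[i] :=
  summability.sum (fun l : dual_lattice L =>
    cexp (pi%:C * 'i *
      form_ext rho (cvec (val l) *m psi z + 2 *: u) (cvec (val l))) : R[i]).

End Theta.

Definition tube (R : realType) n (Y : set 'rV[R]_n) : set 'rV[R[i]]_n :=
  [set z | Y (Im_vec z)].

Definition dual_cone (R : realType) n (sigma : 'rV[R]_n -> 'rV[R]_n -> R)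
    (Y : set 'rV[R]_n) : set 'rV[R]_n :=
  [set x | forall y, closure Y y -> y != 0 -> 0 < sigma x y].

(* Fréchet differentiability over the field R[i] *)
Definition holomorphic_on (R : realType) (V W : normedModType R[i])
    (D : set V) (f : V -> W) : Prop :=
  forall z, D z -> differentiable f z.

Definition affine_on (R : realType) n (D : set 'rV[R[i]]_n)
    (f : 'rV[R[i]]_n -> 'rV[R[i]]_n) : Prop :=
  exists (A : 'M[R[i]]_n) (b : 'rV[R[i]]_n),
    forall z, D z -> f z = z *m A + b.

Section HermitianSymmetricDomain.
Context {R : realType} {n : nat}.
Local Notation Cn := ('rV[R[i]]_n).

Definition domain (D : set Cn) : Prop := [/\ open D, connected D & D !=set0].

Definition biholomorphic (D D' : set Cn) : Prop :=
  exists f g : Cn -> Cn,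
    [/\ holomorphic_on D f, holomorphic_on D' g,
        forall z, D z -> D' (f z) /\ g (f z) = z &
        forall w, D' w -> D (g w) /\ f (g w) = w].

(* C^oo in the real sense on an open set: a function is C^oo iff it belongs to
   a family of continuous functions that is closed under taking derivatives in
   all real directions. *)
Definition real_smooth_on (D : set Cn) (F : Cn -> 'M[R[i]]_n) : Prop :=
  exists2 S : set (Cn -> 'M[R[i]]_n), S F &
    forall f, S f ->
      (forall z, D z -> {for z, continuous f}) /\
      (forall v : Cn, exists2 f', S f' & forall z, D z ->
         (t^-1)%:C *: (f (z + t%:C *: v) - f z) @[t --> (0 : R)^'] --> f' z).

Definition hform (G : 'M[R[i]]_n) (u v : Cn) : R[i] :=
  (u *m G *m (map_mx (@conjc R) v)^T) 0 0.

Definition hermitian_metric (D : set Cn) (g : Cn -> 'M[R[i]]_n) : Prop :=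
  real_smooth_on D g /\
  forall z, D z ->
    (forall u v, hform (g z) v u = conjc (hform (g z) u v)) /\
    (forall u, u != 0 -> 0 < hform (g z) u u).

Definition isometry_on (D : set Cn) (g : Cn -> 'M[R[i]]_n) (s : Cn -> Cn)
    : Prop :=
  forall z, D z -> forall u v,
    hform (g (s z)) ('d s z u) ('d s z v) = hform (g z) u v.

(* A Hermitian manifold in which every point is an isolated fixed point of an
   involutive holomorphic isometry is a Hermitian symmetric space; the
   biholomorphism with a bounded domain selects the noncompact type. *)
Definition hermitian_symmetric_domain (D : set Cn) : Prop :=
  [/\ domain D,
      exists B : set Cn, [/\ domain B, bounded_set B & biholomorphic D B] &
      exists2 g, hermitian_metric D g &
        forall a, D a -> exists s : Cn -> Cn,
          [/\ holomorphic_on D s,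
              forall z, D z -> D (s z) /\ s (s z) = z,
              isometry_on D g s,
              s a = a &
              \forall z \near a^', s z != z]].

End HermitianSymmetricDomain.

(* Bilinearity of the product follows from left linearity and
   commutativity. *)
Record jordan_algebra (R : realType) n
    (mul : 'rV[R]_n -> 'rV[R]_n -> 'rV[R]_n) (e : 'rV[R]_n) : Prop :=
  JordanAlgebra {
    ja_linear : forall a x y z, mul (a *: x + y) z = a *: mul x z + mul y z;
    ja_comm : forall x y, mul x y = mul y x;
    ja_jordan : forall x y, mul x (mul (mul x x) y) = mul (mul x x) (mul x y);
    ja_unit : forall x, mul e x = x }.

Definition formally_real (R : realType) n
    (mul : 'rV[R]_n -> 'rV[R]_n -> 'rV[R]_n) : Prop :=
  forall s : seq 'rV[R]_n,
    \sum_(x <- s) mul x x = 0 -> forall x, x \in s -> x = 0.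

(* Jacobson's definition of the inverse y of x in a Jordan algebra with unit e;
   such a y is unique. *)
Definition jordan_inverse (T : Type) (mul : T -> T -> T) (e x y : T) : Prop :=
  mul x y = e /\ mul (mul x x) y = x.

Definition jordan_invertible (T : Type) (mul : T -> T -> T) (e x : T) : Prop :=
  exists y, jordan_inverse mul e x y.

Definition trace_form (R : realType) n
    (mul : 'rV[R]_n -> 'rV[R]_n -> 'rV[R]_n) (x y : 'rV[R]_n) : R :=
  \tr (lin1_mx (mul (mul x y))).

(* Main.v *)
Require Import Defs.
From HB Require Import structures.
From mathcomp Require Import all_boot all_order all_algebra finmap.
From mathcomp Require Import complex.
From mathcomp Require Import all_classical all_reals all_analysis.
From mathcomp Require Import perm sesquilinear spectral ring lra.
From mathcomp.analysis.showcase Require summability.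
Import Order.TTheory GRing.Theory Num.Theory.
Import numFieldNormedType.Exports.
Import Normc.
Set Implicit Arguments.
Unset Strict Implicit.
Unset Printing Implicit Defensive.
Local Open Scope classical_set_scope.
Local Open Scope ring_scope.
Local Open Scope complex_scope.

(** An orthonormal basis of rho turns psi into an injective real linear map phi
from V to the symmetric matrices with phi e = 1.  The cone is the set where
phi is positive definite, and on the tube the matrix phi z is symmetric with
positive definite imaginary part.  For a lattice with basis C the hypothesis
reads, with N = phi (j z) and M = phi z,

  Theta (C N C^T) = c_C h(z) Theta (C^-T M C^-1),

where Theta X is the sum of exp (pi i k X k^T) over the integer vectors k.

The first half shows that this forces N M = -1 ([theta_j_inverse]).  Shrink
one basis vector of the lattice by a factor t that tends to 0.  On the left the
sum over the first coordinate becomes a Riemann sum of a Gaussian integral, so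
that t Theta tends to a multiple of N_11^(-1/2) Theta of the Schur complement
of N_11; on the right all terms with nonzero first coordinate die, which
leaves Theta of the complementary block of M.  The constants depend on t but
not on z, hence are controlled by the base point ie ([theta_step]).  Since the
inverse of a Schur complement is a block of the inverse, an induction on the
dimension ([theta_inverse]) ends with M_mm = K (N^-1)_mm, and ie gives K = -1.
The last basis vector is arbitrary, so the quadratic forms of M and - N^-1
agree.  Everything is squared, which avoids the choice of a square root of
N_11; the Gaussian integral F(al) itself need not be evaluated, as it is enough
that al F(al)^2 is independent of al ([gsum_square]) and that F is insensitive
to complex shifts ([gsum_shift]).  Both are derivatives whose Riemann sums
telescope ([riemann_by_parts]).

For x in the cone the inverse of phi x is again phi of a point of the cone, the
imaginary part of j (ix).  By the identity of Hua, X^2 = X - (X^-1 + (1 -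
X)^-1)^-1, so phi V is closed under squares: it is a Jordan algebra of real
symmetric matrices, and it is formally real because a sum of squares of
symmetric matrices vanishes only trivially.  Associativity and positivity of
the trace form are [tr_mul_assoc] and [tr_mul_sq_gt0]; functional calculus
inside the algebra ([func_calc]) gives square roots, hence the description of
the cone by squares and its self-duality.  The relation N M = -1 says that
j z is the negative of the Jordan inverse of z.

For the symmetric structure of the tube, j yields a Cayley transform
z |-> e + 2i j (z + ie) whose inverse is built in the same way from j; its image
is bounded because a resolvent has entries of norm at most 1
([resolvent_bound]).  The metric is tr (Y^-1 U Y^-1 conj W) with Y = phi (Im z),
and the symmetry at x0 + i y0 is z |-> x0 + P(y0) j (z - x0), where P(y0) acts on
matrices by W |-> phi y0 * W * phi y0 and preserves phi V. *)

(** * Unordered sums of complex families *)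

Section Normc.
Context {R : realType}.
Implicit Types (x y z : R[i]).

Lemma normcE' x : `|x| = (normc x)%:C.
Proof. by case: x. Qed.

Lemma normc_ge0 x : 0 <= normc x.
Proof. by case: x => a b; exact: sqrtr_ge0. Qed.

Lemma normc_eq0 x : (normc x == 0) = (x == 0).
Proof.
by apply/eqP/eqP => [/eq0_normc//|->]; rewrite normc0.
Qed.

Lemma normc_gt0 x : (0 < normc x) = (x != 0).
Proof. by rewrite lt0r normc_ge0 andbT normc_eq0. Qed.

Lemma normc_distC x y : normc (x - y) = normc (y - x).
Proof. by rewrite -normcN opprB. Qed.

Lemma normc_real (a : R) : normc a%:C = `|a|.
Proof. by rewrite /= expr0n addr0 sqrtr_sqr. Qed.

Lemma normcX x n : normc (x ^+ n) = normc x ^+ n.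
Proof. by elim: n => [|n IH]; rewrite ?expr0 ?normc1 // !exprS normcM IH. Qed.

Lemma normc_i : normc ('i : R[i]) = 1.
Proof. by rewrite /= expr0n add0r expr1n sqrtr1. Qed.

Lemma le_normcB x y : normc (x - y) <= normc x + normc y.
Proof. by rewrite (le_trans (le_normcD _ _))// normcN. Qed.

Lemma normc_sum (I : Type) (s : seq I) (P : pred I) (f : I -> R[i]) :
  normc (\sum_(i <- s | P i) f i) <= \sum_(i <- s | P i) normc (f i).
Proof.
elim/big_rec2: _ => [|i a b _ h]; first by rewrite normc0.
by rewrite (le_trans (le_normcD _ _))// lerD2l.
Qed.

Lemma le_Re_normc x : `|complex.Re x| <= normc x.
Proof. by have := normc_ge_Re x; rewrite normcE' lecR. Qed.

Lemma le_Im_normc x : `|complex.Im x| <= normc x.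
Proof.
by case: x => a b /=; rewrite -sqrtr_sqr ler_wsqrtr // lerDr sqr_ge0.
Qed.

Lemma normc_le_ReIm x : normc x <= `|complex.Re x| + `|complex.Im x|.
Proof.
rewrite {1}(complexE x) (le_trans (le_normcD _ _))// normcM normc_i mul1r.
by rewrite !normc_real.
Qed.

Lemma cvg_normcP (T : Type) (F : set_system T) {FF : Filter F}
    (u : T -> R[i]) (l : R[i]) :
  (u @ F --> l) <-> (forall eps : R, 0 < eps -> \forall t \near F, normc (u t - l) < eps).
Proof.
split=> [/cvgrPdist_lt h eps e0|h].
  have := h eps%:C; rewrite ltcR => /(_ e0); apply: filterS => t.
  by rewrite normcE' ltcR normc_distC.
apply/cvgrPdist_lt => -[a b]; rewrite ltcE/= => /andP[/eqP-> a0].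
by have := h a a0; apply: filterS => t; rewrite normcE' normc_distC complexr0 ltcR.
Qed.

Lemma cvg_normc0 (T : Type) (F : set_system T) {FF : Filter F}
    (u : T -> R[i]) (g : T -> R) (l : R[i]) :
  (forall t, normc (u t - l) <= g t) -> (g @ F --> 0) -> u @ F --> l.
Proof.
move=> h /cvgrPdist_lt g0; apply/cvg_normcP => eps e0.
apply: filterS (g0 _ e0) => t; rewrite sub0r normrN => gt.
by rewrite (le_lt_trans (h t))// (le_lt_trans _ gt)// ler_norm.
Qed.

Lemma subr_cvg0C (T : Type) (F : set_system T) {FF : Filter F} (u : T -> R[i]) (l : R[i]) :
  (u t - l @[t --> F] --> (0 : R[i])) <-> (u @ F --> l).
Proof.
split=> h; apply/cvg_normcP => e e0.
  by move/cvg_normcP : h => /(_ e e0); apply: filterS => t; rewrite subr0.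
by move/cvg_normcP : h => /(_ e e0); apply: filterS => t; rewrite subr0.
Qed.

Lemma cvg_sumC (T I : Type) (F : set_system T) {FF : Filter F} (r : seq I)
    (P : pred I) (f : I -> T -> R[i]) (l : I -> R[i]) :
  (forall i, P i -> f i @ F --> l i) ->
  (fun t => \sum_(i <- r | P i) f i t) @ F --> \sum_(i <- r | P i) l i.
Proof.
move=> h; elim: r => [|i r IH].
  rewrite big_nil; under eq_fun do rewrite big_nil; exact: cvg_cst.
rewrite big_cons; under eq_fun do rewrite big_cons.
case: ifP => [Pi|_]; last exact: IH.
exact: (@cvgD _ R[i] _ F FF _ _ _ _ (h i Pi) IH).
Qed.

End Normc.

Section HasSum.
#[local] Existing Instance summability.totally_filter.
Context {R : realType}.
Local Notation "A <=f B" := (fsubset A B) (at level 70).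

(** Convergence of the net of finite partial sums.  [summability.sum] is the limit
of this net when it has one, and is arbitrary otherwise. *)
Definition has_sum (I : choiceType) (f : I -> R[i]) (s : R[i]) : Prop :=
  forall eps : R, 0 < eps -> exists A : {fset I},
    forall B : {fset I}, A <=f B -> normc (\sum_(i <- B) f i - s) < eps.

Definition sums_le (I : choiceType) (g : I -> R) (K : R) : Prop :=
  forall B : {fset I}, \sum_(i <- B) g i <= K.

Lemma has_sum_unique (I : choiceType) (f : I -> R[i]) s s' :
  has_sum f s -> has_sum f s' -> s = s'.
Proof.
move=> h h'; apply/eqP; rewrite -subr_eq0 -normc_eq0 eq_le normc_ge0 andbT.
apply/ler_addgt0Pl => e e0; rewrite addr0.
have [A hA] := h (e / 2) (divr_gt0 e0 (ltr0n _ 2)).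
have [A' hA'] := h' (e / 2) (divr_gt0 e0 (ltr0n _ 2)).
have /hA := fsubsetUl A A'; have /hA' := fsubsetUr A A'.
set S := \sum_(_ <- _) _ => h1 h2.
have -> : s - s' = (S - s') - (S - s) by ring.
by rewrite (le_trans (le_normcB _ _))// ltW// [e in ltRHS]splitr ltrD.
Qed.

Lemma has_sum_sum (I : choiceType) (f : I -> R[i]) s :
  has_sum f s -> summability.sum f = s.
Proof.
move=> h; rewrite /summability.sum; apply/cvg_lim; first exact: norm_hausdorff.
apply/cvg_normcP => eps /h[A hA]; exists A => // B AB.
by rewrite /summability.partial_sum -(big_seq_fsetE _ _ predT)/=; exact: hA.
Qed.

Lemma eq_has_sum (I : choiceType) (f g : I -> R[i]) s :
  f =1 g -> has_sum f s -> has_sum g s.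
Proof. by move=> /funext ->. Qed.

Lemma has_sumD (I : choiceType) (f g : I -> R[i]) s t :
  has_sum f s -> has_sum g t -> has_sum (fun i => f i + g i) (s + t).
Proof.
move=> h h' e e0.
have [A hA] := h (e / 2) (divr_gt0 e0 (ltr0n _ 2)).
have [A' hA'] := h' (e / 2) (divr_gt0 e0 (ltr0n _ 2)).
exists (A `|` A')%fset => B; rewrite fsubUset => /andP[/hA h1 /hA' h2].
rewrite big_split/= opprD addrACA (le_lt_trans (le_normcD _ _))//.
by rewrite [e in ltRHS]splitr ltrD.
Qed.

Lemma has_sumZ (I : choiceType) (f : I -> R[i]) s c :
  has_sum f s -> has_sum (fun i => c * f i) (c * s).
Proof.
move=> h e e0; have c0 : 0 < normc c + 1 by rewrite ltr_wpDl ?normc_ge0.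
have [A hA] := h (e / (normc c + 1)) (divr_gt0 e0 c0).
exists A => B /hA h1; rewrite -mulr_sumr -mulrBr normcM.
move: h1; rewrite ltr_pdivlMr// mulrC => /(le_lt_trans _); apply.
by rewrite ler_wpM2r ?normc_ge0// lerDl.
Qed.

Lemma has_sumB (I : choiceType) (f g : I -> R[i]) s t :
  has_sum f s -> has_sum g t -> has_sum (fun i => f i - g i) (s - t).
Proof.
move=> h /(has_sumZ (-1)) h'; rewrite -mulN1r.
by apply: eq_has_sum (has_sumD h h') => i; rewrite mulN1r.
Qed.

Lemma le_sum_fset (I : choiceType) (g : I -> R) (A B : {fset I}) :
  (forall i, 0 <= g i) -> A <=f B -> \sum_(i <- A) g i <= \sum_(i <- B) g i.
Proof.
move=> g0 AB; have -> : \sum_(i <- A) g i = \sum_(i <- A) (if i \in A then g i else 0).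
  by rewrite big_seq [RHS]big_seq; apply: eq_bigr => i ->.
rewrite (big_fset_incl _ AB) => [|i _ /negbTE->//].
by apply: ler_sum => i _; case: ifP.
Qed.

Lemma sums_le_sup (I : choiceType) (g : I -> R) K :
  (forall i, 0 <= g i) -> sums_le g K ->
  exists2 s, 0 <= s <= K & forall eps, 0 < eps -> exists A : {fset I},
    forall B : {fset I}, A <=f B -> s - eps < \sum_(i <- B) g i <= s.
Proof.
move=> g0 gK; pose E := [set \sum_(i <- B) g i | B in [set: {fset I}]].
have E0 : E 0 by exists fset0 => //; rewrite big_seq_fset0.
have ubE : ubound E K by move=> _ [B _ <-]; exact: gK.
have hE : has_sup E by split; [exists 0 | exists K].
exists (sup E) => [|eps e0].
  by rewrite (ub_le_sup hE.2 E0)/= ge_sup//; exists 0.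
have [_ [A _ <-] hA] := sup_adherent e0 hE; exists A => B AB.
apply/andP; split; first exact: lt_le_trans hA (le_sum_fset g0 AB).
by apply: (ub_le_sup hE.2); exists B.
Qed.

Lemma sums_leP (I : choiceType) (g h : I -> R) K :
  (forall i, h i <= g i) -> sums_le g K -> sums_le h K.
Proof. by move=> hg gK B; apply: le_trans (gK B); apply: ler_sum. Qed.

Lemma has_sum_ex_nneg (I : choiceType) (g : I -> R) K :
  (forall i, 0 <= g i) -> sums_le g K -> exists s, has_sum (fun i => (g i)%:C) s.
Proof.
move=> g0 /(sums_le_sup g0)[s _ hs]; exists s%:C => e /hs[A hA]; exists A => B /hA.
move=> /andP[h1 h2]; rewrite -(raddf_sum (real_complex R)) -rmorphB normc_real.
rewrite ltr_norml; apply/andP; split; lra.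
Qed.

Lemma has_sum_ex_real (I : choiceType) (g : I -> R) K :
  sums_le (fun i => `|g i|) K -> exists s, has_sum (fun i => (g i)%:C) s.
Proof.
move=> gK.
have [||s hs] := @has_sum_ex_nneg _ (fun i => Num.max (g i) 0) K _ (sums_leP _ gK).
- by move=> i; rewrite le_max lexx orbT.
- by move=> i; rewrite ge_max ler_norm normr_ge0.
have [||t ht] := @has_sum_ex_nneg _ (fun i => Num.max (- g i) 0) K _ (sums_leP _ gK).
- by move=> i; rewrite le_max lexx orbT.
- by move=> i; rewrite ge_max -normrN ler_norm normr_ge0.
exists (s - t); apply: eq_has_sum (has_sumB hs ht) => i.
by rewrite -rmorphB; congr (_%:C); case: (leP (g i) 0) => h; case: leP => h'; lra.
Qed.

(** Monotone nets converge; a complex family is split into its real and imaginary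
parts and these into positive and negative parts. *)
Lemma has_sum_ex (I : choiceType) (f : I -> R[i]) K :
  sums_le (fun i => normc (f i)) K -> exists s, has_sum f s.
Proof.
move=> fK.
have [s hs] := has_sum_ex_real (sums_leP (fun i => le_Re_normc (f i)) fK).
have [t ht] := has_sum_ex_real (sums_leP (fun i => le_Im_normc (f i)) fK).
exists (s + 'i * t); apply: eq_has_sum (has_sumD hs (has_sumZ 'i ht)) => i.
by rewrite [RHS]complexE.
Qed.

Lemma has_sum_norm_le (I : choiceType) (f : I -> R[i]) s K :
  has_sum f s -> sums_le (fun i => normc (f i)) K -> normc s <= K.
Proof.
move=> h fK; apply/ler_addgt0Pl => e /h[A /(_ A (fsubset_refl _))].
set S := \sum_(_ <- _) _ => hS.
have -> : s = (s - S) + S by ring.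
rewrite (le_trans (le_normcD _ _))// lerD//; first by rewrite normc_distC ltW.
exact: le_trans (normc_sum _ _ _) (fK A).
Qed.

Lemma has_sum_reindex (I J : choiceType) (h : J -> I) (h' : I -> J) (f : I -> R[i]) s :
  cancel h h' -> cancel h' h -> has_sum f s -> has_sum (f \o h) s.
Proof.
move=> hK h'K H e /H[A hA]; exists [fset h' a | a in A]%fset => B AB.
have := hA [fset h b | b in B]%fset; rewrite big_imfset/=; last first.
  by move=> x y _ _ /(can_inj hK).
apply; apply/fsubsetP => a aA; apply/imfsetP; exists (h' a); rewrite ?h'K//=.
by apply: (fsubsetP AB); rewrite in_imfset.
Qed.

Lemma sums_le_prod (I J : choiceType) (g : I -> R) (h : J -> R) K L :
  (forall i, 0 <= g i) -> (forall j, 0 <= h j) ->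
  sums_le g K -> sums_le h L -> sums_le (fun p : I * J => g p.1 * h p.2) (K * L).
Proof.
move=> g0 h0 gK hL B.
pose A1 := [fset p.1 | p in B]%fset; pose A2 := [fset p.2 | p in B]%fset.
pose P := [fset ((i, j) : I * J) | i in A1, j in A2]%fset.
have BP : B <=f P.
  apply/fsubsetP => -[i j] pB; apply/imfset2P; exists i; first by apply/imfsetP; exists (i, j).
  by exists j => //; apply/imfsetP; exists (i, j).
apply: le_trans (le_sum_fset _ BP) _ => [p|]; first exact: mulr_ge0.
rewrite big_imfset2/=; last by move=> [? ?] [? ?] _ _ [-> ->].
have -> : \sum_(i <- A1) \sum_(j <- A2) g i * h j = (\sum_(i <- A1) g i) * (\sum_(j <- A2) h j).
  by rewrite mulr_suml; apply: eq_bigr => i _; rewrite mulr_sumr.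
by rewrite ler_pM// sumr_ge0.
Qed.

(** A finite set of columns is cut by the rectangles that contain a given finite set
of pairs; a rectangle with enough rows approximates each of its finitely many
column sums. *)
Lemma has_sum_fubini (I J : choiceType) (f : I * J -> R[i]) s (g : J -> R[i]) :
  has_sum f s -> (forall j, has_sum (fun i => f (i, j)) (g j)) -> has_sum g s.
Proof.
move=> hf hg e e0; have e20 := divr_gt0 e0 (ltr0n R 2).
have [A hA] := hf _ e20; exists [fset p.2 | p in A]%fset => B AB.
pose n : R := #|` B|%fset%:R + 1; have n0 : 0 < n by rewrite ltr_wpDl.
have /choice[W hW] : forall j, exists W : {fset I}, forall W', W <=f W' ->
    normc (\sum_(i <- W') f (i, j) - g j) < e / 2 / n.
  by move=> j; apply: hg; rewrite divr_gt0.
pose U := ([fset p.1 | p in A] `|` \bigcup_(j <- B) W j)%fset.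
pose P := [fset ((i, j) : I * J) | i in U, j in B]%fset.
have AP : A <=f P.
  apply/fsubsetP => -[i j] pA; apply/imfset2P; exists i.
    by rewrite inE; apply/orP; left; apply/imfsetP; exists (i, j).
  by exists j => //; apply: (fsubsetP AB); apply/imfsetP; exists (i, j).
have := hA _ AP; rewrite big_imfset2/=; last by move=> [? ?] [? ?] _ _ [-> ->].
rewrite exchange_big/=; set S := \sum_(_ <- _) _ => hS.
have -> : \sum_(j <- B) g j - s = (S - s) - \sum_(j <- B) (\sum_(i <- U) f (i, j) - g j).
  by rewrite big_split/= sumrN; rewrite /S; ring.
rewrite (le_lt_trans (le_normcB _ _))// [e]splitr ltr_leD//.
rewrite (le_trans (normc_sum _ _ _))//.
apply: (@le_trans _ _ (\sum_(j <- B) e / 2 / n)).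
  rewrite big_seq [leRHS]big_seq; apply: ler_sum => j jB; apply/ltW/hW.
  by apply: fsubset_trans (fsubsetUr _ _); exact: bigfcup_sup.
rewrite big_const_seq count_predT iter_addr_0 -[leLHS]mulr_natr mulrAC.
rewrite ler_pdivrMr// ler_wpM2l ?(ltW e20)//.
by rewrite /n lerDl.
Qed.

(** Dominated convergence: the majorant has small mass outside of a finite set, on
which finitely many terms tend to 0. *)
Lemma has_sum_tannery0 (I : choiceType) (f : nat -> I -> R[i]) (s : nat -> R[i])
    (g : I -> R) K :
  (forall n i, normc (f n i) <= g i) -> sums_le g K ->
  (forall i, f n i @[n --> \oo] --> (0 : R[i])) -> (forall n, has_sum (f n) (s n)) ->
  s n @[n --> \oo] --> (0 : R[i]).
Proof.
move=> fg gK f0 fs; apply/cvg_normcP => e e0.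
have g0 i : 0 <= g i by apply: le_trans (fg 0%N i); exact: normc_ge0.
have e40 : 0 < e / 4 by rewrite divr_gt0.
have [S _ /(_ _ e40)[A hA]] := sums_le_sup g0 gK.
have /cvg_normcP/(_ _ e40) : (\sum_(i <- A) f n i) @[n --> \oo] --> (0 : R[i]).
  have := @cvg_sumC _ _ _ \oo _ A predT (fun i n => f n i) (fun=> 0) (fun i _ => f0 i).
  by rewrite big1_eq; apply.
apply: filterS => n; rewrite !subr0 => hn.
have [A' hA'] := fs n _ e40; have := hA' _ (fsubsetUr A A').
have /hA/andP[_ US] := fsubsetUl A A'; have /hA/andP[SA _] := fsubset_refl A.
have eF : \sum_(i <- (A `|` A')%fset) (if i \in A then f n i else 0) = \sum_(i <- A) f n i.
  rewrite -(big_fset_incl _ (fsubsetUl A A')) => [|i _ /negbTE->//].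
  by rewrite big_seq [RHS]big_seq; apply: eq_bigr => i ->.
rewrite -{}eF in hn.
have eA : \sum_(i <- (A `|` A')%fset) (if i \in A then g i else 0) = \sum_(i <- A) g i.
  rewrite -(big_fset_incl _ (fsubsetUl A A')) => [|i _ /negbTE->//].
  by rewrite big_seq [RHS]big_seq; apply: eq_bigr => i ->.
have h1 : normc (\sum_(i <- (A `|` A')%fset) f n i -
    \sum_(i <- (A `|` A')%fset) (if i \in A then f n i else 0)) <= e / 4.
  rewrite -sumrB (le_trans (normc_sum _ _ _))//.
  apply: (@le_trans _ _ (\sum_(i <- (A `|` A')%fset) (g i - (if i \in A then g i else 0)))).
    apply: ler_sum => i _; case: ifP => _; first by rewrite !subrr normc0.
    by rewrite !subr0.
  by rewrite sumrB eA; lra.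
move: hn h1; set T := \sum_(_ <- _) f n _; set T' := \sum_(_ <- _) _ => hn h1 h2.
have -> : s n = T' + (T - T') - (T - s n) by ring.
have := le_normcB (T' + (T - T')) (T - s n).
have := le_normcD T' (T - T'); lra.
Qed.

Lemma has_sum_tannery (I : choiceType) (f : nat -> I -> R[i]) (s : nat -> R[i])
    (fo : I -> R[i]) (so : R[i]) (g : I -> R) K :
  (forall n i, normc (f n i) <= g i) -> (forall i, normc (fo i) <= g i) -> sums_le g K ->
  (forall i, f n i @[n --> \oo] --> fo i) -> (forall n, has_sum (f n) (s n)) ->
  has_sum fo so -> s n @[n --> \oo] --> so.
Proof.
move=> fg fog gK f0 fs foso; apply: (iffLR (subr_cvg0C s so)).
apply: (@has_sum_tannery0 _ (fun n i => f n i - fo i) _ (fun i => g i + g i) (K + K)).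
- by move=> n i; rewrite (le_trans (le_normcB _ _))// lerD.
- by move=> B; rewrite big_split lerD.
- by move=> i; exact: (iffRL (subr_cvg0C (f^~ i) (fo i))).
- by move=> n; exact: has_sumB.
Qed.

End HasSum.

(** * The complex exponential *)

Section Cexp.
Context {R : realType}.
Implicit Types (x y : R) (u v : R[i]).

Lemma cReD u v : complex.Re (u + v) = complex.Re u + complex.Re v.
Proof. by case: u v => ? ? []. Qed.
Lemma cImD u v : complex.Im (u + v) = complex.Im u + complex.Im v.
Proof. by case: u v => ? ? []. Qed.
Lemma cReN u : complex.Re (- u) = - complex.Re u.
Proof. by case: u. Qed.
Lemma cImN u : complex.Im (- u) = - complex.Im u.
Proof. by case: u. Qed.
Lemma cReM u v : complex.Re (u * v) = complex.Re u * complex.Re v - complex.Im u * complex.Im v.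
Proof. by case: u v => ? ? []. Qed.
Lemma cImM u v : complex.Im (u * v) = complex.Re u * complex.Im v + complex.Im u * complex.Re v.
Proof. by case: u v => ? ? []. Qed.

Lemma normc_eq_le u v x : u = v -> normc v <= x -> normc u <= x.
Proof. by move=> ->. Qed.

Lemma cexp0 : cexp 0 = 1 :> R[i].
Proof. by rewrite /cexp /= expR0 cos0 sin0 mul1r. Qed.

Lemma cexpD u v : cexp (u + v) = cexp u * cexp v.
Proof.
case: u v => a b [c d]; rewrite /cexp /= expRD cosD sinD rmorphM mulrACA; congr (_ * _).
by apply/eqP; rewrite eq_complex /=; apply/andP; split; apply/eqP; ring.
Qed.

Lemma normc_cexp u : normc (cexp u) = expR (complex.Re u).
Proof.
rewrite /cexp normcM normc_real ger0_norm ?expR_ge0//=.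
by rewrite cos2Dsin2 sqrtr1 mulr1.
Qed.

Lemma cexp_real x : cexp x%:C = (expR x)%:C.
Proof. by rewrite /cexp /= cos0 sin0 mulr1. Qed.

Lemma expR_subr1_le x : `|expR x - 1| <= `|x| * expR `|x|.
Proof.
have h1 := expR_ge1Dx x; have h2 := expR_ge1Dx (- x).
have e0 := expR_gt0 x; have eN : expR (- x) * expR x = 1 by rewrite -expRD addNr expR0.
have h3 : expR x - 1 <= x * expR x by nra.
case: (leP 0 x) => x0.
  by rewrite (ger0_norm x0) ger0_norm ?subr_ge0//; lra.
rewrite (ltr0_norm x0) ler0_norm; last by nra.
have := expR_ge1Dx (- x); nra.
Qed.

Lemma expR_subr1x_le x : `|expR x - 1 - x| <= x ^+ 2 * expR `|x|.
Proof.
have h1 := expR_ge1Dx x; have h2 := expR_ge1Dx (- x).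
have e0 := expR_gt0 x; have eN : expR (- x) * expR x = 1 by rewrite -expRD addNr expR0.
have h3 : expR x - 1 <= x * expR x by nra.
rewrite ger0_norm; last by lra.
case: (leP 0 x) => x0.
  by rewrite (ger0_norm x0); nra.
rewrite (ltr0_norm x0); have := expR_ge1Dx (- x); nra.
Qed.

Lemma MVT_le (f f' : R -> R) (B x : R) : f 0 = 0 ->
  (forall y, is_derive y 1 f (f' y)) ->
  (forall y, `|y| <= `|x| -> `|f' y| <= B) -> `|f x| <= B * `|x|.
Proof.
move=> f0 fd fB; have fc : continuous f.
  by move=> y; apply/differentiable_continuous/derivable1_diffP; have [] := fd y.
have [->|x0] := eqVneq x 0; first by rewrite f0 normr0 mulr0.
have [x0'|x0'] := ltP 0 x.
  have [] := @MVT _ f f' 0 x x0' (fun y _ => fd y); first exact: continuous_subspaceT.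
  move=> c; rewrite in_itv/= => /andP[c0 cx]; rewrite f0 !subr0 => ->.
  by rewrite normrM ler_wpM2r// fB// !gtr0_norm// ltW.
have {x0 x0'}x0 : x < 0 by rewrite lt_neqAle x0.
have [] := @MVT _ f f' x 0 x0 (fun y _ => fd y); first exact: continuous_subspaceT.
move=> c; rewrite in_itv/= => /andP[c0 cx]; rewrite f0 sub0r => /eqP; rewrite eqr_oppLR => /eqP ->.
by rewrite sub0r mulrN opprK normrM ler_wpM2r// fB// !ltr0_norm// lerN2 ltW.
Qed.

Lemma norm_sin_le x : `|sin x| <= `|x|.
Proof.
rewrite -[leRHS]mul1r; apply: (@MVT_le _ cos); first exact: sin0.
by move=> y _; exact: cos_max.
Qed.

Lemma norm_cos_sub1_le (x : R) : `|cos x - 1| <= `|x| * `|x|.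
Proof.
apply: (@MVT_le (fun x => cos x - 1) (fun x => - sin x)); first by rewrite cos0 subrr.
  by move=> y; apply: is_derive_eq; rewrite oppr0 addr0.
by move=> y yx; rewrite normrN (le_trans (norm_sin_le _)).
Qed.

Lemma norm_cos_sub1_le1 (x : R) : `|cos x - 1| <= `|x|.
Proof.
rewrite -[leRHS]mul1r; apply: (@MVT_le (fun x => cos x - 1) (fun x => - sin x)); first by rewrite cos0 subrr.
  by move=> y; apply: is_derive_eq; rewrite oppr0 addr0.
by move=> y yx; rewrite normrN sin_max.
Qed.

Lemma norm_sin_subx_le (x : R) : `|sin x - x| <= `|x| * `|x|.
Proof.
apply: (@MVT_le (fun x => sin x - x) (fun x => cos x - 1)); first by rewrite sin0 subrr.
by move=> y yx; rewrite (le_trans (norm_cos_sub1_le1 _)).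
Qed.

(** The factor [expR (normc u)] makes the Taylor estimate global, so that it can be
absorbed by a Gaussian. *)
Lemma cexp_taylor_le u : normc (cexp u - 1 - u) <= 4 * normc u ^+ 2 * expR (normc u).
Proof.
have := le_Re_normc u; have := le_Im_normc u.
case: u => x y; set N := normc (x +i* y) => yN xN.
rewrite /= in yN xN.
have N0 : 0 <= N by exact: le_trans xN.
have EN : expR `|x| <= expR N by rewrite ler_expR.
have Ex : expR x <= expR N by rewrite ler_expR (le_trans _ xN)// ler_norm.
apply: le_trans (normc_le_ReIm _) _; rewrite /= mul0r subr0 mul0r addr0 subr0.
have E0 := expR_gt0 N; have e0 := expR_gt0 x.
have x2 : x ^+ 2 <= N ^+ 2 by rewrite -real_normK ?num_real// lerXn2r ?nnegrE.
have y2 : `|y| * `|y| <= N ^+ 2 by rewrite expr2 ler_pM.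
have -> : expR x * cos y - 1 - x = (expR x - 1 - x) + expR x * (cos y - 1) by ring.
have -> : expR x * sin y - y = expR x * (sin y - y) + (expR x - 1) * y by ring.
have b1 : `|expR x - 1 - x| <= N ^+ 2 * expR N.
  by apply: le_trans (expR_subr1x_le _) _; apply: ler_pM; rewrite ?sqr_ge0 ?expR_ge0.
have b2 : `|expR x * (cos y - 1)| <= N ^+ 2 * expR N.
  rewrite normrM (ger0_norm (ltW e0)) [leLHS]mulrC.
  apply: ler_pM; rewrite ?(ltW e0)//.
  exact: le_trans (norm_cos_sub1_le _) _.
have b3 : `|expR x * (sin y - y)| <= N ^+ 2 * expR N.
  rewrite normrM (ger0_norm (ltW e0)) [leLHS]mulrC.
  apply: ler_pM; rewrite ?(ltW e0)//.
  exact: le_trans (norm_sin_subx_le _) _.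
have b4 : `|(expR x - 1) * y| <= N ^+ 2 * expR N.
  rewrite normrM expr2 mulrAC; apply: ler_pM => //.
  by apply: le_trans (expR_subr1_le _) _; apply: ler_pM; rewrite ?expR_ge0.
have := ler_normD (expR x - 1 - x) (expR x * (cos y - 1)).
have := ler_normD (expR x * (sin y - y)) ((expR x - 1) * y).
lra.
Qed.

End Cexp.

(** * Sums over a fine mesh of the line *)

Section Weights.
Context {R : realType}.
Local Notation "A <=f B" := (fsubset A B) (at level 70).

Definition csum (I : choiceType) (f : I -> R[i]) : R[i] := summability.sum f.

Lemma has_sum_csum (I : choiceType) (f : I -> R[i]) K :
  sums_le (fun i => normc (f i)) K -> has_sum f (csum f).
Proof. by move=> /has_sum_ex[s hs]; rewrite /csum (has_sum_sum hs). Qed.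

Lemma geom_sum_le (q : R) N : 0 <= q -> q < 1 ->
  (\sum_(0 <= i < N) q ^+ i) * (1 - q) <= 1.
Proof.
move=> q0 q1; suff -> : (\sum_(0 <= i < N) q ^+ i) * (1 - q) = 1 - q ^+ N.
  by rewrite gerBl exprn_ge0.
elim: N => [|N IH]; first by rewrite big_nil mul0r expr0 subrr.
by rewrite big_nat_recr//= mulrDl IH exprS; ring.
Qed.

(** The order of magnitude 1/t is that of an integral over the line approximated
by a mesh t. *)
Lemma sums_le_geom (t : R) : 0 < t -> t <= 1 ->
  sums_le (fun k : int => expR (- `|t * k%:~R|)) (4 / t).
Proof.
move=> t0 t1 B; pose q := expR (- t).
have q0 : 0 < q := expR_gt0 _.
have q1 : (1 + t) * q <= 1.
  have := expR_ge1Dx t; rewrite /q expRN => h.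
  by rewrite ler_pdivrMr ?expR_gt0// mul1r.
have qlt1 : q < 1 by nra.
have qE (n : nat) : expR (- `|t * n%:R|) = q ^+ n.
  by rewrite ger0_norm ?mulr_ge0 ?(ltW t0)// -mulNr mulrC expRM_natl.
have [N NE] : {N | N = (\max_(k <- B) `|k|%N).+1} by eexists.
pose P := [fset Posz i | i in iota 0 N]%fset.
pose M := [fset (- Posz i)%R | i in iota 0 N]%fset.
have BPM : B <=f (P `|` M)%fset.
  apply/fsubsetP => k kB; rewrite inE; have kN : (`|k| < N)%N.
    by rewrite NE ltnS; apply: leq_bigmax_seq.
  case: (leP 0 k) => k0.
    by apply/orP; left; apply/imfsetP; exists `|k|%N; rewrite ?mem_iota//= gez0_abs.
  by apply/orP; right; apply/imfsetP; exists `|k|%N; rewrite ?mem_iota//= ltz0_abs// opprK.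
apply: le_trans (le_sum_fset _ BPM) _ => [k|]; first exact: expR_ge0.
pose g (k : int) : R := expR (- `|t * k%:~R|).
have g0 k : 0 <= g k by exact: expR_ge0.
have hU : \sum_(i <- (P `|` M)%fset) g i <= \sum_(i <- P) g i + \sum_(i <- M) g i.
  have e1 : \sum_(i <- P) g i = \sum_(i <- (P `|` M)%fset) (if i \in P then g i else 0).
    rewrite -(big_fset_incl _ (fsubsetUl P M)) => [|i _ /negbTE->//].
    by rewrite big_seq [RHS]big_seq; apply: eq_bigr => i ->.
  have e2 : \sum_(i <- M) g i = \sum_(i <- (P `|` M)%fset) (if i \in M then g i else 0).
    rewrite -(big_fset_incl _ (fsubsetUr P M)) => [|i _ /negbTE->//].
    by rewrite big_seq [RHS]big_seq; apply: eq_bigr => i ->.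
  rewrite e1 e2 -big_split/= big_seq [leRHS]big_seq; apply: ler_sum => i.
  rewrite inE; case: (i \in P) => /=; case: (i \in M) => //= _; have := g0 i; lra.
apply: le_trans hU _.
have eP : \sum_(i <- P) g i = \sum_(0 <= i < N) q ^+ i.
  rewrite /P big_imfset/=; last by move=> x y _ _ [].
  by rewrite undup_id ?iota_uniq// /index_iota subn0; apply: eq_bigr => i _; rewrite /g -qE.
have eM : \sum_(i <- M) g i = \sum_(0 <= i < N) q ^+ i.
  rewrite /M big_imfset/=; last by move=> x y _ _ /oppr_inj[].
  rewrite undup_id ?iota_uniq// /index_iota subn0; apply: eq_bigr => i _.
  by rewrite /g -qE rmorphN mulrN normrN.
rewrite eP eM ler_pdivlMr//; have := geom_sum_le N (ltW q0) qlt1.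
have : 0 <= \sum_(0 <= i < N) q ^+ i by apply: sumr_ge0 => i _; rewrite exprn_ge0// ltW.
nra.
Qed.

Lemma sums_leZ (I : choiceType) (g : I -> R) K c :
  0 <= c -> sums_le g K -> sums_le (fun i => c * g i) (c * K).
Proof. by move=> c0 gK B; rewrite -mulr_sumr ler_wpM2l. Qed.

Definition exp_weight (x : R) := expR (- `|x|).

Lemma exp_weight_gt0 x : 0 < exp_weight x. Proof. exact: expR_gt0. Qed.

Lemma sums_le_exp_weight (t K : R) (f : int -> R[i]) : 0 < t -> t <= 1 -> 0 <= K ->
  (forall k, normc (f k) <= K * exp_weight (t * k%:~R)) ->
  sums_le (fun k => normc (f k)) (K * (4 / t)).
Proof.
by move=> t0 t1 K0 fK; apply: sums_leP fK (sums_leZ K0 (sums_le_geom t0 t1)).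
Qed.

(** Sums over a mesh t normally have size 1/t.  When chi is a derivative, the
increments of its primitive Psi telescope to 0 over the integers, and only the
quadratic errors remain, so the sum stays bounded as t tends to 0. *)
Lemma riemann_by_parts (t K : R) (Psi chi : R -> R[i]) : 0 < t -> t <= 1 -> 0 <= K ->
  (forall x, normc (Psi x) <= K * exp_weight x) ->
  (forall x, normc (Psi (x + t) - Psi x - t%:C * chi x) <= K * t ^+ 2 * exp_weight x) ->
  exists2 s, has_sum (fun k : int => chi (t * k%:~R)) s & normc s <= 4 * K.
Proof.
move=> t0 t1 K0 hPsi hchi; have tN0 : t%:C != 0 :> R[i].
  by rewrite -normc_eq0 normc_real normr_eq0 gt_eqF.
have hP := has_sum_csum (sums_le_exp_weight t0 t1 K0 (fun k => hPsi _)).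
set P := csum _ in hP.
have hP1 : has_sum (fun k : int => Psi (t * k%:~R + t)) P.
  have := has_sum_reindex (h := fun k : int => k + 1) (h' := fun k => k - 1) (addrK 1) (subrK 1) hP.
  by apply: eq_has_sum => k /=; rewrite rmorphD/= mulrDr mulr1.
have hb := sums_le_exp_weight t0 t1 (mulr_ge0 K0 (sqr_ge0 t)) (fun k => hchi _).
have hE := has_sum_csum hb; set E := csum _ in hE.
have := has_sumZ t%:C^-1 (has_sumB (has_sumB hP1 hP) hE); rewrite subrr sub0r => hs.
exists (t%:C^-1 * - E).
  by apply: eq_has_sum hs => k /=; rewrite opprB addrC subrK mulKf.
have := has_sum_norm_le hE hb.
rewrite normcM normcV normc_real gtr0_norm// normcN ler_pdivrMl//.
have -> : K * t ^+ 2 * (4 / t) = t * (4 * K) by field; rewrite gt_eqF.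
by [].
Qed.

(** Integration of a derivative bound along [0,1] without differentiability in the
parameter: over N steps the quadratic errors add up to O(1/N). *)
Lemma path_increment (D : R -> R[i]) (c1 c2 : R) (N0 : nat) :
  (forall s d, 0 <= s -> 0 < d -> s + d <= 1 -> d <= N0.+1%:R^-1 ->
     normc (D (s + d) - D s) <= c1 * d ^+ 2 + c2 * d) ->
  normc (D 1 - D 0) <= c2.
Proof.
move=> hD; apply/ler_addgt0Pr => e e0.
(* N makes the steps admissible and gives c1 / N <= e. *)
pose N := (maxn N0.+1 (Num.truncn (`|c1| / e)).+1).
have N0' : (0 < N)%N by rewrite /N leq_max.
have Nr : (0 : R) < N%:R by rewrite ltr0n.
have hN : `|c1| <= e * N%:R.
  rewrite mulrC -ler_pdivrMr// ltW// (lt_le_trans (truncnS_gt _))//.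
  by rewrite ler_nat leq_max leqnn orbT.
have step i : (i <= N)%N -> normc (D (i%:R / N%:R) - D 0) <= i%:R * (c1 * N%:R^-1 ^+ 2 + c2 * N%:R^-1).
  elim: i => [|i IH] iN; first by rewrite mul0r subrr normc0 mul0r.
  have -> : i.+1%:R / N%:R = i%:R / N%:R + N%:R^-1 :> R by rewrite -natr1 mulrDl mul1r.
  set s := i%:R / _; set d := N%:R^-1.
  have -> : D (s + d) - D 0 = (D (s + d) - D s) + (D s - D 0) by ring.
  apply: le_trans (le_normcD _ _) _; rewrite -natr1 mulrDl mul1r addrC lerD ?IH 1?ltnW//.
  apply: hD; rewrite ?invr_gt0 ?divr_ge0//.
    by rewrite -[d]mul1r -mulrDl natr1 ler_pdivrMr// mul1r ler_nat.
  by rewrite lef_pV2 ?posrE ?ltr0n// ler_nat leq_max leqnn.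
have := step N (leqnn _); rewrite divff ?gt_eqF// => /le_trans; apply.
have -> : N%:R * (c1 * N%:R^-1 ^+ 2 + c2 * N%:R^-1) = c2 + c1 / N%:R.
  by field; rewrite gt_eqF.
by rewrite lerD2l ler_pdivrMr// (le_trans (ler_norm _)).
Qed.

End Weights.

(** * Gaussian sums *)

Section Gauss.
Context {R : realType}.
Implicit Types (al X y ze : R[i]) (x t a L M : R).

Definition gauss al X : R[i] := cexp (al * X ^+ 2).

Lemma normc_nat n : normc (n%:R : R[i]) = n%:R.
Proof. by rewrite -[n%:R](rmorph_nat (real_complex R)) normc_real normr_nat. Qed.

Lemma Re_scale x (z : R[i]) : complex.Re (x%:C * z) = x * complex.Re z.
Proof. by rewrite cReM /= mul0r subr0. Qed.

Lemma expR_quad_le a L M x : 0 < a ->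
  expR (- a * x ^+ 2 + L * `|x| + M) <=
  expR ((L + 2) ^+ 2 / (4 * a) + M) * expR (- (2 * `|x|)).
Proof.
move=> a0; rewrite -expRD ler_expR -[x ^+ 2]real_normK ?num_real//.
set n := `|x|; rewrite -subr_ge0.
have -> : (L + 2) ^+ 2 / (4 * a) + M - 2 * n - (- a * n ^+ 2 + L * n + M) =
          (2 * a * n - (L + 2)) ^+ 2 / (4 * a) by field; rewrite gt_eqF.
by rewrite divr_ge0 ?sqr_ge0// mulr_ge0// ltW.
Qed.

Lemma exp_weight_ge2 x : expR (- (2 * `|x|)) <= exp_weight x.
Proof. by rewrite ler_expR; have := normr_ge0 x; lra. Qed.

Lemma gauss_norm_le a A H al x y : 0 < a -> complex.Re al <= - a -> normc al <= A -> normc y <= H ->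
  normc (gauss al (x%:C + y)) <= expR (- a * x ^+ 2 + 2 * A * H * `|x| + A * H ^+ 2).
Proof.
move=> a0 ala alA yH; rewrite normc_cexp ler_expR.
have -> : al * (x%:C + y) ^+ 2 = (x ^+ 2)%:C * al + (2 * x)%:C * (al * y) + al * y ^+ 2.
  by rewrite rmorphXn rmorphM rmorph_nat; ring.
have h0 : 0 <= normc al by exact: normc_ge0.
have h1 : 0 <= normc y by exact: normc_ge0.
rewrite !cReD !Re_scale; apply: lerD; first apply: lerD.
- by rewrite mulrC ler_wpM2r ?sqr_ge0.
- rewrite (le_trans (ler_norm _))// normrM normrM normr_nat.
  rewrite -!mulrA ler_wpM2l// mulrA mulrC ler_wpM2r//.
  by rewrite (le_trans (le_Re_normc _))// normcM ler_pM.
- rewrite (le_trans (ler_norm _))// (le_trans (le_Re_normc _))// normcM normcX.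
  by rewrite ler_pM ?sqr_ge0// lerXn2r ?nnegrE// (le_trans _ yH).
Qed.

Lemma gauss_bound a A H : 0 < a -> exists2 K : R, 0 <= K &
  forall al x y, complex.Re al <= - a -> normc al <= A -> normc y <= H ->
  normc (gauss al (x%:C + y)) <= K * expR (- (2 * `|x|)).
Proof.
move=> a0; eexists; last first.
  move=> al x y h1 h2 h3; apply: le_trans (gauss_norm_le _ a0 h1 h2 h3) _.
  exact: expR_quad_le.
exact: expR_ge0.
Qed.

Lemma le_expR x : x <= expR x.
Proof. by have := expR_ge1Dx x; lra. Qed.

(** Taylor estimate in the shift, uniform in al and y; the exponential factor is what
is left of the Gaussian decay and makes the errors summable over a mesh. *)
Lemma gauss_shift a A H : 0 < a -> 0 <= A -> 0 <= H -> exists2 K : R, 0 <= K &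
  forall al x y ze, complex.Re al <= - a -> normc al <= A -> normc y <= H -> normc ze <= 1 ->
  normc (gauss al (x%:C + y + ze) - gauss al (x%:C + y) * (1 + 2 * al * (x%:C + y) * ze))
    <= K * normc ze ^+ 2 * expR (- (2 * `|x|)).
Proof.
move=> a0 A0 H0.
(* The exponent is the one of [expR_quad_le] for the bound of the Gaussian plus 3 P,
   where z P bounds the increment u of the exponent. *)
exists ((4 + A) * expR (((2 * A * H + 6 * A) + 2) ^+ 2 / (4 * a) + (A * H ^+ 2 + 6 * A * H + 3 * A))).
  by rewrite mulr_ge0 ?expR_ge0// addr_ge0.
move=> al x y ze h1 h2 h3 h4; set X := x%:C + y; set z := normc ze in h4 *.
have z0 : 0 <= z by exact: normc_ge0.
pose u := 2 * al * X * ze + al * ze ^+ 2.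
pose P := 2 * A * (`|x| + H) + A.
have P0 : 0 <= P by rewrite addr_ge0// !mulr_ge0// addr_ge0.
have XN : normc X <= `|x| + H by rewrite (le_trans (le_normcD _ _))// normc_real lerD2l.
have uP : normc u <= z * P.
  have e2 : normc (al * ze ^+ 2) = normc al * z ^+ 2 by rewrite normcM normcX.
  rewrite (le_trans (le_normcD _ _))// e2 !normcM normc_nat -/z.
  have -> : z * P = 2 * A * (`|x| + H) * z + A * z by rewrite /P; ring.
  apply: lerD; first by rewrite ler_wpM2r// ler_pM ?mulr_ge0 ?normc_ge0// ler_wpM2l.
  rewrite ler_pM ?normc_ge0 ?sqr_ge0// expr2; nra.
have uP1 : z * P <= P by rewrite ler_piMl.
have -> : gauss al (X + ze) = gauss al X * cexp u.
  by rewrite -cexpD; congr cexp; rewrite /u; ring.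
have -> : gauss al X * cexp u - gauss al X * (1 + 2 * al * X * ze) =
          gauss al X * ((cexp u - 1 - u) + al * ze ^+ 2) by rewrite /u; ring.
rewrite normcM; set Q := - a * x ^+ 2 + 2 * A * H * `|x| + A * H ^+ 2.
have gQ : normc (gauss al X) <= expR Q by exact: gauss_norm_le.
have ep := expR_gt0 P.
have hE : normc (cexp u - 1 - u + al * ze ^+ 2) <= (4 + A) * z ^+ 2 * expR (3 * P).
  have -> : expR (3 * P) = expR P ^+ 3 by rewrite -expRM_natl.
  apply: le_trans (le_normcD _ _) _.
  have e1 : 1 <= expR P by rewrite -expR0 ler_expR.
  have b1 : normc (cexp u - 1 - u) <= 4 * z ^+ 2 * expR P ^+ 3.
    apply: le_trans (cexp_taylor_le _) _.
    have -> : 4 * z ^+ 2 * expR P ^+ 3 = 4 * (z ^+ 2 * expR P ^+ 2) * expR P by ring.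
    have hu : normc u ^+ 2 <= z ^+ 2 * expR P ^+ 2.
      rewrite -exprMn lerXn2r ?nnegrE ?normc_ge0//; first by rewrite mulr_ge0 ?expR_ge0.
      by rewrite (le_trans uP)// ler_wpM2l// le_expR.
    have hEu : expR (normc u) <= expR P by rewrite ler_expR (le_trans uP).
    apply: ler_pM; rewrite ?expR_ge0//; first by rewrite mulr_ge0 ?sqr_ge0.
    by rewrite ler_wpM2l.
  have b2 : normc (al * ze ^+ 2) <= A * z ^+ 2 * expR P ^+ 3.
    rewrite normcM normcX -/z -[leLHS]mulr1 ler_pM ?mulr_ge0 ?normc_ge0 ?sqr_ge0 ?expr_ge1//.
    by rewrite ler_wpM2r ?sqr_ge0.
  lra.
have -> : (4 + A) * expR (((2 * A * H + 6 * A) + 2) ^+ 2 / (4 * a) + (A * H ^+ 2 + 6 * A * H + 3 * A))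
   * z ^+ 2 * expR (- (2 * `|x|)) = (4 + A) * z ^+ 2 *
  (expR (((2 * A * H + 6 * A) + 2) ^+ 2 / (4 * a) + (A * H ^+ 2 + 6 * A * H + 3 * A)) * expR (- (2 * `|x|))) by ring.
apply: (@le_trans _ _ (expR Q * ((4 + A) * z ^+ 2 * expR (3 * P)))).
  by rewrite ler_pM ?normc_ge0.
rewrite mulrCA ler_wpM2l//; first by rewrite mulr_ge0 ?sqr_ge0// addr_ge0.
rewrite -[leLHS]expRD; apply: le_trans (expR_quad_le _ _ _ a0); rewrite ler_expR /Q /P; lra.
Qed.

(** Half of the Gaussian decay is spent on the exponential of the increment of the
exponent, hence the bound on [ze]. *)
Lemma gauss_param a : 0 < a -> exists2 K : R, 0 <= K &
  forall al x ze, complex.Re al <= - a -> normc ze <= a / 2 ->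
  normc (gauss (al + ze) x%:C - gauss al x%:C * (1 + ze * x%:C ^+ 2))
    <= K * normc ze ^+ 2 * expR (- (2 * `|x|)).
Proof.
move=> a0; have a20 : 0 < a / 2 by rewrite divr_gt0.
exists (4 * expR ((4 + 2) ^+ 2 / (4 * (a / 2)) + 0)).
  by rewrite mulr_ge0 ?expR_ge0.
move=> al x ze h1 h2; set z := normc ze in h2 *.
have z0 : 0 <= z by exact: normc_ge0.
pose u := ze * x%:C ^+ 2.
have -> : gauss (al + ze) x%:C = gauss al x%:C * cexp u by rewrite /gauss mulrDl cexpD.
have -> : gauss al x%:C * cexp u - gauss al x%:C * (1 + ze * x%:C ^+ 2) =
          gauss al x%:C * (cexp u - 1 - u) by rewrite /u; ring.
have uN : normc u = z * x ^+ 2.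
  by rewrite /u normcM normcX normc_real real_normK ?num_real.
rewrite normcM; have x20 := sqr_ge0 x.
have gQ : normc (gauss al x%:C) <= expR (- a * x ^+ 2).
  by rewrite normc_cexp ler_expR mulrC -rmorphXn Re_scale mulrC ler_wpM2r.
apply: (@le_trans _ _ (expR (- a * x ^+ 2) * (4 * (z * x ^+ 2) ^+ 2 * expR (a / 2 * x ^+ 2)))).
  rewrite ler_pM ?normc_ge0//; apply: le_trans (cexp_taylor_le _) _; rewrite uN.
  apply: ler_wpM2l; first by rewrite mulr_ge0 ?sqr_ge0.
  by rewrite ler_expR ler_wpM2r.
have -> : 4 * expR ((4 + 2) ^+ 2 / (4 * (a / 2)) + 0) * z ^+ 2 * expR (- (2 * `|x|)) =
  4 * z ^+ 2 * (expR ((4 + 2) ^+ 2 / (4 * (a / 2)) + 0) * expR (- (2 * `|x|))) by ring.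
have -> : expR (- a * x ^+ 2) * (4 * (z * x ^+ 2) ^+ 2 * expR (a / 2 * x ^+ 2)) =
  4 * z ^+ 2 * (x ^+ 4 * (expR (- a * x ^+ 2) * expR (a / 2 * x ^+ 2))) by ring.
rewrite ler_wpM2l ?mulr_ge0 ?sqr_ge0//; apply: le_trans (expR_quad_le _ _ _ a20).
rewrite -expRD addr0.
have -> : - a * x ^+ 2 + a / 2 * x ^+ 2 = - (a / 2) * x ^+ 2 by field.
rewrite expRD mulrC.
rewrite ler_wpM2l ?expR_ge0// expRM_natl -[x ^+ 4]ger0_norm ?exprn_even_ge0// normrX.
by rewrite lerXn2r ?nnegrE ?expR_ge0// le_expR.
Qed.

(** t times this is a Riemann sum of the Gaussian integral of exp (al (x + y)^2). *)
Definition gsum al y t : R[i] := csum (fun k : int => gauss al ((t * k%:~R)%:C + y)).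

Lemma gsum_has_sum a A H : 0 < a -> exists2 K : R, 0 <= K &
  forall al y t, complex.Re al <= - a -> normc al <= A -> normc y <= H -> 0 < t -> t <= 1 ->
  has_sum (fun k : int => gauss al ((t * k%:~R)%:C + y)) (gsum al y t) /\
  normc (gsum al y t) <= K / t.
Proof.
move=> a0; have [K K0 hK] := gauss_bound A H a0; exists (K * 4); first by rewrite mulr_ge0.
move=> al y t h1 h2 h3 t0 t1.
have hb : sums_le (fun k : int => normc (gauss al ((t * k%:~R)%:C + y))) (K * (4 / t)).
  apply: sums_le_exp_weight => // k; apply: le_trans (hK _ _ _ h1 h2 h3) _.
  by rewrite ler_wpM2l// exp_weight_ge2.
split; first exact: has_sum_csum hb.
by rewrite -mulrA; exact: has_sum_norm_le (has_sum_csum hb) hb.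
Qed.

(** A Gaussian integral is invariant under complex translations: the derivative of
the sum in the translation parameter is a sum of a derivative in x. *)
Lemma gsum_shift al eta : complex.Re al < 0 -> exists2 C : R, 0 <= C &
  forall t, 0 < t -> t <= 1 -> normc (gsum al eta t - gsum al 0 t) <= C.
Proof.
move=> al0; pose a := - complex.Re al; have a0 : 0 < a by rewrite oppr_gt0.
have ala : complex.Re al <= - a by rewrite opprK.
pose A := normc al; pose H := normc eta.
have A0 : 0 <= A := normc_ge0 _; have H0 : 0 <= H := normc_ge0 _.
have [K K0 hK] := gauss_shift a0 A0 H0.
have [K1 K10 hK1] := gauss_bound A H a0.
have [K2 K20 hK2] := gsum_has_sum A H a0.
exists (4 * (K + K1) * H); first by rewrite !mulr_ge0 ?addr_ge0.
move=> t t0 t1.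
have := @path_increment _ (fun s => gsum al (s%:C * eta) t) (K * H ^+ 2 * (4 / t))
  (4 * (K + K1) * H) (Num.truncn H); rewrite mul1r mul0r; apply.
move=> s d s0 d0 sd1 dN.
have s1 : s <= 1 by apply: le_trans sd1; rewrite lerDl ltW.
have seta : normc (s%:C * eta) <= H by rewrite normcM normc_real ger0_norm// ler_piMl.
have sdeta : normc ((s + d)%:C * eta) <= H.
  by rewrite normcM normc_real ger0_norm ?ler_piMl// addr_ge0// ltW.
have deta : normc (d%:C * eta) <= 1.
  rewrite normcM normc_real gtr0_norm// -/H.
  apply: le_trans (ler_wpM2r H0 dN) _; rewrite ler_pdivrMl ?ltr0n// mulr1.
  exact/ltW/truncnS_gt.
have [|||chi hchi chiN] := @riemann_by_parts _ t (K + K1) (fun x => gauss al (x%:C + s%:C * eta))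
   (fun x => 2 * al * (x%:C + s%:C * eta) * gauss al (x%:C + s%:C * eta)) t0 t1.
- exact: addr_ge0.
- move=> x; apply: le_trans (hK1 _ _ _ ala (lexx _) seta) _.
  by rewrite ler_pM ?expR_ge0 ?exp_weight_ge2// lerDr.
- move=> x; have tN : normc t%:C <= 1 by rewrite normc_real gtr0_norm.
  have := hK _ x _ _ ala (lexx _) seta tN; rewrite normc_real gtr0_norm// => h.
  have -> : (x + t)%:C + s%:C * eta = x%:C + s%:C * eta + t%:C by rewrite rmorphD/=; ring.
  apply: le_trans (normc_eq_le _ h) _; first by ring.
   apply: ler_pM; rewrite ?expR_ge0 ?exp_weight_ge2//.
    by rewrite mulr_ge0 ?sqr_ge0.
  by rewrite ler_wpM2r ?sqr_ge0// lerDl.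
have [f1 _] := hK2 _ _ _ ala (lexx _) sdeta t0 t1.
have [f0 _] := hK2 _ _ _ ala (lexx _) seta t0 t1.
have hB := has_sumB (has_sumB f1 f0) (has_sumZ (d%:C * eta) hchi).
set D := gsum al _ t - gsum al _ t in hB *.
have -> : D = (D - d%:C * eta * chi) + d%:C * eta * chi by ring.
apply: le_trans (le_normcD _ _) _; apply: lerD; last first.
  rewrite normcM normcM normc_real gtr0_norm// -/H.
  have -> : 4 * (K + K1) * H * d = d * H * (4 * (K + K1)) by ring.
  by rewrite ler_wpM2l// mulr_ge0// ltW.
apply: has_sum_norm_le hB _.
have -> : K * H ^+ 2 * (4 / t) * d ^+ 2 = (K * (d * H) ^+ 2) * (4 / t) by ring.
apply: sums_le_exp_weight => // [|k]; first by rewrite mulr_ge0 ?sqr_ge0.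
have := hK _ (t * k%:~R) _ _ ala (lexx _) seta deta.
rewrite normcM normc_real gtr0_norm// -/H => h.
set X := (t * k%:~R)%:C in h *.
have -> : X + (s + d)%:C * eta = X + s%:C * eta + d%:C * eta by rewrite rmorphD/=; ring.
apply: le_trans (normc_eq_le _ h) _; first by ring.
 rewrite ler_wpM2l ?exp_weight_ge2// mulr_ge0 ?sqr_ge0//.
Qed.

End Gauss.

Section GaussSquare.
Context {R : realType}.
Implicit Types (al X y ze : R[i]) (x t a L M : R).

Lemma normx_exp_weight x : (`|x| + 1) * expR (- (2 * `|x|)) <= exp_weight x.
Proof.
have -> : expR (- (2 * `|x|)) = exp_weight x * exp_weight x.
  by rewrite /exp_weight -expRD; congr expR; ring.
rewrite mulrA ler_piMl ?(ltW (exp_weight_gt0 _))//.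
by rewrite /exp_weight expRN ler_pdivrMr ?expR_gt0// mul1r addrC expR_ge1Dx.
Qed.

(** The summand is the derivative of x exp (al x^2), so [riemann_by_parts] applies. *)
Lemma gauss_moment a A : 0 < a -> 0 <= A -> exists2 K : R, 0 <= K &
  forall al t, complex.Re al <= - a -> normc al <= A -> 0 < t -> t <= 1 ->
  exists2 s, has_sum (fun k : int => (1 + 2 * al * (t * k%:~R)%:C ^+ 2) * gauss al (t * k%:~R)%:C) s
    & normc s <= 4 * K.
Proof.
move=> a0 A0; have [K2 K20 hK2] := gauss_shift a0 A0 (lexx 0).
have [K1 K10 hK1] := gauss_bound A 0 a0.
exists (K2 + (2 * A + 1) * K1); first by rewrite addr_ge0// mulr_ge0// addr_ge0// mulr_ge0.
move=> al t ala alA t0 t1.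
have n0 : normc (0 : R[i]) <= 0 by rewrite normc0.
have AK : 0 <= A * K1 by rewrite mulr_ge0.
have gb x : normc (gauss al x%:C) <= K1 * expR (- (2 * `|x|)).
  by have := hK1 _ x _ ala alA n0; rewrite addr0.
have e0 x : 0 < expR (- (2 * `|x|)) := expR_gt0 _.
apply: (@riemann_by_parts _ t _ (fun x => x%:C * gauss al x%:C)
   (fun x => (1 + 2 * al * x%:C ^+ 2) * gauss al x%:C) t0 t1).
- by rewrite addr_ge0// mulr_ge0// addr_ge0// mulr_ge0.
- move=> x; rewrite normcM normc_real; have := normx_exp_weight x; have := exp_weight_gt0 x.
  have := gb x; have := normr_ge0 x; have := e0 x; set N := `|x|; set E := expR _.
  set g := normc _; set k := exp_weight x => E0 N0 h1 k0 h2.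
  have h3 : N * g <= N * (K1 * E) by rewrite ler_wpM2l.
  have h4 : K1 * ((N + 1) * E) <= K1 * k by rewrite ler_wpM2l.
  have h5 : 0 <= K1 * E by rewrite mulr_ge0// ltW.
  have h6 : 0 <= K2 * k by rewrite mulr_ge0// ltW.
  have h7 : 0 <= A * K1 * k by rewrite !mulr_ge0// ltW.
  nra.
- move=> x; have tN : normc t%:C <= 1 by rewrite normc_real gtr0_norm.
  have := hK2 _ x _ _ ala alA n0 tN; rewrite addr0 normc_real gtr0_norm// => h.
  have tE : (x + t)%:C = x%:C + t%:C :> R[i] by rewrite rmorphD.
  have e3 (w : R[i]) : normc (2 * al * x%:C * t%:C ^+ 2 * w) = 2 * normc al * `|x| * t ^+ 2 * normc w.
    by rewrite normcM [normc (_ * _ ^+ 2)]normcM normcX !normcM normc_nat !normc_real (gtr0_norm t0).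
  apply: (@normc_eq_le _ _ ((x + t)%:C * (gauss al (x%:C + t%:C) - gauss al x%:C * (1 + 2 * al * x%:C * t%:C))
     + 2 * al * x%:C * t%:C ^+ 2 * gauss al x%:C)).
    by rewrite tE; ring.
  apply: le_trans (le_normcD _ _) _; rewrite e3 (normcM (x + t)%:C) normc_real.
  have := normx_exp_weight x; have := exp_weight_gt0 x.
  have := gb x; have := normr_ge0 x; have := e0 x.
  have : `|x + t| <= `|x| + 1 by rewrite (le_trans (ler_normD _ _))// lerD2l gtr0_norm.
  move: h; set N := `|x|; set E := expR _; set G := normc _; set G' := normc (gauss _ _).
  set k := exp_weight x; set a' := normc al in alA * => h xt E0 N0 h1 k0 h2.
  have a'0 : 0 <= a' by exact: normc_ge0.
  have T0 : 0 <= t ^+ 2 by exact: sqr_ge0.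
  have b1 : `|x + t| * G <= (N + 1) * (K2 * t ^+ 2 * E) by rewrite ler_pM ?normc_ge0.
  have b2 : 2 * a' * N * t ^+ 2 * G' <= 2 * A * (N + 1) * t ^+ 2 * (K1 * E).
    apply: ler_pM; rewrite ?normc_ge0 ?mulr_ge0 ?(ltW t0)//.
    rewrite ler_wpM2r// ler_pM ?mulr_ge0//; first by rewrite ler_wpM2l.
    by rewrite lerDl.
  have h4 : K2 * t ^+ 2 * ((N + 1) * E) <= K2 * t ^+ 2 * k by rewrite ler_wpM2l// mulr_ge0.
  have h5 : 2 * (A * K1) * t ^+ 2 * ((N + 1) * E) <= 2 * (A * K1) * t ^+ 2 * k.
    by apply: ler_wpM2l => //; apply: mulr_ge0 => //; apply: mulr_ge0.
  have h6 : 0 <= K1 * t ^+ 2 * k.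
    by apply: mulr_ge0; [apply: mulr_ge0 | exact: ltW].
  nra.
Qed.

(** al F(al)^2 is constant for the Gaussian integral F: its derivative is
F (F + 2 al F'), and F + 2 al F' integrates the derivative of
x exp (al x^2), see [gauss_moment].  Multiplied by t^2, the bound tends to 0. *)
Lemma gsum_square al0 al1 : complex.Re al0 < 0 -> complex.Re al1 < 0 ->
  exists2 C : R, 0 <= C & forall t, 0 < t -> t <= 1 ->
    normc (al1 * gsum al1 0 t ^+ 2 - al0 * gsum al0 0 t ^+ 2) <= C / t.
Proof.
move=> re0 re1; pose a := Num.min (- complex.Re al0) (- complex.Re al1).
have a0 : 0 < a by rewrite lt_min !oppr_gt0 re0.
have a1 : a <= - complex.Re al0 by rewrite ge_min lexx.
have a2 : a <= - complex.Re al1 by rewrite ge_min lexx orbT.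
pose De := al1 - al0; pose A := normc al0 + normc De.
have A0 : 0 <= A by rewrite addr_ge0 ?normc_ge0.
have segR s : 0 <= s -> s <= 1 -> complex.Re (al0 + s%:C * De) <= - a.
  by move=> s0 s1; rewrite cReD Re_scale cReD cReN; nra.
have segA s : 0 <= s -> s <= 1 -> normc (al0 + s%:C * De) <= A.
  move=> s0 s1; rewrite (le_trans (le_normcD _ _))// lerD2l normcM normc_real.
  by rewrite ger0_norm// ler_piMl ?normc_ge0.
have [K1 K10 hK1] := @gauss_param R _ a0.
have [KB KB0 hKB] := gauss_moment a0 A0.
have [K3 K30 hK3] := gsum_has_sum A 0 a0.
pose g := A / (2 * a); pose e1 := 4 * g * KB.
have g0 : 0 <= g by rewrite divr_ge0// mulr_ge0// ltW.
have e10 : 0 <= e1 by apply: mulr_ge0 => //; apply: mulr_ge0.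
exists (4 * A * K3 * e1).
  by apply: mulr_ge0 => //; apply: mulr_ge0 => //; apply: mulr_ge0.
move=> t t0 t1; pose e2 := 4 * K1 * A ^+ 2 / t; pose f := K3 / t.
have f0 : 0 <= f by rewrite /f divr_ge0// ltW.
have e20 : 0 <= e2 by rewrite /e2 divr_ge0 ?(ltW t0)// mulr_ge0 ?sqr_ge0// mulr_ge0.
have n0 : normc (0 : R[i]) <= 0 by rewrite normc0.
have := @path_increment _ (fun s => (al0 + s%:C * De) * gsum (al0 + s%:C * De) 0 t ^+ 2)
  (5 * A * f ^+ 2 * g ^+ 2 + 4 * A * f * e2 + A * (e1 + e2) ^+ 2)
  (4 * A * K3 * e1 / t) (Num.truncn (2 * A / a)).
rewrite mul0r addr0 mul1r.
have -> : al0 + De = al1 by rewrite /De; ring.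
apply=> s d s0 d0 sd1 dN.
have s1 : s <= 1 by apply: le_trans sd1; rewrite lerDl ltW.
have d1 : d <= 1 by apply: le_trans sd1; rewrite lerDr.
set al := al0 + s%:C * De; pose ze := d%:C * De.
have -> : al0 + (s + d)%:C * De = al + ze by rewrite /al /ze rmorphD/=; ring.
have alR : complex.Re al <= - a by exact: segR.
have alA : normc al <= A by exact: segA.
have al'R : complex.Re (al + ze) <= - a.
  have -> : al + ze = al0 + (s + d)%:C * De by rewrite /al /ze rmorphD/=; ring.
  by apply: segR => //; rewrite addr_ge0// ltW.
have al'A : normc (al + ze) <= A.
  have -> : al + ze = al0 + (s + d)%:C * De by rewrite /al /ze rmorphD/=; ring.
  by apply: segA => //; rewrite addr_ge0// ltW.
have ala : a <= normc al.
  by have := le_Re_normc al; have := ler_norm (- complex.Re al); rewrite normrN; lra.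
have al0' : al != 0 by rewrite -normc_gt0 (lt_le_trans a0).
have zA : normc ze <= d * A.
  rewrite normcM normc_real gtr0_norm// ler_wpM2l ?(ltW d0)//.
  by rewrite lerDr normc_ge0.
have za : normc ze <= a / 2.
  apply: le_trans zA _; apply: le_trans (ler_wpM2r A0 dN) _.
  rewrite ler_pdivrMl ?ltr0n// mulrCA -ler_pdivrMl//.
  have := ltW (truncnS_gt (2 * A / a)); rewrite -natr1 ler_pdivrMr//.
  set q := _%:R + 1 => h.
  have -> : a^-1 * A = (2 * A) / a / 2 by field; rewrite gt_eqF.
  by rewrite ler_pM2r ?invr_gt0// ler_pdivrMr.
set z := normc ze in zA za; have z0 : 0 <= z := normc_ge0 _.
have [hF FN] := hK3 _ _ _ alR alA n0 t0 t1.
have [hF' _] := hK3 _ _ _ al'R al'A n0 t0 t1.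
have [X hX XN] := hKB _ _ alR alA t0 t1.
set F := gsum al 0 t in hF FN *; set F' := gsum (al + ze) 0 t in hF' *.
(* With c = ze / (2 al) one has (al + ze) (1 - c)^2 = al (1 - 3 c^2 + 2 c^3), so
   F' should be F (1 - c) up to second order; rho is the error. *)
have [c czE] : {c | 2 * al * c = ze} by exists (ze / (2 * al)); field.
have hr := has_sumB (has_sumB hF' hF) (has_sumZ c (has_sumB hX hF)).
pose r := F' - F - c * (X - F).
have rN : normc r <= (K1 * z ^+ 2) * (4 / t).
  apply: has_sum_norm_le hr _; apply: sums_le_exp_weight => // [|k].
    by rewrite mulr_ge0 ?sqr_ge0.
  have := hK1 al (t * k%:~R) ze alR za; rewrite -/z !addr0; set x := (_)%:C => h.
  apply: le_trans (normc_eq_le _ h) _; first by rewrite -czE; ring.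
  by rewrite ler_wpM2l ?exp_weight_ge2// mulr_ge0 ?sqr_ge0.
have nal0 : 0 < normc al := lt_le_trans a0 ala.
have cE : normc c = z / (2 * normc al).
  by rewrite /z -czE (normcM _ c) (normcM 2 al) normc_nat mulrC mulKf// gt_eqF// mulr_gt0.
have cN : normc c <= d * g.
  rewrite cE ler_pdivrMr ?mulr_gt0//.
  apply: le_trans zA _; rewrite /g.
  have -> : d * (A / (2 * a)) * (2 * normc al) = d * A * (normc al / a) by field; rewrite gt_eqF.
  by rewrite ler_peMr ?mulr_ge0 ?(ltW d0)// ler_pdivlMr// mul1r.
have c1 : normc c <= 1 / 4.
  by rewrite cE ler_pdivrMr ?mulr_gt0//; clear -za ala; lra.
pose rho := c * X + r.
have F'E : F' = F * (1 - c) + rho by rewrite /rho /r; ring.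
have rhoN : normc rho <= d * e1 + d ^+ 2 * e2.
  apply: le_trans (le_normcD _ _) _; apply: lerD.
    rewrite normcM; apply: le_trans (ler_pM _ _ cN XN) _; rewrite ?normc_ge0//.
    by rewrite /e1; clear; lra.
  apply: le_trans rN _; have h : z ^+ 2 <= (d * A) ^+ 2.
    by rewrite lerXn2r ?nnegrE// mulr_ge0// ltW.
  have -> : d ^+ 2 * e2 = K1 * (d * A) ^+ 2 * (4 / t) by rewrite /e2; ring.
  by rewrite ler_wpM2r ?divr_ge0 ?(ltW t0)// ler_wpM2l.
have -> : (al + ze) * F' ^+ 2 - al * F ^+ 2 =
   al * (F ^+ 2 * (c ^+ 2 * (2 * c - 3))) + (al + ze) * ((2 * F * (1 - c) + rho) * rho).
  by rewrite F'E -czE; ring.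
apply: le_trans (le_normcD _ _) _; rewrite !(normcM, normcX).
have c23 : normc (2 * c - 3) <= 5.
  by rewrite (le_trans (le_normcB _ _))// normcM !normc_nat; clear -c1; lra.
have c2 : normc (1 - c) <= 2 by rewrite (le_trans (le_normcB _ _))// normc1; clear -c1; lra.
have nr0 : 0 <= normc rho := normc_ge0 _.
have nF0 : 0 <= normc F := normc_ge0 _.
have nc0 : 0 <= normc c := normc_ge0 _.
have q1 : normc (2 * F * (1 - c) + rho) <= 4 * f + normc rho.
  apply: le_trans (le_normcD _ _) _; rewrite lerD2r !normcM normc_nat.
  have hF2 : normc F * normc (1 - c) <= f * 2 by rewrite ler_pM ?normc_ge0.
  clear -hF2; lra.
have b1 : normc al * (normc F ^+ 2 * (normc c ^+ 2 * normc (2 * c - 3))) <=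
    A * (f ^+ 2 * ((d * g) ^+ 2 * 5)).
  apply: ler_pM; rewrite ?mulr_ge0 ?sqr_ge0 ?normc_ge0//.
  apply: ler_pM; rewrite ?mulr_ge0 ?sqr_ge0 ?normc_ge0//.
    by rewrite lerXn2r ?nnegrE.
  apply: ler_pM; rewrite ?mulr_ge0 ?sqr_ge0 ?normc_ge0//.
  by rewrite lerXn2r ?nnegrE// mulr_ge0// ltW.
have b2 : normc (al + ze) * (normc (2 * F * (1 - c) + rho) * normc rho) <=
    A * ((4 * f + normc rho) * normc rho).
  by rewrite ler_pM ?mulr_ge0 ?normc_ge0// ler_wpM2r.
have b3 : normc rho ^+ 2 <= d ^+ 2 * (e1 + e2) ^+ 2.
  rewrite -exprMn lerXn2r ?nnegrE ?mulr_ge0 ?addr_ge0 ?(ltW d0)//.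
  apply: le_trans rhoN _; rewrite mulrDr lerD2l; apply: ler_wpM2r => //.
  by rewrite expr2 ler_piMr ?(ltW d0).
have b4 : A * (4 * f * normc rho) <= A * (4 * f * (d * e1 + d ^+ 2 * e2)).
  by rewrite ler_wpM2l// ler_wpM2l// mulr_ge0.
have b5 : A * normc rho ^+ 2 <= A * (d ^+ 2 * (e1 + e2) ^+ 2) by rewrite ler_wpM2l.
have -> : 4 * A * K3 * e1 / t * d = 4 * A * f * e1 * d by rewrite /f; ring.
clear -b1 b2 b3 b4 b5; lra.
Qed.

Lemma has_sum_real_ge (I : choiceType) (g : I -> R) (s : R[i]) :
  (forall i, 0 <= g i) -> has_sum (fun i => (g i)%:C) s ->
  forall B : {fset I}, (\sum_(i <- B) g i)%:C <= s.
Proof.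
move=> g0 gs B; rewrite lecE /=; apply/andP; split.
  rewrite -normr_eq0 eq_le normr_ge0 andbT; apply/ler_addgt0Pl => e /gs[A hA].
  have := hA _ (fsubset_refl A); rewrite -(raddf_sum (real_complex R)) => /ltW.
  rewrite addr0; apply: le_trans; apply: le_trans (le_Im_normc _).
  by rewrite cImD cImN /= sub0r normrN.
apply/ler_addgt0Pl => e /gs[A hA].
have := hA _ (fsubsetUl A B); rewrite -(raddf_sum (real_complex R)) => /ltW.
move/(le_trans (le_Re_normc _)); rewrite cReD cReN /=.
have := le_sum_fset g0 (fsubsetUr A B); set u := \sum_(_ <- _) _; set v := \sum_(_ <- _) _.
by rewrite ler_norml => uv /andP[_]; lra.
Qed.

Definition mesh (n : nat) : R := n.+1%:R^-1.
Lemma mesh_gt0 n : 0 < mesh n. Proof. by rewrite invr_gt0 ltr0n. Qed.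
Lemma mesh_le1 n : mesh n <= 1. Proof. by rewrite invf_le1 ?ltr0n// ler1n. Qed.

(** At al = -pi all terms are positive, which keeps t times the sum away from 0.
This value serves as a unit for the other Gaussian sums. *)
Lemma gsum_base t : 0 < t -> t <= 1 ->
  exists2 r : R, gsum (- (pi : R)%:C) 0 t = r%:C & expR (- pi) <= t * r.
Proof.
move=> t0 t1; have p0 := pi_gt0 R.
have Rp : complex.Re (- (pi : R)%:C) <= - pi by [].
have n0 : normc (0 : R[i]) <= 0 by rewrite normc0.
have [K _ hK] := gsum_has_sum (normc (- (pi : R)%:C)) 0 p0.
have [hs _] := hK _ _ _ Rp (lexx _) n0 t0 t1.
pose g (k : int) : R := expR (- pi * (t * k%:~R) ^+ 2).
have hs' : has_sum (fun k => (g k)%:C) (gsum (- (pi : R)%:C) 0 t).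
  apply: eq_has_sum hs => k; rewrite addr0 /gauss /g -cexp_real; congr cexp.
  by rewrite [RHS]rmorphM rmorphN [in RHS]rmorphXn.
have := has_sum_real_ge (fun k => expR_ge0 _) hs'.
set G := gsum _ _ _ => hG; have := hG fset0; rewrite big_seq_fset0.
case: G hG {hs hs'} => r im hG; rewrite lecE/= => /andP[/eqP im0 _].
exists r; first by rewrite im0.
(* There are at least 1/t indices k >= 0 with t k <= 1. *)
have [N NE] : {N | N = (Num.truncn t^-1).+1} by eexists.
have := hG [fset Posz i | i in iota 0 N]%fset; rewrite lecE/= => /andP[_].
rewrite big_imfset/=; last by move=> x y _ _ [].
rewrite undup_id ?iota_uniq// => hr.
have : \sum_(i <- iota 0 N) expR (- pi) <= \sum_(i <- iota 0 N) g i.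
  rewrite big_seq [leRHS]big_seq; apply: ler_sum => i; rewrite mem_iota add0n NE ltnS => /andP[_ iN].
  rewrite /g ler_expR mulNr lerN2 ler_piMr ?(ltW p0)//.
  have h : t * i%:R <= 1.
    rewrite mulrC -ler_pdivlMr// mul1r; apply: (@le_trans _ _ (Num.truncn t^-1)%:R); first by rewrite ler_nat.
    by rewrite truncn_le invr_ge0 ltW.
  by rewrite expr_le1// mulr_ge0// ltW.
rewrite big_const_seq count_predT iter_addr_0 size_iota => h.
have tN : 1 <= t * N%:R.
  by rewrite mulrC -ler_pdivrMr// mul1r NE ltW// truncnS_gt.
have E0 := expR_gt0 (- pi : R).
have : N%:R * expR (- pi) <= r by rewrite mulr_natl; exact: le_trans hr.
move=> /(ler_wpM2l (ltW t0)); apply: le_trans.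
by rewrite mulrA ler_peMl// ltW.
Qed.

Lemma cvg_mesh : mesh n @[n --> \oo] --> (0 : R).
Proof. exact: cvg_harmonic. Qed.

Lemma gsum_shift_cvg al eta : complex.Re al < 0 ->
  (mesh n)%:C * (gsum al eta (mesh n) - gsum al 0 (mesh n)) @[n --> \oo] --> (0 : R[i]).
Proof.
move=> al0; have [C C0 hC] := gsum_shift eta al0.
apply: (@cvg_normc0 _ _ \oo _ _ (fun n => C * mesh n)) => [n|].
  rewrite subr0 normcM normc_real gtr0_norm ?mesh_gt0// mulrC ler_wpM2r ?(ltW (mesh_gt0 _))//.
  by apply: hC; rewrite ?mesh_gt0 ?mesh_le1.
by rewrite -(mulr0 C); apply: cvgMr; exact: cvg_mesh.
Qed.

Lemma gsum_square_cvg al0 al1 : complex.Re al0 < 0 -> complex.Re al1 < 0 ->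
  al1 * ((mesh n)%:C * gsum al1 0 (mesh n)) ^+ 2 - al0 * ((mesh n)%:C * gsum al0 0 (mesh n)) ^+ 2
    @[n --> \oo] --> (0 : R[i]).
Proof.
move=> h0 h1; have [C C0 hC] := gsum_square h0 h1.
apply: (@cvg_normc0 _ _ \oo _ _ (fun n => C * mesh n)) => [n|]; last first.
  by rewrite -(mulr0 C); apply: cvgMr; exact: cvg_mesh.
set F := gsum al1 _ _; set F0 := gsum al0 _ _.
have -> : al1 * ((mesh n)%:C * F) ^+ 2 - al0 * ((mesh n)%:C * F0) ^+ 2 - 0 =
  (mesh n)%:C ^+ 2 * (al1 * F ^+ 2 - al0 * F0 ^+ 2) by ring.
rewrite normcM normcX normc_real gtr0_norm ?mesh_gt0//.
apply: le_trans (ler_wpM2l (sqr_ge0 _) (hC _ (mesh_gt0 n) (mesh_le1 n))) _.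
have -> : mesh n ^+ 2 * (C / mesh n) = C * mesh n by field; rewrite gt_eqF ?mesh_gt0.
by [].
Qed.

End GaussSquare.

(** * Positive definite matrices and the Siegel half space *)

Section PosDef.
Context {R : realType}.

Definition bil (K : pzRingType) m (N : 'M[K]_m) (u v : 'rV[K]_m) : K := (u *m N *m v^T) 0 0.

Lemma bilDl (K : pzRingType) m (N : 'M[K]_m) u u' v : bil N (u + u') v = bil N u v + bil N u' v.
Proof. by rewrite /bil !mulmxDl mxE. Qed.
Lemma bilDr (K : pzRingType) m (N : 'M[K]_m) u v v' : bil N u (v + v') = bil N u v + bil N u v'.
Proof. by rewrite /bil linearD/= mulmxDr mxE. Qed.
Lemma bilZl (K : comPzRingType) m (N : 'M[K]_m) a u v : bil N (a *: u) v = a * bil N u v.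
Proof. by rewrite /bil -!scalemxAl mxE. Qed.
Lemma bilZr (K : comPzRingType) m (N : 'M[K]_m) a u v : bil N u (a *: v) = a * bil N u v.
Proof. by rewrite /bil linearZ/= -scalemxAr mxE. Qed.
Lemma bil_sym (K : comPzRingType) m (N : 'M[K]_m) u v : N^T = N -> bil N u v = bil N v u.
Proof.
move=> NT; rewrite /bil -[LHS](mxE trmx_key (fun i j => (u *m N *m v^T) j i)).
by rewrite -[matrix_of_fun _ _]/((u *m N *m v^T)^T) !trmx_mul trmxK NT mulmxA.
Qed.

Definition posdef m (S : 'M[R]_m) : Prop :=
  S^T = S /\ forall v : 'rV[R]_m, v != 0 -> 0 < bil S v v.

Lemma posdef_ge0 m (S : 'M[R]_m) v : posdef S -> 0 <= bil S v v.
Proof.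
move=> [_ h]; have [->|/h/ltW//] := eqVneq v 0.
by rewrite /bil !mul0mx mxE.
Qed.

Definition schur (K : fieldType) m (N : 'M[K]_(1 + m)) : 'M[K]_m :=
  drsubmx N - (N 0 0)^-1 *: ((ursubmx N)^T *m ursubmx N).

Lemma block_sym (K : fieldType) m (N : 'M[K]_(1 + m)) : N^T = N ->
  N = block_mx (N 0 0)%:M (ursubmx N) (ursubmx N)^T (drsubmx N).
Proof.
move=> NT; rewrite -{1}[N]submxK; congr block_mx.
  apply/rowP => j; rewrite !mxE !ord1 /=; congr (N _ _); exact: val_inj.
by rewrite trmx_ursub NT.
Qed.

Lemma schur_sym (K : fieldType) m (N : 'M[K]_(1 + m)) : N^T = N -> (schur N)^T = schur N.
Proof.
by move=> NT; rewrite /schur linearB linearZ/= trmx_mul trmxK trmx_drsub NT.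
Qed.

Lemma add00 (K : pzRingType) (A B : 'M[K]_1) : (A + B) 0 0 = A 0 0 + B 0 0.
Proof. by rewrite mxE. Qed.

Lemma bil_block (K : fieldType) m (N : 'M[K]_(1 + m)) x y : N^T = N ->
  bil N (row_mx x%:M y) (row_mx x%:M y) =
  N 0 0 * x ^+ 2 + 2 * x * (ursubmx N *m y^T) 0 0 + bil (drsubmx N) y y.
Proof.
move=> NT; have := block_sym NT; set b := N 0 0; set w := ursubmx N; set D := drsubmx N => NE.
rewrite /bil [in LHS]NE mul_row_block tr_row_mx mul_row_col !mulmxDl !add00.
have e1 : (x%:M *m b%:M *m (x%:M : 'M[K]_1)^T) 0 0 = b * x ^+ 2.
  by rewrite tr_scalar_mx -!scalar_mxM mxE eqxx mulr1n; ring.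
have e2 : (y *m w^T *m (x%:M : 'M[K]_1)^T) 0 0 = x * (w *m y^T) 0 0.
  rewrite tr_scalar_mx mul_mx_scalar mxE; congr (_ * _).
  by rewrite !mxE; apply: eq_bigr => k _; rewrite !mxE mulrC.
have e3 : (x%:M *m w *m y^T) 0 0 = x * (w *m y^T) 0 0.
  by rewrite mul_scalar_mx -scalemxAl mxE.
by rewrite e1 e2 e3; ring.
Qed.

Lemma bil_schur (K : fieldType) m (N : 'M[K]_(1 + m)) y :
  bil (schur N) y y = bil (drsubmx N) y y - (N 0 0)^-1 * (ursubmx N *m y^T) 0 0 ^+ 2.
Proof.
rewrite /bil /schur mulmxBr mulmxBl mxE [X in _ + X]mxE; congr (_ - _).
rewrite -scalemxAr -scalemxAl mxE; congr (_ * _).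
have -> : y *m ((ursubmx N)^T *m ursubmx N) *m y^T = (ursubmx N *m y^T)^T *m (ursubmx N *m y^T).
  by rewrite trmx_mul trmxK !mulmxA.
by rewrite mxE big_ord1 mxE -expr2.
Qed.

Lemma row_mx0P (K : fieldType) m (y : 'rV[K]_m) (x : K) :
  y != 0 -> row_mx x%:M y != 0 :> 'rV[K]_(1 + m).
Proof.
apply: contraNneq => h; have : rsubmx (row_mx (x%:M : 'M[K]_1) y) = 0 by rewrite h linear0.
by rewrite row_mxKr => ->; rewrite eqxx.
Qed.

Lemma posdef00 m (S : 'M[R]_(1 + m)) : posdef S -> 0 < S 0 0.
Proof.
move=> [ST h]; have := h (row_mx 1%:M 0); rewrite bil_block// trmx0 mulmx0 /bil mul0mx mxE.
rewrite [(0 *m _) _ _]mxE big1 => [|i _]; last by rewrite mxE mul0r.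
rewrite mulr0 !addr0 expr1n mulr1; apply.
apply/eqP => /rowP/(_ 0); rewrite !mxE; case: splitP => // j _.
by rewrite ord1 !mxE => /eqP; rewrite oner_eq0.
Qed.

(** The value at v is the minimum of the form of S over the vectors that extend v. *)
Lemma posdef_schur m (S : 'M[R]_(1 + m)) : posdef S -> posdef (schur S).
Proof.
move=> pS; have b0 := posdef00 pS; have [ST h] := pS; split; first exact: schur_sym.
move=> v v0; have := h (row_mx (- (S 0 0)^-1 * (ursubmx S *m v^T) 0 0)%:M v) (row_mx0P _ v0).
rewrite bil_block// bil_schur; set w := (_ *m _) _ _; set q := bil _ _ _.
suff -> : S 0 0 * (- (S 0 0)^-1 * w) ^+ 2 + 2 * (- (S 0 0)^-1 * w) * w + q =
   q - (S 0 0)^-1 * w ^+ 2 by [].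
by field; rewrite gt_eqF.
Qed.

(** Elimination of the first variable and induction on the Schur complement. *)
Lemma cholesky m (S : 'M[R]_m) : posdef S -> exists2 T : 'M[R]_m, T \in unitmx & S = T *m T^T.
Proof.
elim: m S => [|m IH] S pS.
  exists 1%:M; first exact: unitmx1.
  by apply/matrixP => -[].
have b0 := posdef00 (m := m) pS; have [T Tu TE] := IH _ (posdef_schur (m := m) pS).
have [ST _] := pS; pose b := S 0 0; pose s := Num.sqrt b.
have s0 : s != 0 by rewrite gt_eqF// sqrtr_gt0.
have s2 : s * s = b by rewrite -expr2 sqr_sqrtr// ltW.
pose w : 'rV[R]_m := @ursubmx _ 1 m 1 m S.
have uX : (block_mx s%:M 0 (s^-1 *: w^T) T : 'M[R]_(1 + m)) \in unitmx.
  by rewrite unitmxE det_lblock unitrM -[\det T \is a _]unitmxE Tu andbT det_scalar1 unitfE.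
exists (block_mx s%:M 0 (s^-1 *: w^T) T : 'M[R]_(1 + m)); first exact: uX.
suff: (S : 'M[R]_(1 + m)) = (block_mx s%:M 0 (s^-1 *: w^T) T : 'M[R]_(1 + m)) *m (block_mx s%:M 0 (s^-1 *: w^T) T : 'M[R]_(1 + m))^T by [].
rewrite [LHS](block_sym (m := m) ST) -/b -/w tr_block_mx mulmx_block.
rewrite !trmx0 !mul0mx !mulmx0 !addr0 ?add0r tr_scalar_mx.
congr block_mx.
- by rewrite -scalar_mxM s2.
- by rewrite mul_scalar_mx linearZ/= trmxK scalerA divff// scale1r.
- by rewrite mul_mx_scalar scalerA divff// scale1r.
rewrite linearZ/= trmxK -scalemxAl -scalemxAr scalerA -invfM s2 -TE /schur -/b -/w.
by rewrite addrC subrK.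
Qed.

Definition sqn m (v : 'rV[R]_m) : R := \sum_j v 0 j ^+ 2.

Lemma sqnE m (v : 'rV[R]_m) : sqn v = (v *m v^T) 0 0.
Proof. by rewrite mxE; apply: eq_bigr => j _; rewrite mxE expr2. Qed.

Lemma sqn_ge0 m (v : 'rV[R]_m) : 0 <= sqn v.
Proof. by apply: sumr_ge0 => j _; exact: sqr_ge0. Qed.

Lemma sqn_mul_le m (T : 'M[R]_m) : exists2 C : R, 0 < C &
  forall v : 'rV[R]_m, sqn (v *m T) <= C * sqn v.
Proof.
pose K : R := \sum_i \sum_j `|T i j| + 1.
have K0 : 0 < K by rewrite ltr_wpDl// sumr_ge0// => i _; rewrite sumr_ge0.
exists (m%:R * K ^+ 2 + 1); first by rewrite ltr_wpDl// mulr_ge0 ?sqr_ge0.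
move=> v; have q0 := sqn_ge0 v.
pose Y := Num.sqrt (sqn v); have Y0 : 0 <= Y by exact: sqrtr_ge0.
have vY i : `|v 0 i| <= Y.
  rewrite -sqrtr_sqr ler_wsqrtr// /sqn (bigD1 i)//= lerDl.
  by apply: sumr_ge0 => j _; exact: sqr_ge0.
have vTY j : `|(v *m T) 0 j| <= Y * K.
  rewrite mxE (le_trans (ler_norm_sum _ _ _))//.
  apply: (@le_trans _ _ (\sum_i Y * (\sum_j `|T i j|))).
    apply: ler_sum => i _; rewrite normrM; apply: ler_pM => //.
    by rewrite (bigD1 j)//= lerDl sumr_ge0.
  by rewrite -mulr_sumr ler_wpM2l// lerDl.
apply: (@le_trans _ _ (\sum_(j < m) (Y * K) ^+ 2)).
  apply: ler_sum => j _; rewrite -real_normK ?num_real// lerXn2r ?nnegrE// mulr_ge0//.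
  exact: ltW.
rewrite sumr_const card_ord exprMn sqr_sqrtr// -[leLHS]mulr_natl mulrDl mul1r.
by rewrite [sqn v * _]mulrC mulrA lerDl.
Qed.

Lemma posdef_coercive m (S : 'M[R]_m) : posdef S -> exists2 c : R, 0 < c &
  forall v, c * sqn v <= bil S v v.
Proof.
move=> /cholesky[T Tu ->]; have [C C0 hC] := sqn_mul_le (invmx T).
exists C^-1 => [|v]; first by rewrite invr_gt0.
have := hC (v *m T); rewrite mulmxK// => h.
rewrite ler_pdivrMl//; apply: le_trans h _; rewrite ler_wpM2l ?(ltW C0)//.
by rewrite sqnE /bil trmx_mul !mulmxA.
Qed.

End PosDef.

Section Siegel.
Context {R : realType}.
Local Notation C := R[i].

Definition ReMx m n (N : 'M[C]_(m, n)) : 'M[R]_(m, n) := map_mx (@complex.Re R) N.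
Definition ImMx m n (N : 'M[C]_(m, n)) : 'M[R]_(m, n) := map_mx (@complex.Im R) N.
Definition cM m n (A : 'M[R]_(m, n)) : 'M[C]_(m, n) := map_mx (real_complex R) A.

Lemma cM_ReIm m n (N : 'M[C]_(m, n)) : N = cM (ReMx N) + 'i *: cM (ImMx N).
Proof. by apply/matrixP => i j; rewrite !mxE [LHS]complexE. Qed.

Lemma cMM m n p (A : 'M[R]_(m, n)) (B : 'M[R]_(n, p)) : cM (A *m B) = cM A *m cM B.
Proof. exact: map_mxM. Qed.
Lemma cMT m n (A : 'M[R]_(m, n)) : cM A^T = (cM A)^T.
Proof. by rewrite /cM map_trmx. Qed.
Lemma cM_inj m n : injective (@cM m n).
Proof. by apply: map_mx_inj => x y []. Qed.

Lemma bil_cM m (S : 'M[R]_m) u v : bil (cM S) (cM u) (cM v) = (bil S u v)%:C.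
Proof. by rewrite /bil -cMT -!cMM mxE. Qed.

(** The Siegel upper half space. *)
Definition siegel m (N : 'M[C]_m) : Prop := N^T = N /\ posdef (ImMx N).

Lemma bil_add m (N N' : 'M[C]_m) u v : bil (N + N') u v = bil N u v + bil N' u v.
Proof. by rewrite /bil mulmxDr mulmxDl mxE. Qed.
Lemma bil_scale m a (N : 'M[C]_m) u v : bil (a *: N) u v = a * bil N u v.
Proof. by rewrite /bil -scalemxAr -scalemxAl mxE. Qed.

Lemma bil_real m (N : 'M[C]_m) (x : 'rV[R]_m) :
  bil N (cM x) (cM x) = (bil (ReMx N) x x)%:C + 'i * (bil (ImMx N) x x)%:C.
Proof. by rewrite {1}[N]cM_ReIm bil_add bil_scale !bil_cM. Qed.

Lemma ReMx_sym m (N : 'M[C]_m) : N^T = N -> (ReMx N)^T = ReMx N.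
Proof. by move=> NT; rewrite /ReMx map_trmx NT. Qed.
Lemma ImMx_sym m (N : 'M[C]_m) : N^T = N -> (ImMx N)^T = ImMx N.
Proof. by move=> NT; rewrite /ImMx map_trmx NT. Qed.

Definition conjM m n (N : 'M[C]_(m, n)) : 'M[C]_(m, n) := map_mx (@conjc R) N.

Lemma conjME m n (N : 'M[C]_(m, n)) : conjM N = cM (ReMx N) - 'i *: cM (ImMx N).
Proof.
apply/matrixP => i j; rewrite !mxE; case: (N i j) => a b /=.
by apply/eqP; rewrite eq_complex /=; apply/andP; split; apply/eqP; ring.
Qed.

Lemma Im_herm m (N : 'M[C]_m) (u : 'rV[C]_m) : N^T = N ->
  complex.Im (bil N u (conjM u)) =
  bil (ImMx N) (ReMx u) (ReMx u) + bil (ImMx N) (ImMx u) (ImMx u).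
Proof.
move=> NT; set a := ReMx u; set b := ImMx u.
rewrite {1}[u]cM_ReIm conjME -/a -/b bilDl -scaleN1r scalerA !bilDr !bilZl !bilZr.
have sX := bil_sym a b (ReMx_sym NT); have sY := bil_sym a b (ImMx_sym NT).
have := cM_ReIm N; move: sX sY; set X := ReMx N; set Y := ImMx N => sX sY ->.
rewrite !bil_add !bil_scale !bil_cM sX sY.
by rewrite !(cImD, cImM, cReD, cReM, cReN, cImN) /=; ring.
Qed.

(** The real part of N contributes a real number to a Hermitian form. *)
Lemma siegel_im_gt0 m (N : 'M[C]_m) (u : 'rV[C]_m) : siegel N -> u != 0 ->
  0 < complex.Im (bil N u (conjM u)).
Proof.
move=> [NT pN] u0; rewrite Im_herm//.
have [a0|a0] := eqVneq (ReMx u) 0; last by rewrite ltr_wpDr ?posdef_ge0//; apply: pN.2.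
have b0 : ImMx u != 0.
  apply: contraNneq u0 => b0; rewrite [u]cM_ReIm a0 b0 /cM !map_mx0 scaler0 addr0//.
by rewrite ltr_wpDl ?posdef_ge0//; apply: pN.2.
Qed.

Lemma siegel_unit m (N : 'M[C]_m) : siegel N -> N \in unitmx.
Proof.
move=> sN; rewrite -row_free_unit -kermx_eq0; apply/rowV0P => u /sub_kermxP uN.
apply/eqP; apply: contraTT isT => u0; have := siegel_im_gt0 sN u0.
by rewrite /bil uN mul0mx mxE ltxx.
Qed.

Lemma siegel00 m (N : 'M[C]_(1 + m)) : siegel N -> 0 < complex.Im (N 0 0).
Proof. by move=> [_ /posdef00]; rewrite mxE. Qed.

Lemma siegel00_neq0 m (N : 'M[C]_(1 + m)) : siegel N -> N 0 0 != 0.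
Proof. by move=> /siegel00; apply: contraTneq => ->; rewrite ltxx. Qed.

(** The vector u below is chosen so that u N has first entry 0; the form of N at u
is then the form of the Schur complement at v. *)
Lemma siegel_schur m (N : 'M[C]_(1 + m)) : siegel N -> siegel (schur N).
Proof.
move=> sN; have [NT pN] := sN; have b0 := siegel00_neq0 sN.
have ST := schur_sym NT; split=> //; split; first exact: ImMx_sym.
move=> v v0; pose w := (ursubmx N *m (cM v)^T) 0 0.
pose u := row_mx (- (N 0 0)^-1 * w)%:M (cM v) : 'rV[C]_(1 + m).
have u0 : u != 0.
  apply: row_mx0P; apply: contraNneq v0 => h; apply/eqP/cM_inj.
  by rewrite h /cM map_mx0.
have := siegel_im_gt0 sN u0.
suff -> : bil N u (conjM u) = bil (schur N) (cM v) (cM v).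
  by rewrite bil_real !(cImD, cImM) /= mul1r !mul0r !add0r.
have cv : conjM (cM v) = cM v by apply/matrixP => i j; rewrite !mxE conjc_real.
have uN : u *m N = row_mx 0 (cM v *m schur N).
  rewrite {1}(block_sym NT) mul_row_block; congr row_mx.
    apply/rowP => i; rewrite !ord1 -scalar_mxM !mxE eqxx mulr1n.
    rewrite -[X in _ + X](_ : w = _); first by field.
    by rewrite /w mxE; apply: eq_bigr => j _; rewrite !mxE mulrC.
  rewrite /schur mulmxBr addrC; congr (_ + _).
  rewrite mul_scalar_mx mulNr scaleNr -scalemxAr mulmxA; congr (- _).
  rewrite -scalerA; congr (_ *: _).
  have -> : cM v *m (ursubmx N)^T = w%:M.
    apply/rowP => i; rewrite !ord1 [RHS]mxE eqxx mulr1n /w !mxE; apply: eq_bigr => j _.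
    by rewrite !mxE mulrC.
  by rewrite mul_scalar_mx.
rewrite /bil uN /conjM map_row_mx -/(conjM _) -/(conjM _) cv tr_row_mx mul_row_col mul0mx add0r.
by [].
Qed.

Lemma siegel_drsub m (N : 'M[C]_(1 + m)) : siegel N -> siegel (drsubmx N).
Proof.
move=> [NT [SN pN]]; split; first by rewrite trmx_drsub NT.
split; first by apply: ImMx_sym; rewrite trmx_drsub NT.
move=> v v0; have := pN (row_mx 0%:M v) (row_mx0P _ v0).
rewrite bil_block// expr0n/= !mulr0 mul0r !add0r /ImMx map_drsubmx; apply.
Qed.

End Siegel.

(** * Theta series and their degenerations *)

Section Theta.
Context {R : realType}.
Local Notation C := R[i].

Definition expi (x : C) : C := cexp ((pi : R)%:C * 'i * x).

Lemma expi0 : expi 0 = 1.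
Proof. by rewrite /expi mulr0 cexp0. Qed.

Lemma normc_expi x : normc (expi x) = expR (- pi * complex.Im x).
Proof.
by rewrite normc_cexp; congr expR; rewrite !cReM /=; ring.
Qed.

Definition scale_point m (tau : 'rV[R]_m) (k : 'rV[int]_m) : 'rV[R]_m :=
  \row_j (tau 0 j * (k 0 j)%:~R).

Definition all_pos m (tau : 'rV[R]_m) : Prop := forall j, 0 < tau 0 j.

(** The diagonal scaling tau is kept apart from N, since its entries are sent to 0
or to infinity while N is fixed. *)
Definition theta_term m (N : 'M[C]_m) (tau : 'rV[R]_m) (k : 'rV[int]_m) : C :=
  expi (bil N (cM (scale_point tau k)) (cM (scale_point tau k))).

Definition Theta m (N : 'M[C]_m) (tau : 'rV[R]_m) : C := csum (theta_term N tau).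

Lemma sums_le_bij (I J : choiceType) (h : J -> I) (h' : I -> J) (g : I -> R) K :
  cancel h h' -> cancel h' h -> sums_le (g \o h) K -> sums_le g K.
Proof.
move=> hK h'K gK B; have := gK [fset h' b | b in B]%fset.
rewrite big_imfset/=; last by move=> x y _ _ /(can_inj h'K).
by rewrite (eq_bigr g)// => i _; rewrite h'K.
Qed.

Lemma sums_le_gauss1 (a t : R) : 0 < a -> 0 < t -> exists2 K : R, 0 <= K &
  sums_le (fun k : int => expR (- a * (t * k%:~R) ^+ 2)) K.
Proof.
move=> a0 t0; pose t' := Num.min t 1.
have t'0 : 0 < t' by rewrite lt_min t0 ltr01.
have t'1 : t' <= 1 by rewrite ge_min lexx orbT.
have t't : t' <= t by rewrite ge_min lexx.
pose K0 := expR ((0 + 2) ^+ 2 / (4 * a) + 0).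
exists (K0 * (4 / t')); first by rewrite mulr_ge0 ?expR_ge0// divr_ge0// ltW.
apply: sums_leP (sums_leZ (expR_ge0 _) (sums_le_geom t'0 t'1)) => k.
have := expR_quad_le 0 0 (t * k%:~R) a0; rewrite mul0r !addr0 => /le_trans; apply.
rewrite ler_wpM2l ?expR_ge0// (le_trans (exp_weight_ge2 _))// ler_expR lerN2 !normrM ler_wpM2r//.
by rewrite !gtr0_norm.
Qed.

Lemma sums_le_gauss1_unif (a : R) : 0 < a -> exists2 K : R, 0 <= K &
  forall t, 0 < t -> t <= 1 -> sums_le (fun k : int => expR (- a * (t * k%:~R) ^+ 2)) (K / t).
Proof.
move=> a0; pose K0 := expR ((0 + 2) ^+ 2 / (4 * a) + 0).
exists (K0 * 4); first by rewrite mulr_ge0 ?expR_ge0.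
move=> t t0 t1; rewrite -mulrA.
apply: sums_leP (sums_leZ (expR_ge0 _) (sums_le_geom t0 t1)) => k.
have := expR_quad_le 0 0 (t * k%:~R) a0; rewrite mul0r !addr0 => /le_trans; apply.
by rewrite ler_wpM2l ?expR_ge0// exp_weight_ge2.
Qed.

Definition glue m (p : int * 'rV[int]_m) : 'rV[int]_(1 + m) := row_mx p.1%:M p.2.
Definition unglue m (k : 'rV[int]_(1 + m)) : int * 'rV[int]_m := (k 0 0, rsubmx k).

Lemma glueK m : cancel (@glue m) (@unglue m).
Proof.
move=> [x y]; rewrite /glue /unglue /= row_mxKr; congr pair.
rewrite mxE; case: splitP => [j _|k]; last by [].
by rewrite ord1 mxE eqxx mulr1n.
Qed.

Lemma unglueK m : cancel (@unglue m) (@glue m).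
Proof.
move=> k; rewrite /glue /unglue /= -[RHS]hsubmxK; congr row_mx.
apply/rowP => j; rewrite !ord1 !mxE eqxx mulr1n; congr (k _ _); exact: val_inj.
Qed.

Definition glue_scale m (t : R) (tau : 'rV[R]_m) : 'rV[R]_(1 + m) := row_mx t%:M tau.

Lemma scale_point_glue m t (tau : 'rV[R]_m) p :
  scale_point (glue_scale t tau) (glue p) = row_mx (t * p.1%:~R)%:M (scale_point tau p.2).
Proof.
apply/rowP => j; rewrite !mxE; case: splitP => i _; last by rewrite !mxE.
by rewrite !ord1 !mxE eqxx !mulr1n.
Qed.

Lemma sqn_glue m x (y : 'rV[R]_m) : sqn (row_mx x%:M y : 'rV[R]_(1 + m)) = x ^+ 2 + sqn y.
Proof.
rewrite /sqn big_split_ord /= big_ord1; congr (_ + _).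
  by rewrite row_mxEl mxE eqxx mulr1n.
by apply: eq_bigr => j _; rewrite row_mxEr.
Qed.

Lemma all_pos_glue m t (tau : 'rV[R]_m) : 0 < t -> all_pos tau -> all_pos (glue_scale t tau).
Proof.
move=> t0 ptau j; rewrite mxE; case: splitP => i _; last exact: ptau.
by rewrite !ord1 mxE eqxx mulr1n.
Qed.

Lemma glue_scale_split m (tau : 'rV[R]_(1 + m)) : tau = glue_scale (tau 0 0) (rsubmx tau).
Proof.
rewrite /glue_scale -[LHS]hsubmxK; congr row_mx.
apply/rowP => j; rewrite !ord1 !mxE eqxx mulr1n; congr (tau _ _); exact: val_inj.
Qed.

Lemma sums_le_gauss m (a : R) (tau : 'rV[R]_m) : 0 < a -> all_pos tau -> exists2 K : R, 0 <= K &
  sums_le (fun k : 'rV[int]_m => expR (- a * sqn (scale_point tau k))) K.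
Proof.
move=> a0; elim: m tau => [|m IH] tau ptau.
  exists 1 => // B; have BP : fsubset B [fset 0]%fset.
    by apply/fsubsetP => k _; rewrite inE; apply/eqP/rowP => -[].
  apply: le_trans (le_sum_fset _ BP) _ => [k|]; first exact: expR_ge0.
  by rewrite big_seq_fset1 -[leRHS]expR0 ler_expR mulNr oppr_le0 mulr_ge0 ?sqn_ge0// ltW.
pose t := tau 0 0; pose tau' := @rsubmx _ 1 1 m tau.
have tauE : tau = glue_scale t tau' := glue_scale_split (m := m) tau.
have [K1 K10 h1] := sums_le_gauss1 a0 (ptau 0).
have [|K2 K20 h2] := IH tau'; first by move=> j; rewrite mxE.
exists (K1 * K2); first exact: mulr_ge0.
apply: (sums_le_bij (@glueK m) (@unglueK m)).
apply: sums_leP (sums_le_prod _ _ h1 h2) => [p|i|j]; rewrite ?expR_ge0//=.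
have -> : sqn (scale_point tau (glue p)) = (t * p.1%:~R) ^+ 2 + sqn (scale_point tau' p.2).
  by rewrite {1}tauE scale_point_glue sqn_glue.
by rewrite -expRD mulrDr.
Qed.

Lemma normc_expi_le m (N : 'M[C]_m) : siegel N -> exists2 a : R, 0 < a &
  forall x : 'rV[R]_m, normc (expi (bil N (cM x) (cM x))) <= expR (- a * sqn x).
Proof.
move=> [_ /posdef_coercive[c c0 hc]]; exists (pi * c); first by rewrite mulr_gt0 ?pi_gt0.
move=> x; rewrite normc_expi ler_expR mulNr mulNr lerN2 -mulrA ler_wpM2l ?pi_ge0//.
by rewrite bil_real !(cImD, cImM) /= mul1r !mul0r !add0r.
Qed.

Lemma has_sum_Theta m (N : 'M[C]_m) tau : siegel N -> all_pos tau ->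
  has_sum (theta_term N tau) (Theta N tau).
Proof.
move=> /normc_expi_le[a a0 ha] ptau; have [K _ hK] := sums_le_gauss a0 ptau.
exact: has_sum_csum (sums_leP (fun k => ha _) hK).
Qed.

Lemma cM_row_mx m x (y : 'rV[R]_m) :
  cM (row_mx x%:M y : 'rV[R]_(1 + m)) = row_mx x%:C%:M (cM y).
Proof. by rewrite /cM map_row_mx map_scalar_mx. Qed.

Definition cross_form m (N : 'M[C]_(1 + m)) (y : 'rV[R]_m) : C := (ursubmx N *m (cM y)^T) 0 0.

(** Completion of the square: for a fixed tail of k the first coordinate runs through
a shifted Gaussian. *)
Lemma theta_term_glue m (N : 'M[C]_(1 + m)) t tau p : siegel N ->
  theta_term N (glue_scale t tau) (glue p) =
  theta_term (schur N) tau p.2 *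
  gauss ((pi : R)%:C * 'i * N 0 0) ((t * p.1%:~R)%:C + cross_form N (scale_point tau p.2) / N 0 0).
Proof.
move=> sN; rewrite /theta_term scale_point_glue cM_row_mx bil_block ?sN.1// bil_schur.
rewrite /gauss -/(cross_form N _) /expi -cexpD; congr cexp; field.
exact: siegel00_neq0.
Qed.

Lemma Re_gauss_coef m (N : 'M[C]_(1 + m)) : siegel N -> complex.Re ((pi : R)%:C * 'i * N 0 0) < 0.
Proof.
move=> /siegel00; rewrite !cReM !cImM /= !(mulr0, mul0r, mulr1, mul1r, subr0, addr0, sub0r).
by move=> h; have := mulr_gt0 (pi_gt0 R) h; lra.
Qed.

Lemma has_sum_gsum (al y : C) (t : R) : complex.Re al < 0 -> 0 < t -> t <= 1 ->
  has_sum (fun k : int => gauss al ((t * k%:~R)%:C + y)) (gsum al y t).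
Proof.
move=> al0; have a0 : 0 < - complex.Re al by rewrite oppr_gt0.
have [K _ hK] := gsum_has_sum (normc al) (normc y) a0.
by move=> t0 t1; apply: (hK al y t _ _ _ t0 t1).1; rewrite ?opprK.
Qed.

Lemma Theta_fubini m (N : 'M[C]_(1 + m)) t tau : siegel N -> 0 < t -> t <= 1 -> all_pos tau ->
  has_sum (fun k : 'rV[int]_m => theta_term (schur N) tau k *
    gsum ((pi : R)%:C * 'i * N 0 0) (cross_form N (scale_point tau k) / N 0 0) t) (Theta N (glue_scale t tau)).
Proof.
move=> sN t0 t1 ptau.
have h := has_sum_Theta sN (all_pos_glue t0 ptau).
have := has_sum_reindex (@glueK m) (@unglueK m) h => /has_sum_fubini; apply => k.
apply: eq_has_sum (has_sumZ _ (has_sum_gsum _ (Re_gauss_coef sN) t0 t1)) => i /=.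
by rewrite theta_term_glue.
Qed.

(** After summation over the first coordinate each term is a shifted Gaussian sum,
which may be replaced by the unshifted one; the common factor comes out of
the sum over the other coordinates. *)
Lemma Theta_riemann m (N : 'M[C]_(1 + m)) tau : siegel N -> all_pos tau ->
  (@mesh R n)%:C * Theta N (glue_scale (@mesh R n) tau) -
  (@mesh R n)%:C * gsum ((pi : R)%:C * 'i * N 0 0) 0 (@mesh R n) * Theta (schur N) tau
    @[n --> \oo] --> (0 : C).
Proof.
move=> sN ptau; set al := _ * N 0 0.
have al0 : complex.Re al < 0 := Re_gauss_coef sN.
have a0 : 0 < - complex.Re al by rewrite oppr_gt0.
have [a aN ha] := normc_expi_le sN; have [a' a'N ha'] := normc_expi_le (siegel_schur sN).
have [K1 K10 hK1] := sums_le_gauss1_unif aN.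
have [K3 K30 hK3] := gsum_has_sum (normc al) 0 a0.
have [S1 _ hS1] := sums_le_gauss aN ptau; have [S2 _ hS2] := sums_le_gauss a'N ptau.
have sS := siegel_schur sN.
have al1 : complex.Re al <= - - complex.Re al by rewrite opprK.
have n0 : normc (0 : R[i]) <= 0 by rewrite normc0.
pose f n k := (@mesh R n)%:C * (theta_term (schur N) tau k * gsum al (cross_form N (scale_point tau k) / N 0 0) (@mesh R n))
   - (@mesh R n)%:C * gsum al 0 (@mesh R n) * theta_term (schur N) tau k.
apply: (@has_sum_tannery0 _ _ f _ (fun k => K1 * expR (- a * sqn (scale_point tau k)) +
     K3 * expR (- a' * sqn (scale_point tau k))) (K1 * S1 + K3 * S2)).
- move=> n k; have t0 := @mesh_gt0 R n; have t1 := @mesh_le1 R n.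
  apply: le_trans (le_normcB _ _) _; apply: lerD.
    rewrite normcM normc_real gtr0_norm// -ler_pdivlMl// mulrA.
    apply: has_sum_norm_le (has_sumZ _ (has_sum_gsum _ al0 t0 t1)) _.
    rewrite [_^-1 * K1]mulrC [_ * expR _]mulrC.
    apply: sums_leP (sums_leZ (expR_ge0 _) (hK1 _ t0 t1)) => i.
    apply: (@normc_eq_le _ _ (theta_term N (glue_scale (@mesh R n) tau) (glue (i, k)))).
      by rewrite theta_term_glue.
    apply: le_trans (ha _) _; rewrite scale_point_glue sqn_glue -expRD ler_expR /=; lra.
  rewrite normcM; apply: ler_pM; rewrite ?normc_ge0//; last exact: ha'.
  rewrite normcM normc_real gtr0_norm// -ler_pdivlMl// mulrC.
  by have [_ ] := hK3 _ _ _ al1 (lexx _) n0 t0 t1.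
- by move=> B; rewrite big_split lerD// -mulr_sumr ler_wpM2l.
- move=> k; pose c := theta_term (schur N) tau k.
  have hc := gsum_shift_cvg (cross_form N (scale_point tau k) / N 0 0) al0.
  apply/cvg_normcP => e e0; move/cvg_normcP : hc.
  have c0 : 0 < normc c + 1 by rewrite ltr_wpDl ?normc_ge0.
  move=> /(_ (e / (normc c + 1)) (divr_gt0 e0 c0)); apply: filterS => n.
  rewrite !subr0 ltr_pdivlMr// => h; apply: le_lt_trans h.
  have -> : f n k = (@mesh R n)%:C * (gsum al (cross_form N (scale_point tau k) / N 0 0) (@mesh R n) - gsum al 0 (@mesh R n)) * c.
    by rewrite /f /c; ring.
  by rewrite normcM ler_wpM2l ?normc_ge0// lerDl.
- move=> n; apply: has_sumB; apply: has_sumZ.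
    exact: Theta_fubini (@mesh_gt0 R n) (@mesh_le1 R n) ptau.
  exact: has_sum_Theta.
Qed.

Lemma expR_mesh_cvg (a : R) : 0 < a -> expR (- a * n.+1%:R) @[n --> \oo] --> (0 : R).
Proof.
move=> a0; apply: (@squeeze_cvgr nat \oo _ R (fun=> 0) (fun n => a^-1 * @mesh R n)).
- near=> n; rewrite expR_ge0/= mulNr expRN -invfM lef_pV2 ?posrE ?expR_gt0 ?mulr_gt0//.
  exact: le_expR.
- exact: cvg_cst.
- by rewrite -(mulr0 a^-1); apply: cvgMr; exact: cvg_mesh.
Unshelve. all: by end_near. Qed.

(** With the first coordinate stretched by n + 1, all terms off the hyperplane where
it vanishes tend to 0. *)
Lemma Theta_concentrate m (M : 'M[C]_(1 + m)) tau : siegel M -> all_pos tau ->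
  Theta M (glue_scale (@mesh R n)^-1 tau) @[n --> \oo] --> Theta (drsubmx M) tau.
Proof.
move=> sM ptau; have [a a0 ha] := normc_expi_le sM.
have [K1 K10 hK1] := sums_le_gauss1 a0 ltr01.
have [S1 _ hS1] := sums_le_gauss a0 ptau.
pose f n (p : int * 'rV[int]_m) := theta_term M (glue_scale (@mesh R n)^-1 tau) (glue p).
pose fo (p : int * 'rV[int]_m) := if p.1 == 0 then theta_term (drsubmx M) tau p.2 else 0.
pose g (p : int * 'rV[int]_m) : R := expR (- a * (1 * p.1%:~R) ^+ 2) * expR (- a * sqn (scale_point tau p.2)).
have gK : sums_le g (K1 * S1).
  exact: (sums_le_prod (fun=> expR_ge0 _) (fun=> expR_ge0 _) hK1 hS1).
have tV n : (@mesh R n)^-1 = n.+1%:R by rewrite /mesh invrK.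
have f0E n k : f n (0, k) = theta_term (drsubmx M) tau k.
  rewrite /f /theta_term scale_point_glue /= mulr0 cM_row_mx bil_block ?sM.1//.
  by rewrite expr0n/= !(mulr0, mul0r, add0r).
have fg n p : normc (f n p) <= expR (- a * (n.+1%:R * p.1%:~R) ^+ 2) * expR (- a * sqn (scale_point tau p.2)).
  apply: le_trans (ha _) _; rewrite tV scale_point_glue sqn_glue -expRD ler_expR; lra.
have fg' n p : normc (f n p) <= g p.
  apply: le_trans (fg n p) _; rewrite ler_wpM2r ?expR_ge0// ler_expR !mulNr lerN2 ler_wpM2l ?(ltW a0)//.
  by rewrite !exprMn ler_wpM2r ?sqr_ge0// lerXn2r ?nnegrE// ler1n.
have fog p : normc (fo p) <= g p.
  case: p => k1 k; rewrite /fo /=; case: eqP => [->|_]; last by rewrite normc0 mulr_ge0 ?expR_ge0.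
  by rewrite -(f0E 0%N).
have fs n : has_sum (f n) (Theta M (glue_scale (@mesh R n)^-1 tau)).
  apply: (has_sum_reindex (@glueK m) (@unglueK m)); apply: has_sum_Theta => //.
  by apply: all_pos_glue => //; rewrite invr_gt0 mesh_gt0.
have hfo := has_sum_csum (sums_leP fog gK).
have <- : csum fo = Theta (drsubmx M) tau.
  apply: has_sum_unique (has_sum_fubini hfo _) (has_sum_Theta (siegel_drsub sM) ptau) => k.
  move=> e e0; exists [fset 0]%fset => B B0.
  rewrite /fo /= -(big_fset_incl _ B0) => [|i _]; last by rewrite inE => /negbTE ->.
  by rewrite big_seq_fset1 eqxx subrr normc0.
apply: (has_sum_tannery fg' fog gK) fs hfo => -[k1 k].
have [->|k10] := eqVneq k1 0.
  rewrite /fo eqxx; under eq_fun do rewrite f0E; exact: cvg_cst.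
rewrite /fo (negbTE k10).
apply: (@cvg_normc0 _ _ \oo _ _ (fun n => expR (- a * n.+1%:R))); last exact: expR_mesh_cvg.
move=> n; rewrite subr0; apply: le_trans (fg n (k1, k)) _ => /=.
rewrite -[leRHS]mulr1; apply: ler_pM; rewrite ?expR_ge0//; last first.
  by rewrite -expR0 ler_expR mulNr oppr_le0 mulr_ge0 ?sqn_ge0// ltW.
rewrite ler_expR !mulNr lerN2 ler_wpM2l ?(ltW a0)//.
have k1n : (1 : R) <= `|k1%:~R|.
  by rewrite -intr_norm -[1]/(1%:~R) ler_int -gtz0_ge1 normr_gt0.
rewrite -real_normK ?num_real// normrM normr_nat.
have n1 : (1 : R) <= n.+1%:R by rewrite ler1n.
have q1 : n.+1%:R <= n.+1%:R * `|k1%:~R| :> R by rewrite ler_peMr.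
have := le_trans n1 q1; move: q1; set q := _ * `|_| => q1 q2.
by rewrite expr2; nra.
Qed.

End Theta.

(** * The functional equation determines the inverse *)

Section CvgC.
Context {R : realType}.
Local Notation C := R[i].
Implicit Types (u v : nat -> C).

Lemma ccvg_cst (a : C) : (fun _ : nat => a) @ \oo --> a.
Proof. exact: cvg_cst. Qed.

Lemma ccvgM u v (a b : C) : u @ \oo --> a -> v @ \oo --> b -> u n * v n @[n --> \oo] --> a * b.
Proof. exact: cvgM. Qed.

Lemma ccvgD u v (a b : C) : u @ \oo --> a -> v @ \oo --> b -> u n + v n @[n --> \oo] --> a + b.
Proof. exact: cvgD. Qed.

Lemma ccvgV u (a : C) : a != 0 -> u @ \oo --> a -> (u n)^-1 @[n --> \oo] --> a^-1.
Proof. exact: cvgV. Qed.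

Lemma ccvg_unique u (a b : C) : u @ \oo --> a -> u @ \oo --> b -> a = b.
Proof. by apply: cvg_unique; exact: norm_hausdorff. Qed.

Lemma ccvg_bounded u v (K : R) : u @ \oo --> (0 : C) -> (forall n, normc (v n) <= K) ->
  u n * v n @[n --> \oo] --> (0 : C).
Proof.
move=> /cvg_normcP hu vK; apply/cvg_normcP => e e0.
have K0 : 0 <= K by apply: le_trans (vK 0%N); exact: normc_ge0.
have K10 : 0 < K + 1 by rewrite ltr_wpDl.
apply: filterS (hu _ (divr_gt0 e0 K10)) => n; rewrite !subr0 ltr_pdivlMr// => h.
apply: le_lt_trans h; rewrite normcM ler_wpM2l ?normc_ge0// (le_trans (vK n))// lerDl//.
Qed.

Lemma ccvg_quotient v p (P q : C) : P != 0 -> p @ \oo --> P -> v n * p n @[n --> \oo] --> q ->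
  v @ \oo --> q / P.
Proof.
move=> P0 hp hvp; have := ccvgM hvp (ccvgV P0 hp).
apply: cvg_trans; apply: near_eq_cvg.
have P0' : 0 < normc P by rewrite normc_gt0.
move/cvg_normcP : hp => /(_ _ P0'); apply: filterS => n hn.
have pn0 : p n != 0 by apply: contraTneq hn => ->; rewrite sub0r normcN ltxx.
by rewrite mulfK.
Qed.

End CvgC.
Arguments ccvg_cst {R} a.

Section Step.
Context {R : realType}.
Local Notation C := R[i].

Lemma map_inv_glue_scale m t (tau : 'rV[R]_m) :
  map_mx GRing.inv (glue_scale t tau) = glue_scale t^-1 (map_mx GRing.inv tau).
Proof.
rewrite /glue_scale map_row_mx; congr row_mx; apply/rowP => j.
by rewrite !ord1 !mxE eqxx !mulr1n.
Qed.

Lemma all_pos_inv m (tau : 'rV[R]_m) : all_pos tau -> all_pos (map_mx GRing.inv tau).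
Proof. by move=> h j; rewrite mxE invr_gt0. Qed.

Lemma map_invK m (tau : 'rV[R]_m) : map_mx GRing.inv (map_mx GRing.inv tau) = tau.
Proof. by apply/rowP => j; rewrite !mxE invrK. Qed.

(** u n is the Gaussian sum at -pi, times the mesh.  The square of the ratio of the
Gaussian sum at pi i N_11 to this one tends to -pi / (pi i N_11), which is
i / N_11. *)
Lemma riemann_square m (N : 'M[C]_(1 + m)) tau (u : nat -> R) : siegel N -> all_pos tau ->
  (forall n, gsum (- (pi : R)%:C) 0 (mesh n) = (u n / mesh n)%:C) -> (forall n, expR (- pi) <= u n) ->
  ((mesh n)%:C * Theta N (glue_scale (mesh n) tau) / (u n)%:C) ^+ 2 @[n --> \oo] -->
    'i / N 0 0 * Theta (schur N) tau ^+ 2.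
Proof.
move=> sN ptau uE uge; set T := Theta (schur N) tau.
pose al : C := (pi : R)%:C * 'i * N 0 0; have al0 : complex.Re al < 0 := Re_gauss_coef sN.
have a0 : 0 < - complex.Re al by rewrite oppr_gt0.
have N0 := siegel00_neq0 sN; have p0 := pi_gt0 R.
have pC0 : (pi : R)%:C != 0 :> C by rewrite -normc_eq0 normc_real normr_eq0 gt_eqF.
have i0 : 'i != 0 :> C by rewrite -normc_eq0 normc_i oner_eq0.
have alN0 : al != 0 by rewrite !mulf_neq0.
have u0 n : 0 < u n := lt_le_trans (expR_gt0 _) (uge n).
have uC0 n : (u n)%:C != 0 :> C by rewrite -normc_eq0 normc_real normr_eq0 gt_eqF.
have uN n : normc (u n)%:C^-1 <= expR pi.
  rewrite normcV normc_real gtr0_norm// -[expR pi]invrK -expRN lef_pV2 ?posrE ?expR_gt0//.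
have [K3 K30 hK3] := gsum_has_sum (normc al) 0 a0.
have al1 : complex.Re al <= - - complex.Re al by rewrite opprK.
have n0 : normc (0 : R[i]) <= 0 by rewrite normc0.
pose x n := (mesh n)%:C * Theta N (glue_scale (mesh n) tau) / (u n)%:C.
pose g n := (mesh n)%:C * gsum al 0 (mesh n) / (u n)%:C.
have gN n : normc (g n) <= K3 * expR pi.
  rewrite /g normcM ler_pM ?normc_ge0// normcM normc_real gtr0_norm ?mesh_gt0//.
  rewrite -ler_pdivlMl ?mesh_gt0// mulrC.
  by have [_ ] := hK3 _ _ _ al1 (lexx _) n0 (mesh_gt0 n) (mesh_le1 n).
have d0 : x n - g n * T @[n --> \oo] --> (0 : C).
  have := ccvg_bounded (Theta_riemann sN ptau) uN; rewrite -/al.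
  have -> // : (fun n => ((mesh n)%:C * Theta N (glue_scale (mesh n) tau) - (mesh n)%:C * gsum al 0 (mesh n) * T) * (u n)%:C^-1)
    = (fun n => x n - g n * T).
  by apply/funext => n; rewrite /x /g mulrBl; congr (_ - _); ring.
have g2 : g n ^+ 2 @[n --> \oo] --> 'i / N 0 0.
  have Rp : complex.Re (- (pi : R)%:C) < 0 by rewrite cReN oppr_lt0.
  have uN2 n : normc ((u n)%:C^-1 ^+ 2) <= expR pi ^+ 2.
    by rewrite normcX lerXn2r ?nnegrE ?normc_ge0 ?expR_ge0.
  have := ccvg_bounded (gsum_square_cvg Rp al0) uN2.
  have -> : (fun n => (al * ((mesh n)%:C * gsum al 0 (mesh n)) ^+ 2 -
       - (pi : R)%:C * ((mesh n)%:C * gsum (- (pi : R)%:C) 0 (mesh n)) ^+ 2) * (u n)%:C^-1 ^+ 2) =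
     (fun n => al * g n ^+ 2 + (pi : R)%:C).
    apply/funext => n; rewrite uE.
    have -> : (mesh n)%:C * (u n / mesh n)%:C = (u n)%:C :> C.
      by rewrite -rmorphM mulrCA divff ?mulr1// gt_eqF// mesh_gt0.
    by rewrite /g; move: (uC0 n); set U := (u n)%:C; set V := (mesh n)%:C => U0; field.
  move=> h; have := ccvgM (ccvg_cst al^-1) (ccvgD h (ccvg_cst (- (pi : R)%:C))).
  have -> : (fun n => al^-1 * (al * g n ^+ 2 + (pi : R)%:C + - (pi : R)%:C)) = (fun n => g n ^+ 2).
    by apply/funext => n; rewrite addrK mulKf.
  suff -> : al^-1 * (0 + - (pi : R)%:C) = 'i / N 0 0 by [].
  rewrite /al add0r; have i2 : 'i ^+ 2 = -1 :> C := sqr_i R.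
  apply: (mulfI alN0); rewrite mulVKf// /al.
  have -> : (pi : R)%:C * 'i * N 0 0 * ('i / N 0 0) = (pi : R)%:C * 'i ^+ 2 by field.
  by rewrite i2 mulrN1.
have xE n : x n ^+ 2 = g n ^+ 2 * T ^+ 2 + ((x n - g n * T) * (2 * T) * g n + (x n - g n * T) * (x n - g n * T)).
  by ring.
have -> : (fun n => x n ^+ 2) = (fun n => g n ^+ 2 * T ^+ 2 + ((x n - g n * T) * (2 * T) * g n + (x n - g n * T) * (x n - g n * T))).
  by apply/funext.
have d1 := ccvgM d0 (ccvg_cst (2 * T)); rewrite mul0r in d1.
have d2 := ccvg_bounded d1 gN.
have d3 := ccvgM d0 d0; rewrite mul0r in d3.
have d4 := ccvgD d2 d3; rewrite addr0 in d4.
by have := ccvgD (ccvgM g2 (ccvg_cst (T ^+ 2))) d4; rewrite addr0.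
Qed.

(** Only the limits of the two sides are compared.  After normalization the unknown
constants converge because they can be read off at z0, where the limit of the
right side is not 0. *)
Lemma theta_step (D : Type) m (f h : D -> C) (N M : D -> 'M[C]_(1 + m)) (z0 : D) :
  (forall z, siegel (N z)) -> (forall z, siegel (M z)) -> (forall z, h z != 0) ->
  (forall tau, all_pos tau -> Theta (drsubmx (M z0)) tau != 0) ->
  (forall tau, all_pos tau -> exists c, forall z,
     f z * Theta (N z) tau ^+ 2 = c * h z * Theta (M z) (map_mx GRing.inv tau) ^+ 2) ->
  forall tau, all_pos tau -> exists c, forall z,
     f z / N z 0 0 * Theta (schur (N z)) tau ^+ 2 =
     c * h z * Theta (drsubmx (M z)) (map_mx GRing.inv tau) ^+ 2.
Proof.
move=> sN sM h0 T0 H tau ptau; have itau := all_pos_inv ptau.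
have /choice[c hc] : forall n, exists c, forall z,
    f z * Theta (N z) (glue_scale (@mesh R n) tau) ^+ 2 =
    c * h z * Theta (M z) (glue_scale (@mesh R n)^-1 (map_mx GRing.inv tau)) ^+ 2.
  move=> n; have [c hc] := H _ (all_pos_glue (mesh_gt0 n) ptau).
  by exists c => z; rewrite hc map_inv_glue_scale.
have /choice[u hu] : forall n, exists r : R,
    gsum (- (pi : R)%:C) 0 (mesh n) = (r / mesh n)%:C /\ expR (- pi) <= r.
  move=> n; have [r rE re] := @gsum_base R _ (mesh_gt0 n) (mesh_le1 n).
  by exists (mesh n * r); rewrite rE mulrC mulKf// gt_eqF// mesh_gt0.
have uE n := (hu n).1; have ue n := (hu n).2.
have u0 n : 0 < u n := lt_le_trans (expR_gt0 _) (ue n).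
have uC0 n : (u n)%:C != 0 :> C by rewrite -normc_eq0 normc_real normr_eq0 gt_eqF.
pose v n : C := ((mesh n)%:C / (u n)%:C) ^+ 2 * c n.
pose X z n := f z * ((mesh n)%:C * Theta (N z) (glue_scale (mesh n) tau) / (u n)%:C) ^+ 2.
pose P z n := h z * Theta (M z) (glue_scale (@mesh R n)^-1 (map_mx GRing.inv tau)) ^+ 2.
have XE z n : X z n = v n * P z n.
  rewrite /X /v /P -[RHS]mulrA [c n * (_ * _)]mulrA -hc.
  by move: (uC0 n); set U := (u n)%:C; set V := (mesh n)%:C => U0; field.
have hX z : X z @ \oo --> f z * ('i / N z 0 0 * Theta (schur (N z)) tau ^+ 2).
  exact: ccvgM (ccvg_cst _) (riemann_square (sN z) ptau uE ue).
have hP z : P z @ \oo --> h z * Theta (drsubmx (M z)) (map_mx GRing.inv tau) ^+ 2.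
  have hT := Theta_concentrate (sM z) itau.
  exact: ccvgM (ccvg_cst _) (ccvgM hT hT).
have P0 : h z0 * Theta (drsubmx (M z0)) (map_mx GRing.inv tau) ^+ 2 != 0.
  by rewrite mulf_neq0 ?expf_neq0// T0.
pose q := f z0 * ('i / N z0 0 0 * Theta (schur (N z0)) tau ^+ 2) /
  (h z0 * Theta (drsubmx (M z0)) (map_mx GRing.inv tau) ^+ 2).
have hv : v @ \oo --> q.
  apply: (ccvg_quotient P0 (hP z0)); have := hX z0.
  by have -> : X z0 = (fun n => v n * P z0 n) by apply/funext => n; exact: XE.
exists (q / 'i) => z.
have hvP : v n * P z n @[n --> \oo] --> f z * ('i / N z 0 0 * Theta (schur (N z)) tau ^+ 2).
  by have := hX z; have -> // : X z = (fun n => v n * P z n) by apply/funext => n; exact: XE.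
have e := ccvg_unique hvP (ccvgM hv (hP z)).
have i0 : 'i != 0 :> C by rewrite -normc_eq0 normc_i oner_eq0.
have N0 := siegel00_neq0 (sN z).
have key (I F b T q' H' T' : C) : I != 0 -> b != 0 -> F * (I / b * T ^+ 2) = q' * (H' * T' ^+ 2) ->
    F / b * T ^+ 2 = q' / I * H' * T' ^+ 2.
  move=> I0 b0 e'.
  have -> : q' / I * H' * T' ^+ 2 = q' * (H' * T' ^+ 2) / I by ring.
  by rewrite -e'; field; rewrite I0 b0.
exact: key i0 N0 e.
Qed.

(** On the imaginary axis all terms are positive. *)
Lemma Theta_base_neq0 m (Y : 'M[R]_m) tau : posdef Y -> all_pos tau -> Theta ('i *: cM Y) tau != 0.
Proof.
move=> pY ptau.
have sY : siegel ('i *: cM Y : 'M[C]_m).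
  have e : ImMx ('i *: cM Y : 'M[C]_m) = Y.
    by apply/matrixP => i j; rewrite !mxE /= mul0r mul1r add0r.
  by split; rewrite ?e// linearZ/= -cMT pY.1.
have := has_sum_Theta sY ptau.
have -> : theta_term ('i *: cM Y) tau = (fun k => (expR (- pi * bil Y (scale_point tau k) (scale_point tau k)))%:C).
  apply/funext => k; rewrite /theta_term /expi bil_scale bil_cM -cexp_real; congr cexp.
  rewrite rmorphM rmorphN mulrA -[_ * 'i * 'i]mulrA -expr2 sqr_i; ring.
move=> /(has_sum_real_ge (fun=> expR_ge0 _))/(_ [fset 0]%fset); rewrite big_seq_fset1 => h.
have : 0 < Theta ('i *: cM Y) tau.
  by apply: lt_le_trans h; rewrite ltcR expR_gt0.
by case/lt0r_neq0/negP: (h) || move/lt0r_neq0.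
Qed.

Lemma Theta_dim0 (N : 'M[C]_0) tau : siegel N -> Theta N tau = 1.
Proof.
move=> sN; have ptau : all_pos tau by case.
apply: has_sum_unique (has_sum_Theta sN ptau) _ => e e0; exists [fset 0]%fset => B B0.
have -> : B = [fset 0]%fset.
  by apply/eqP; rewrite eqEfsubset B0 andbT; apply/fsubsetP => k _; rewrite inE; apply/eqP/rowP => -[].
by rewrite big_seq_fset1 /theta_term /bil mxE big1 ?expi0 ?subrr ?normc0// => -[].
Qed.

Lemma invmx_uniq (K : fieldType) m (A B : 'M[K]_m) : A *m B = 1%:M -> invmx A = B.
Proof.
by move=> AB; have [Au _] := mulmx1_unit AB; rewrite -[RHS](mulKmx Au) AB mulmx1.
Qed.

(** This lets the induction on the dimension keep track of the inverse of N while N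
itself is replaced by Schur complements. *)
Lemma invmx_schur (K : fieldType) m (N : 'M[K]_(1 + m)) : N^T = N -> N \in unitmx -> N 0 0 != 0 ->
  invmx (schur N) = drsubmx (invmx N).
Proof.
move=> NT Nu b0; apply: invmx_uniq; set P := invmx N.
have := mulmxV Nu; rewrite -/P {1}(block_sym NT) -[P]submxK mulmx_block -[1%:M]submxK.
move=> /eq_block_mx[_ e1 _ e2].
have e1' : ursubmx P = - (N 0 0)^-1 *: (ursubmx N *m drsubmx P).
  move/eqP: e1; rewrite mul_scalar_mx.
  have -> : ursubmx (1%:M : 'M[K]_(1 + m)) = 0 by rewrite scalar_mx_block block_mxKur.
  rewrite addr_eq0 => /eqP e1; rewrite scaleNr -scalerN -e1 scalerA mulVf// scale1r//.
move: e2; rewrite block_mxKdr.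
have -> : drsubmx (1%:M : 'M[K]_(1 + m)) = 1%:M by rewrite scalar_mx_block block_mxKdr.
move=> <-; rewrite /schur mulmxBl addrC; congr (_ + _).
by rewrite e1' -scalemxAr -scalemxAl mulmxA scaleNr.
Qed.

Lemma schur_imag m (X : 'M[R]_(1 + m)) : schur ('i *: cM X) = 'i *: cM (schur X) :> 'M[C]_m.
Proof.
have i0 : 'i != 0 :> C by rewrite -normc_eq0 normc_i oner_eq0.
have hu : ursubmx ('i *: cM X : 'M[C]_(1 + m)) = 'i *: cM (ursubmx X).
  by apply/matrixP => a b; rewrite !mxE.
have hd : drsubmx ('i *: cM X : 'M[C]_(1 + m)) = 'i *: cM (drsubmx X).
  by apply/matrixP => a b; rewrite !mxE.
rewrite /schur hu hd; apply/matrixP => a b; rewrite !mxE !big_ord1 !mxE.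
rewrite rmorphB !rmorphM fmorphV /=; have [e|e] := eqVneq ((X 0 0)%:C : C) 0.
  by rewrite e mulr0 invr0 !mul0r !subr0.
by field; rewrite i0 e.
Qed.

(** Each application of [theta_step] removes the first coordinate from both sides
and puts the factor 1 / N_11 into f.  In dimension one it is applied in both
directions: the left side gives f / N_11 = c1 h, and the equation with the roles
of N and M exchanged gives h / M_11 = c2 f. *)
Theorem theta_inverse m (D : Type) (f h : D -> C) (N M : D -> 'M[C]_m.+1) (z0 : D) (X Y : 'M[R]_m.+1) :
  (forall z, siegel (N z)) -> (forall z, siegel (M z)) ->
  (forall z, f z != 0) -> (forall z, h z != 0) ->
  posdef X -> posdef Y -> N z0 = 'i *: cM X -> M z0 = 'i *: cM Y ->
  (forall tau, all_pos tau -> exists c, forall z,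
     f z * Theta (N z) tau ^+ 2 = c * h z * Theta (M z) (map_mx GRing.inv tau) ^+ 2) ->
  exists K, forall z, M z ord_max ord_max = K * invmx (N z) ord_max ord_max.
Proof.
have i0 : 'i != 0 :> C by rewrite -normc_eq0 normc_i oner_eq0.
have drpos k (Z : 'M[R]_(1 + k)) : posdef Z -> posdef (drsubmx Z).
  move=> [ZT pZ]; split; first by rewrite trmx_drsub ZT.
  move=> v v0; have := pZ (row_mx 0%:M v) (row_mx0P _ v0).
  by rewrite bil_block// expr0n/= !mulr0 mul0r !add0r.
elim: m D f h N M X Y => [|m IH] D f h N M X Y in z0 *;
  move=> sN sM f0 h0 pX pY NX MY H.
  have [] := @theta_step D 0 f h N M z0 sN sM h0 _ H 0.
  - by move=> tau ptau; rewrite Theta_dim0 ?oner_eq0//; exact: (@siegel_drsub _ 0).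
  - by case.
  move=> c1 hc1.
  have H' tau : all_pos tau -> exists c, forall z,
     h z * Theta (M z) tau ^+ 2 = c * f z * Theta (N z) (map_mx GRing.inv tau) ^+ 2.
    move=> ptau; have ip := all_pos_inv ptau; have [c hc] := H _ ip; exists c^-1 => z.
    have c0 : c != 0.
      have := hc z0; apply: contra_eqN => /eqP ->; rewrite !mul0r NX.
      by rewrite mulf_neq0 ?f0// expf_neq0// Theta_base_neq0.
    by rewrite -[RHS]mulrA hc map_invK -[c * _ * _]mulrA mulKf.
  have [] := @theta_step D 0 h f M N z0 sM sN f0 _ H' 0.
  - by move=> tau ptau; rewrite Theta_dim0 ?oner_eq0//; exact: (@siegel_drsub _ 0).
  - by case.
  move=> c2 hc2.
  exists (c1 * c2)^-1 => z; have Nb := @siegel00_neq0 _ 0 _ (sN z); have Mb := @siegel00_neq0 _ 0 _ (sM z).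
  have e1 := hc1 z; have e2 := hc2 z.
  rewrite !(Theta_dim0 _ (@siegel_schur _ 0 _ (sN z)), Theta_dim0 _ (@siegel_drsub _ 0 _ (sM z))) expr1n !mulr1 in e1.
  rewrite !(Theta_dim0 _ (@siegel_schur _ 0 _ (sM z)), Theta_dim0 _ (@siegel_drsub _ 0 _ (sN z))) expr1n !mulr1 in e2.
  have iE : invmx (N z) 0 0 = (N z 0 0)^-1.
    have -> : invmx (N z) = ((N z 0 0)^-1)%:M.
      apply: invmx_uniq; rewrite mul_mx_scalar; apply/matrixP => a b.
      by rewrite !ord1 !mxE eqxx mulVf.
    by rewrite mxE eqxx.
  rewrite !ord1 iE.
  have c10 : c1 != 0.
    by move: e1; apply: contra_eqN => /eqP ->; rewrite mul0r mulf_neq0 ?f0// invr_neq0.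
  have c20 : c2 != 0.
    by move: e2; apply: contra_eqN => /eqP ->; rewrite mul0r mulf_neq0 ?h0// invr_neq0.
  have fz := f0 z; have hz := h0 z.
  have : (c1 * c2) * (M z 0 0 * N z 0 0) = 1.
    have e3 : f z = c1 * h z * N z 0 0 by rewrite -e1 divfK.
    have e4 : h z = c2 * f z * M z 0 0 by rewrite -e2 divfK.
    apply: (mulfI fz); rewrite mulr1 [RHS]e3 [in RHS]e4; ring.
  move=> e; apply: (mulfI (mulf_neq0 c10 c20)); rewrite mulVKf ?mulf_neq0//.
  by apply: (mulIf Nb); rewrite mulVf// -mulrA.
have MYd : drsubmx (M z0 : 'M[C]_(1 + m.+1)) = 'i *: cM (@drsubmx _ 1 m.+1 1 m.+1 Y).
  by rewrite MY; apply/matrixP => a b; rewrite !mxE.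
have hs := @theta_step D m.+1 f h N M z0 sN sM h0 _ H.
have [] := IH D (fun z => f z / N z 0 0) h (fun z => @schur _ m.+1 (N z))
   (fun z => @drsubmx _ 1 m.+1 1 m.+1 (M z)) (@schur _ m.+1 X) (@drsubmx _ 1 m.+1 1 m.+1 Y) z0.
- by move=> z; exact: (@siegel_schur _ m.+1).
- by move=> z; exact: (@siegel_drsub _ m.+1).
- by move=> z; rewrite mulf_neq0 ?invr_neq0//; exact: (@siegel00_neq0 _ m.+1).
- exact: h0.
- exact: (@posdef_schur _ m.+1).
- exact: drpos.
- by rewrite NX; exact: schur_imag.
- exact: MYd.
- by apply: hs => tau ptau; rewrite MYd Theta_base_neq0//; exact: drpos.
move=> K hK; exists K => z; have := hK z.
rewrite (@invmx_schur _ m.+1) ?(sN z).1 ?siegel_unit//; last exact: (@siegel00_neq0 _ m.+1).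
have om : rshift 1 (ord_max : 'I_m.+1) = ord_max :> 'I_(1 + m.+1) by exact: val_inj.
by rewrite !mxE om.
Qed.

End Step.

(** * From lattices to matrices *)

Lemma gram_congr (K : comNzRingType) p q m (u : 'M[K]_(p, m)) (v : 'M[K]_(m, q)) (T Ti X : 'M[K]_m) :
  Ti *m T = 1%:M -> u *m (T *m X *m Ti) *m (T *m T^T) *m v = u *m T *m X *m (T^T *m v).
Proof. by move=> TiT; rewrite !mulmxA -(mulmxA _ Ti) TiT mulmx1. Qed.

Section Gram.
Context {R : realType}.
Local Notation C := R[i].

Lemma bil_delta (K : pzRingType) m (N : 'M[K]_m) i j : bil N (delta_mx 0 i) (delta_mx 0 j) = N i j.
Proof. by rewrite /bil -rowE trmx_delta -colE !mxE. Qed.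

Lemma bil_ext (K : pzRingType) m (N N' : 'M[K]_m) :
  (forall u v, bil N u v = bil N' u v) -> N = N'.
Proof. by move=> h; apply/matrixP => i j; rewrite -bil_delta h bil_delta. Qed.

(** Polarization; it is enough to know the two forms on real vectors. *)
Lemma bil_ext_diag m (N N' : 'M[C]_m) : N^T = N -> N'^T = N' ->
  (forall u : 'rV[R]_m, bil N (cM u) (cM u) = bil N' (cM u) (cM u)) -> N = N'.
Proof.
move=> NT NT' h.
have e (X : 'M[C]_m) i j : X^T = X -> bil X (cM (delta_mx 0 i + delta_mx 0 j)) (cM (delta_mx 0 i + delta_mx 0 j))
   = X i i + 2 * X i j + X j j.
  move=> XT; have -> : cM (delta_mx 0 i + delta_mx 0 j : 'rV[R]_m) = delta_mx 0 i + delta_mx 0 j.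
    by rewrite /cM map_mxD !map_delta_mx.
  rewrite bilDl !bilDr !bil_delta -[X j i](mxE trmx_key (fun a b => X b a)).
  by rewrite -[matrix_of_fun _ _]/(X^T) XT; ring.
have d i : N i i = N' i i.
  by have := h (delta_mx 0 i); rewrite /cM !map_delta_mx !bil_delta.
apply/matrixP => i j; have := h (delta_mx 0 i + delta_mx 0 j).
rewrite !e// !d => /addIr /addrI /mulfI; apply; by rewrite pnatr_eq0.
Qed.

Context {m : nat} (rho : 'rV[R]_m -> 'rV[R]_m -> R) (rho_psb : posdef_symmetric_bilinear rho).

Definition gram : 'M[R]_m := \matrix_(i, j) rho (delta_mx 0 i) (delta_mx 0 j).

Lemma rho0l v : rho 0 v = 0.
Proof. by have := psb_linear rho_psb (-1) 0 0 v; rewrite scaler0 addr0 => h; lra. Qed.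
Lemma rhoDl u u' v : rho (u + u') v = rho u v + rho u' v.
Proof. by have := psb_linear rho_psb 1 u u' v; rewrite scale1r mul1r. Qed.
Lemma rhoZl a u v : rho (a *: u) v = a * rho u v.
Proof. by have := psb_linear rho_psb a u 0 v; rewrite rho0l !addr0. Qed.
Lemma rho_suml (I : finType) (f : I -> 'rV[R]_m) v : rho (\sum_i f i) v = \sum_i rho (f i) v.
Proof. by apply: (big_morph (rho^~ v)) => [x y|]; rewrite ?rhoDl ?rho0l. Qed.

Lemma rho_gram u v : rho u v = bil gram u v.
Proof.
rewrite {1}[u]row_sum_delta rho_suml /bil [RHS]mxE.
under [RHS]eq_bigr do rewrite mxE mulr_suml.
rewrite exchange_big /=; apply: eq_bigr => i _; rewrite rhoZl (psb_sym rho_psb).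
rewrite {1}[v]row_sum_delta rho_suml mulr_sumr; apply: eq_bigr => j _.
by rewrite rhoZl !mxE (psb_sym rho_psb); ring.
Qed.

Lemma gram_posdef : posdef gram.
Proof.
split; first by apply/matrixP => i j; rewrite !mxE (psb_sym rho_psb).
by move=> v v0; rewrite -rho_gram; apply: (psb_pos rho_psb).
Qed.

Lemma form_ext_gram z w : form_ext rho z w = bil (cM gram) z w.
Proof.
rewrite [in RHS](cM_ReIm z) [in RHS](cM_ReIm w) !bilDl !bilDr !bilZl !bilZr !bil_cM.
rewrite /form_ext !rho_gram -[Re_vec z]/(ReMx z) -[Re_vec w]/(ReMx w).
rewrite -[Im_vec z]/(ImMx z) -[Im_vec w]/(ImMx w).
by apply/eqP; rewrite eq_complex !(cReD, cReM, cImD, cImM) /=; apply/andP; split; apply/eqP; ring.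
Qed.

Lemma dual_lattice_basis (L : set 'rV[R]_m) (B : 'M[R]_m) : B \in unitmx ->
  L = [set map_mx intr k *m B | k in [set: 'rV[int]_m]] ->
  dual_lattice rho L = [set map_mx intr k *m invmx (gram *m B^T) | k in [set: 'rV[int]_m]].
Proof.
move=> Bu ->; have Gu : gram \in unitmx.
  have [T Tu ->] := cholesky gram_posdef; by rewrite unitmx_mul unitmx_tr Tu.
have GBu : gram *m B^T \in unitmx by rewrite unitmx_mul unitmx_tr Gu.
have GT := gram_posdef.1.
have rE k (x : 'rV[R]_m) : rho (map_mx intr k *m B) x = \sum_j (k 0 j)%:~R * (x *m (gram *m B^T)) 0 j.
  rewrite (psb_sym rho_psb) rho_gram /bil trmx_mul !mulmxA mxE; apply: eq_bigr => j _.
  by rewrite mulrC; congr (_ * _); rewrite !mxE.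
apply/seteqP; split=> x /=.
  move=> hx; have hi j : (x *m (gram *m B^T)) 0 j \is a Num.int.
    have hj : rho (map_mx intr (delta_mx 0 j : 'rV[int]_m) *m B) x \is a Num.int.
      by apply: hx; exists (delta_mx 0 j).
    move: hj; rewrite rE (bigD1 j)//= big1 => [|k kj]; rewrite [delta_mx _ _ _ _]mxE eqxx /=.
      by rewrite eqxx mul1r addr0.
    by rewrite (negbTE kj) mul0r.
  exists (\row_j Num.floor ((x *m (gram *m B^T)) 0 j)) => //.
  apply: (canLR (mulmxK GBu)); apply/rowP => j; rewrite 2!mxE.
  by have := hi j; rewrite Num.Theory.intrEfloor => /eqP.
move=> [k _ <-] _ [l _ <-]; rewrite rE mulmxKV// rpred_sum// => j _.
by rewrite mxE rpredM// Num.Theory.intr_int.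
Qed.

End Gram.

Section Setting.
Context {R : realType}.
Local Notation C := R[i].
Context {m n : nat} (rho : 'rV[R]_m -> 'rV[R]_m -> R) (rho_psb : posdef_symmetric_bilinear rho)
  (psi : {linear 'rV[C]_n -> 'M[C]_m}) (psi_sa : preserves_real_selfadjoint rho psi)
  (T : 'M[R]_m) (Tu : T \in unitmx) (TE : gram rho = T *m T^T).

(** The matrix of [psi x] in a rho-orthonormal basis, when [T *m T^T] is the Gram
matrix of rho; vectors are rows, so T maps coordinates to orthonormal ones. *)
Definition orth_op (x : 'rV[R]_n) : 'M[R]_m := invmx T *m ReMx (psi (cvec x)) *m T.

(** The complex linear extension of a real linear map. *)
Definition cext (A : 'rV[R]_n -> 'M[R]_m) (z : 'rV[C]_n) : 'M[C]_m :=
  cM (A (Re_vec z)) + 'i *: cM (A (Im_vec z)).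

Lemma psi_real x : psi (cvec x) = cM (ReMx (psi (cvec x))).
Proof.
apply/row_matrixP => i; have [/(_ (delta_mx 0 i))[w hw] _] := psi_sa x.
have e : row i (psi (cvec x)) = cvec w.
  by rewrite -hw rowE; congr (_ *m _); rewrite /cvec map_delta_mx.
rewrite e; apply/rowP => j; have /rowP/(_ j) := e; rewrite !mxE => ->.
by [].
Qed.

Lemma orth_op_conj x : ReMx (psi (cvec x)) = T *m orth_op x *m invmx T.
Proof. by rewrite /orth_op !mulmxA mulmxV// mul1mx mulmxK. Qed.

Lemma orth_op_sym x : (orth_op x)^T = orth_op x.
Proof.
set P := ReMx (psi (cvec x)).
have PS : P *m gram rho = gram rho *m P^T.
  apply: bil_ext => u v; have [_ /(_ u v)] := psi_sa x.
  rewrite !(form_ext_gram rho_psb) psi_real -/P -!cMM !bil_cM => -[].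
  by rewrite /bil trmx_mul !mulmxA.
have e1 : T^T *m P^T = invmx T *m P *m T *m T^T.
  by rewrite -(mulmxA _ T T^T) -TE -(mulmxA _ P) PS TE !mulmxA mulVmx// mul1mx.
by rewrite /orth_op -/P !trmx_mul mulmxA e1 -(mulmxA _ T^T) -trmx_mul mulVmx// trmx1 mulmx1.
Qed.

Lemma psi_conj x : psi (cvec x) = cM T *m cM (orth_op x) *m cM (invmx T).
Proof. by rewrite psi_real orth_op_conj !cMM. Qed.

Lemma cext_psi z : psi z = cM T *m cext orth_op z *m cM (invmx T).
Proof.
have zE : z = cvec (Re_vec z) + 'i *: cvec (Im_vec z) by exact: cM_ReIm.
rewrite [in LHS]zE linearD linearZ /= !psi_conj /cext.
by rewrite mulmxDr mulmxDl -scalemxAr -scalemxAl.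
Qed.

Lemma orth_op_linear a x y : orth_op (a *: x + y) = a *: orth_op x + orth_op y.
Proof.
rewrite /orth_op; have -> : cvec (a *: x + y) = a%:C *: cvec x + cvec y.
  by rewrite /cvec map_mxD map_mxZ.
rewrite linearD linearZ /=.
have -> : ReMx (a%:C *: psi (cvec x) + psi (cvec y)) = a *: ReMx (psi (cvec x)) + ReMx (psi (cvec y)).
  by apply/matrixP => i j; rewrite !mxE !cReD cReM /= mul0r subr0.
by rewrite mulmxDr mulmxDl -scalemxAr -scalemxAl.
Qed.

Lemma orth_op_inj : injective psi -> injective orth_op.
Proof.
move=> inj x y e; have : psi (cvec x) = psi (cvec y).
  by rewrite psi_real [RHS]psi_real !orth_op_conj e.
by move=> /inj/(@cM_inj _ _ _).
Qed.

Lemma orth_op_unit e : psi (cvec e) = 1%:M -> orth_op e = 1%:M.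
Proof.
move=> h; rewrite /orth_op h; have -> : ReMx (1%:M : 'M[C]_m) = 1%:M.
  by apply/matrixP => i j; rewrite !mxE; case: eqP.
by rewrite mulmx1 mulVmx.
Qed.

Lemma bil_conj (K : comUnitRingType) k (P : 'M[K]_k) (N : 'M[K]_k) u v :
  bil (P *m N *m P^T) u v = bil N (u *m P) (v *m P).
Proof. by rewrite /bil trmx_mul !mulmxA. Qed.

Lemma cone_orth_op x : cone rho psi x <-> posdef (orth_op x).
Proof.
have key u : form_ext rho (cvec u *m psi (cvec x)) (cvec u) = (bil (orth_op x) (u *m T) (u *m T))%:C.
  rewrite (form_ext_gram rho_psb) psi_real orth_op_conj -cMM bil_cM; congr (_%:C).
  rewrite /bil TE trmx_mul !mulmxA; congr ((_ *m _) 0 0).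
  by rewrite mulmxKV.
split=> [h|[_ h]].
  split=> [|v v0]; first exact: orth_op_sym.
  have := h (v *m invmx T); rewrite key ltcR mulmxKV//; apply.
  by apply: contraNneq v0 => /(congr1 (mulmx^~ T)); rewrite mulmxKV// mul0mx => ->.
move=> u u0; rewrite key ltcR; apply: h.
by apply: contraNneq u0 => /(congr1 (mulmx^~ (invmx T))); rewrite mulmxK// mul0mx => ->.
Qed.

Lemma ImMx_cext (A : 'rV[R]_n -> 'M[R]_m) z : ImMx (cext A z) = A (Im_vec z).
Proof. by apply/matrixP => i j; rewrite !mxE cImD cImM /= mul0r mul1r !add0r. Qed.

Lemma siegel_cext (A : 'rV[R]_n -> 'M[R]_m) z : (forall x, (A x)^T = A x) ->
  posdef (A (Im_vec z)) -> siegel (cext A z).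
Proof.
move=> As h; split; last by rewrite ImMx_cext.
by rewrite linearD linearZ /= -!cMT !As.
Qed.

Lemma scale_point_diag k (tau : 'rV[R]_k) (q : 'rV[int]_k) : scale_point tau q = map_mx intr q *m diag_mx tau.
Proof. by apply/rowP => j; rewrite mul_mx_diag !mxE mulrC. Qed.

(** The basis B identifies the summation set with the integer vectors.  Splitting off
the scaling tau leaves a congruence by P that does not change along the
degeneration of the lattice. *)
Lemma theta_Theta (L : set 'rV[R]_m) (B P : 'M[R]_m) tau z :
  dual_lattice rho L = [set map_mx intr k *m B | k in [set: 'rV[int]_m]] ->
  B \in unitmx -> B *m T = diag_mx tau *m P -> all_pos tau -> siegel (cM P *m cext orth_op z *m (cM P)^T) ->
  theta rho psi L z 0 = Theta (cM P *m cext orth_op z *m (cM P)^T) tau.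
Proof.
move=> LE Bu BT ptau sN; apply: has_sum_sum.
have inL k : map_mx intr k *m B \in dual_lattice rho L by rewrite LE inE; exists k.
pose h' (k : 'rV[int]_m) : dual_lattice rho L := SigSub (inL k).
pose h (l : dual_lattice rho L) : 'rV[int]_m := \row_j Num.floor ((val l *m invmx B) 0 j).
have hK : cancel h h'.
  move=> l; apply: val_inj => /=.
  have [k _ kl] : [set map_mx intr k *m B | k in [set: 'rV[int]_m]] (val l).
    by rewrite -LE; exact: set_mem (valP l).
  rewrite -kl; congr (_ *m _); apply/rowP => j; rewrite mxE mxE -kl mulmxK// mxE.
  by rewrite Num.Theory.intrKfloor.
have h'K : cancel h' h.
  by move=> k; apply/rowP => j; rewrite mxE /= mulmxK// mxE Num.Theory.intrKfloor.
apply: eq_has_sum (has_sum_reindex hK h'K (has_sum_Theta sN ptau)) => l /=.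
rewrite -[in RHS](hK l); set k := h l; rewrite /theta_term /expi; congr (cexp (_ * _)) => /=.
rewrite scaler0 addr0 (form_ext_gram rho_psb) cext_psi TE bil_conj -cMM.
have -> : scale_point tau k *m P = map_mx intr k *m B *m T by rewrite scale_point_diag -(mulmxA _ (diag_mx tau)) -BT mulmxA.
set l' := map_mx intr k *m B; rewrite /bil /cvec -/(cM l') !cMM cMT trmx_mul.
have e : cM (invmx T) *m cM T = 1%:M by rewrite -cMM mulVmx// /cM map_mx1.
by rewrite (gram_congr _ _ _ e).
Qed.

End Setting.

Section Inverse.
Context {R : realType}.
Local Notation C := R[i].

Lemma ex_last_row k (l : 'rV[R]_k.+1) : l != 0 -> exists2 P : 'M[R]_k.+1, P \in unitmx & row ord_max P = l.
Proof.
move=> l0; have h := mulmx_ebase l; rewrite rank_rV l0 in h.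
pose c := col_ebase l 0 0; have cE : col_ebase l = c%:M by apply/rowP => i; rewrite !ord1 !mxE eqxx mulr1n.
have c0 : c != 0.
  by have := col_ebase_unit l; rewrite cE unitmxE det_scalar1 unitfE.
have h' : c *: row 0 (row_ebase l) = l.
  rewrite -[RHS]h cE -mulmxA mul_scalar_mx; congr (_ *: _).
  apply/rowP => j; rewrite mxE [RHS]mxE (bigD1 0)//= big1 => [|i i0].
    by rewrite !mxE eqxx mul1r addr0.
  have i0' : (0%N == i) = false by rewrite eq_sym; apply/negbTE.
  by rewrite mxE /= i0' mul0r.
exists (c *: xrow 0 ord_max (row_ebase l)).
  rewrite unitmxZ ?unitfE// xrowE unitmx_mul row_ebase_unit andbT; exact: unitmx_perm.
by apply/rowP => j; rewrite -[in RHS]h' !mxE tpermR.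
Qed.

(** For every row vector l the matrices phi z and - (phi (j z))^-1 have the same
value at l: complete l to a basis P whose last row is l, and apply
[theta_inverse] to the lattices obtained from P by diagonal scalings. *)
Theorem theta_j_inverse m n (m_gt0 : (0 < m)%N) (rho : 'rV[R]_m -> 'rV[R]_m -> R)
  (rho_psb : posdef_symmetric_bilinear rho)
  (psi : {linear 'rV[C]_n -> 'M[C]_m}) (psi_sa : preserves_real_selfadjoint rho psi)
  (T : 'M[R]_m) (Tu : T \in unitmx) (TE : gram rho = T *m T^T)
  (e : 'rV[R]_n) (e_cone : cone rho psi e) (psi_e : psi (cvec e) = 1%:M)
  (j : 'rV[C]_n -> 'rV[C]_n)
  (j_tube : forall z, tube (cone rho psi) z -> tube (cone rho psi) (j z))
  (j_ie : j ('i *: cvec e) = 'i *: cvec e)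
  (h : 'rV[C]_n -> C) (h_neq0 : forall z, tube (cone rho psi) z -> h z != 0)
  (theta_j : forall L : set 'rV[R]_m, full_rank_lattice L ->
      exists c : C, forall z, tube (cone rho psi) z ->
        theta rho psi (dual_lattice rho L) (j z) 0 = c * h z * theta rho psi L z 0) z :
  tube (cone rho psi) z -> cext (orth_op psi T) z *m cext (orth_op psi T) (j z) = - 1%:M.
Proof.
case: m m_gt0 rho rho_psb psi psi_sa T Tu TE e_cone psi_e j_tube h_neq0 theta_j => // m _ rho rho_psb psi psi_sa T Tu TE e_cone psi_e j_tube h_neq0 theta_j.
set A := orth_op psi T; set phi := cext A.
have As x : (A x)^T = A x := orth_op_sym rho_psb psi_sa Tu TE x.
have sphi w : tube (cone rho psi) w -> siegel (phi w).
  by move=> /(cone_orth_op rho_psb psi_sa Tu TE); exact: siegel_cext.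
have iE : phi ('i *: cvec e) = 'i%:M.
  have Ae : A e = 1%:M by exact: orth_op_unit.
  have A0 : A 0 = 0 by have := @orth_op_linear R _ n psi T (-1) 0 0; rewrite scaler0 addr0 scaleN1r addNr.
  rewrite /phi /cext.
  have -> : Re_vec ('i *: cvec e) = 0 by apply/rowP => k; rewrite !mxE /= mul0r mul1r subrr.
  have -> : Im_vec ('i *: cvec e) = e by apply/rowP => k; rewrite !mxE /= mul0r mul1r add0r.
  by rewrite A0 Ae /cM map_mx0 add0r map_mx1 scalemx1.
have tie : tube (cone rho psi) ('i *: cvec e).
  rewrite /tube /=; have -> // : Im_vec ('i *: cvec e) = e.
  by apply/rowP => k; rewrite !mxE /= mul0r mul1r add0r.
have scong w (P : 'M[R]_m.+1) : P \in unitmx -> siegel w -> siegel (cM P *m w *m (cM P)^T).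
  move=> Pu [wT [_ wp]]; have e1 : ImMx (cM P *m w *m (cM P)^T) = P *m ImMx w *m P^T.
    rewrite {1}(cM_ReIm w) mulmxDr mulmxDl -scalemxAr -scalemxAl -cMT -!cMM.
    by apply/matrixP => a b; rewrite !mxE cImD cImM /= mul0r mul1r !add0r.
  have e2 : (cM P *m w *m (cM P)^T)^T = cM P *m w *m (cM P)^T by rewrite !trmx_mul trmxK wT mulmxA.
  split=> //; split; first exact: ImMx_sym.
  move=> v v0; rewrite e1 bil_conj; apply: wp.
  by apply: contraNneq v0 => /(congr1 (mulmx^~ (invmx P))); rewrite mulmxK// mul0mx => ->.
move=> tz; have jz := j_tube _ tz.
suff key : phi z = - invmx (phi (j z)).
  by rewrite key mulNmx mulVmx//; exact: siegel_unit (sphi _ jz).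
have ju := siegel_unit (sphi _ jz).
apply: bil_ext_diag.
- by have [] := sphi _ tz.
- by rewrite linearN /= trmx_inv; have [-> _] := sphi _ jz.
move=> l; have [->|l0] := eqVneq l 0; first by rewrite /cM map_mx0 /bil !mul0mx.
have [P Pu Pl] := ex_last_row l0.
(* In orthonormal coordinates L has the basis diag tau Q, hence its dual lattice has
   the basis diag tau^-1 P. *)
pose Q := invmx P^T.
have Qu : Q \in unitmx by rewrite unitmx_inv unitmx_tr.
pose D := {w | tube (cone rho psi) w}.
pose N (w : D) := cM Q *m phi (j (sval w)) *m (cM Q)^T.
pose M (w : D) := cM P *m phi (sval w) *m (cM P)^T.
have posPP (X : 'M[R]_m.+1) : X \in unitmx -> posdef (X *m X^T).
  move=> Xu; split=> [|v v0]; first by rewrite trmx_mul trmxK.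
  have -> : bil (X *m X^T) v v = sqn (v *m X) by rewrite sqnE /bil trmx_mul !mulmxA.
  have : v *m X != 0.
    by apply: contraNneq v0 => /(congr1 (mulmx^~ (invmx X))); rewrite mulmxK// mul0mx => ->.
  move=> vX; rewrite lt_neqAle sqn_ge0 andbT eq_sym; apply: contraNneq vX => /eqP.
  rewrite /sqn psumr_eq0 => [/allP h0|i _]; last exact: sqr_ge0.
  apply/eqP/rowP => i; have := h0 i; rewrite mem_index_enum sqrf_eq0 => /(_ isT)/eqP ->.
  by rewrite mxE.
have [] := @theta_inverse R m D (fun=> 1) (fun w => h (sval w) ^+ 2) N M (exist _ _ tie) (Q *m Q^T) (P *m P^T).
- by move=> w; apply: scong => //; apply: sphi; apply: j_tube; exact: svalP.
- by move=> w; apply: scong => //; apply: sphi; exact: svalP.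
- by move=> w; exact: oner_neq0.
- by move=> [w tw]; apply: expf_neq0; apply: h_neq0.
- exact: posPP.
- exact: posPP.
- by rewrite /N /= j_ie iE mul_mx_scalar -scalemxAl cMM cMT.
- by rewrite /M /= iE mul_mx_scalar -scalemxAl cMM cMT.
- move=> tau ptau.
  pose B := diag_mx tau *m Q *m invmx T.
  have Du : diag_mx tau \in unitmx.
    by rewrite unitmxE det_diag unitfE; apply/prodf_neq0 => i _; rewrite gt_eqF.
  have Bu : B \in unitmx by rewrite !unitmx_mul Du Qu unitmx_inv.
  pose L := [set map_mx intr k *m B | k in [set: 'rV[int]_m.+1]].
  have Lf : full_rank_lattice L by exists B.
  have [c hc] := theta_j L Lf.
  have G := gram_posdef rho_psb.
  have Gu : gram rho \in unitmx by rewrite TE unitmx_mul unitmx_tr Tu.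
  have LD := dual_lattice_basis rho_psb Bu (erefl L).
  set B' := invmx (gram rho *m B^T) in LD.
  have B'u : B' \in unitmx by rewrite unitmx_inv unitmx_mul unitmx_tr Gu.
  have LDD := dual_lattice_basis rho_psb B'u LD.
  pose Di := diag_mx (map_mx GRing.inv tau).
  have DDi : diag_mx tau *m Di = 1%:M.
    rewrite /Di mulmx_diag -diag_const_mx; congr diag_mx; apply/rowP => i.
    by rewrite !mxE divff// gt_eqF.
  have DiD : Di *m diag_mx tau = 1%:M by apply: mulmx1C.
  have QTP : Q^T *m P = 1%:M by rewrite /Q trmx_inv trmxK mulVmx.
  have TTi : T^T *m (invmx T)^T = 1%:M by rewrite -trmx_mul mulVmx// trmx1.
  have B'E : B' = Di *m P *m invmx T.
    apply: invmx_uniq; rewrite TE /B !trmx_mul tr_diag_mx !mulmxA.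
    rewrite -(mulmxA T) TTi mulmx1 -(mulmxA _ (diag_mx tau)) DDi mulmx1.
    by rewrite -(mulmxA _ Q^T) QTP mulmx1 mulmxV.
  have B''E : invmx (gram rho *m B'^T) = B.
    apply: invmx_uniq; rewrite TE B'E /B !trmx_mul tr_diag_mx !mulmxA.
    rewrite -(mulmxA T) TTi mulmx1 -(mulmxA _ Di) DiD mulmx1.
    by rewrite -(mulmxA _ P^T) mulmxV ?unitmx_tr// mulmx1 mulmxV.
  rewrite B''E in LDD.
  exists (c ^+ 2) => w; have tw := svalP w.
  rewrite mul1r -exprMn -exprMn; congr (_ ^+ 2).
  have hN : siegel (N w) by apply: scong => //; apply: sphi; exact: j_tube.
  have hM : siegel (M w) by apply: scong => //; apply: sphi.
  have <- : theta rho psi (dual_lattice rho L) (j (sval w)) 0 = Theta (N w) tau.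
    apply: (theta_Theta rho_psb psi_sa Tu TE LDD Bu _ ptau hN).
    by rewrite /B mulmxKV.
  have <- : theta rho psi L (sval w) 0 = Theta (M w) (map_mx GRing.inv tau).
    apply: (theta_Theta rho_psb psi_sa Tu TE LD B'u _ (all_pos_inv ptau) hM).
    by rewrite B'E mulmxKV.
  exact: hc.
move=> K hK.
have rowb (X : 'M[C]_m.+1) : (cM P *m X *m (cM P)^T) ord_max ord_max = bil X (cM l) (cM l).
  by rewrite -bil_delta bil_conj -!rowE -Pl /cM map_row.
have QPT : Q *m P^T = 1%:M by rewrite mulVmx ?unitmx_tr.
have QTP : Q^T *m P = 1%:M by rewrite /Q trmx_inv trmxK mulVmx.
have Ninv (w : D) : invmx (N w) = cM P *m invmx (phi (j (sval w))) *m (cM P)^T.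
  apply: invmx_uniq; rewrite /N !mulmxA -(mulmxA _ (cM Q)^T) -cMT -cMM QTP /cM map_mx1 mulmx1.
  have ju' : phi (j (sval w)) \in unitmx.
    by apply: siegel_unit; apply: sphi; apply: j_tube; exact: svalP.
  rewrite -(mulmxA (map_mx _ Q)) mulmxV// mulmx1 -/(cM Q) -/(cM P) -cMT -cMM QPT.
  by rewrite /cM map_mx1.
have hK' (w : D) : bil (phi (sval w)) (cM l) (cM l) = K * bil (invmx (phi (j (sval w)))) (cM l) (cM l).
  by have := hK w; rewrite Ninv !rowb.
have i0 : 'i != 0 :> C by rewrite -normc_eq0 normc_i oner_eq0.
have bs (a : C) : bil a%:M (cM l) (cM l) = a * (sqn l)%:C.
  by rewrite -scalemx1 bil_scale -(map_mx1 (real_complex R)) -/(cM _) bil_cM /bil mulmx1 -sqnE.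
have sl : (sqn l)%:C != 0 :> C.
  have pl : 0 < sqn l.
    rewrite lt_neqAle sqn_ge0 andbT eq_sym; apply: contraNneq l0 => /eqP.
    rewrite /sqn psumr_eq0 => [/allP h0|i _]; last exact: sqr_ge0.
    apply/eqP/rowP => i; have := h0 i; rewrite mem_index_enum sqrf_eq0 => /(_ isT)/eqP ->.
    by rewrite mxE.
  by rewrite -normc_eq0 normc_real normr_eq0 gt_eqF.
have KE : K = -1.
  have := hK' (exist _ _ tie); rewrite /= j_ie iE invmx_scalar !bs mulrA => /(mulIf sl) e1.
  have e3 : K / (Complex 0 1 : C) * (Complex 0 1 : C) = K by rewrite mulfVK.
  exact: (etrans (esym e3) (etrans (esym (congr1 (fun x : C => x * Complex 0 1) e1)) (sqr_i R))).
have := hK' (exist _ _ tz); rewrite /= KE mulN1r => ->.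
by rewrite -[- invmx _]scaleN1r bil_scale mulN1r.
Qed.

End Inverse.

(** * The Jordan algebra of a linear space of symmetric matrices *)

Section MatrixEntries.
Context {K : pzRingType}.

Lemma mxDE p q (X Y : 'M[K]_(p, q)) i j : (X + Y) i j = X i j + Y i j.
Proof. exact: mxE. Qed.
Lemma mxNE p q (X : 'M[K]_(p, q)) i j : (- X) i j = - X i j.
Proof. exact: mxE. Qed.
Lemma mxZE p q a (X : 'M[K]_(p, q)) i j : (a *: X) i j = a * X i j.
Proof. exact: mxE. Qed.

End MatrixEntries.

Ltac mxnc := repeat progress (rewrite ?(mulmxDl, mulmxDr, mulmxN, mulNmx, mulmxA) -?scalemxAl -?scalemxAr);
  apply/matrixP => ? ?; rewrite ?(mxDE, mxNE, mxZE).

Lemma half_double (K : numFieldType) m (X : 'M[K]_m) : 2^-1 *: (X + X) = X.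
Proof. by apply/matrixP => i j; rewrite mxZE mxDE; field. Qed.

Lemma jordan_complexify (K : numFieldType) m (ii : K) (X Y U V : 'M[K]_m) :
  ii * ii = -1 ->
  2^-1 *: (X *m U + U *m X) - 2^-1 *: (Y *m V + V *m Y) +
  ii *: (2^-1 *: (X *m V + V *m X) + 2^-1 *: (Y *m U + U *m Y)) =
  2^-1 *: ((X + ii *: Y) *m (U + ii *: V) + (U + ii *: V) *m (X + ii *: Y)).
Proof.
move=> i2; have i2' t : ii * (ii * t) = - t by rewrite mulrA i2 mulN1r.
by mxnc; rewrite ?(mulrDr ii) ?i2'; ring.
Qed.

Lemma symmetrized_inverse (K : numFieldType) m (Z W : 'M[K]_m) :
  Z *m W = 1%:M -> W *m Z = 1%:M ->
  2^-1 *: (2^-1 *: (Z *m Z + Z *m Z) *m W + W *m (2^-1 *: (Z *m Z + Z *m Z))) = Z.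
Proof. by move=> ZW WZ; rewrite half_double -mulmxA ZW mulmx1 mulmxA WZ mul1mx half_double. Qed.

Section SpectralReal.
Context {R : realType}.
Local Notation C := R[i].

Definition psd m (X : 'M[R]_m) : Prop := forall v : 'rV[R]_m, 0 <= bil X v v.

Lemma Re_herm m (X : 'M[R]_m) (u : 'rV[C]_m) : X^T = X ->
  bil (cM X) u (conjM u) = (bil X (ReMx u) (ReMx u) + bil X (ImMx u) (ImMx u))%:C.
Proof.
move=> XT; set a := ReMx u; set b := ImMx u.
rewrite {1}[u]cM_ReIm conjME -/a -/b bilDl -scaleN1r scalerA !bilDr !bilZl !bilZr !bil_cM.
rewrite (bil_sym b a XT).
apply/eqP; rewrite eq_complex !(cReD, cReM, cImD, cImM, cReN, cImN) /=.
by apply/andP; split; apply/eqP; ring.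
Qed.

(** The eigenvectors are complex, but each eigenvalue is expressed by values of the
real form of X, which lets its sign be read off from X. *)
Lemma sym_spectral m (X : 'M[R]_m) : X^T = X -> exists (P : 'M[C]_m) (d : 'rV[R]_m),
  [/\ P \in unitmx, cM X = invmx P *m diag_mx (cM d) *m P &
   forall i, exists a b : 'rV[R]_m, (a != 0) || (b != 0) /\ d 0 i = bil X a a + bil X b b].
Proof.
move=> XT; pose P := spectralmx (cM X); pose D := spectral_diag (cM X).
have herm : cM X \is hermsymmx.
  apply: realsym_hermsym; last by apply/mxOverP => i j; rewrite mxE complex_real.
  by apply/is_hermitianmxP; rewrite expr0 scale1r -cMT XT; apply/matrixP => i j; rewrite !mxE.
have Pu : P \in unitmx := spectral_unit _.
have XE : cM X = invmx P *m diag_mx D *m P by apply/orthomx_spectralP/hermitian_normalmx.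
have PU : P *m (conjM P)^T = 1%:M.
  have := unitarymxP (spectral_unitarymx (cM X)); rewrite -/P => <-; congr (_ *m _).
  by apply/matrixP => i j; rewrite !mxE.
have Dr i : D 0 i = (complex.Re (D 0 i))%:C.
  by have /mxOverP/(_ 0 i)/RRe_real -> := hermitian_spectral_diag_real herm.
exists P, (ReMx D); split; [exact: Pu| |].
  suff -> : cM (ReMx D) = D by [].
  by apply/rowP => i; rewrite !mxE -Dr.
move=> i; pose u := row i P; exists (ReMx u), (ImMx u).
have uu : u *m (conjM u)^T = 1%:M.
  have /matrixP/(_ i i) := PU; rewrite !mxE eqxx => h.
  by apply/rowP => k; rewrite !ord1 !mxE eqxx -h; apply: eq_bigr => l _; rewrite !mxE.
have uX : u *m cM X = D 0 i *: u.
  rewrite XE !mulmxA /u -row_mul mulmxV// row1 -rowE.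
  by rewrite row_diag_mx -scalemxAl -rowE.
split.
  rewrite -negb_and; apply/negP => /andP[/eqP a0 /eqP b0].
  have u0 : u = 0 by rewrite [u]cM_ReIm a0 b0 /cM !map_mx0 scaler0 addr0.
  by move: uu; rewrite u0 mul0mx => /matrixP/(_ 0 0)/eqP; rewrite !mxE eqxx eq_sym oner_eq0.
have := Re_herm u XT; rewrite {1}/bil uX -scalemxAl uu mxE [_ 0 0]mxE eqxx mulr1 Dr.
by move=> /(@complexI R) <-; rewrite mxE.
Qed.

Lemma interpolate (s : seq R) (f : R -> R) : exists p : {poly R}, forall x, x \in s -> p.[x] = f x.
Proof.
elim: s => [|a s [p hp]]; first by exists 0.
have [as_|as_] := boolP (a \in s).
  by exists p => x; rewrite inE => /orP[/eqP->|]; exact: hp.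
pose q : {poly R} := \prod_(x <- s) ('X - x%:P).
have qa : q.[a] != 0.
  by rewrite -rootE root_prod_XsubC.
exists (p + ((f a - p.[a]) / q.[a]) *: q) => x.
rewrite inE !hornerE => /orP[/eqP->|xs]; first by rewrite divfK//; ring.
have /eqP -> : q.[x] == 0 by rewrite -rootE root_prod_XsubC.
by rewrite mulr0 addr0 hp.
Qed.

(** f (X) for the matrix X with eigenvalues d and left eigenvectors the rows of P. *)
Definition spectral_fun m (P : 'M[C]_m) (d : 'rV[R]_m) (f : R -> R) : 'M[C]_m :=
  invmx P *m diag_mx (\row_i (f (d 0 i))%:C) *m P.

Lemma eq_diag_conj m (P : 'M[C]_m) (r r' : 'rV[C]_m) : (forall i, r 0 i = r' 0 i) ->
  invmx P *m diag_mx r *m P = invmx P *m diag_mx r' *m P.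
Proof. by move=> h; have /= -> : r = r' by apply/rowP. Qed.

Lemma spectral_funM m (P : 'M[C]_m) d f g : P \in unitmx ->
  spectral_fun P d f *m spectral_fun P d g = spectral_fun P d (fun x => f x * g x).
Proof.
move=> Pu; rewrite /spectral_fun !mulmxA (mulmxK Pu) -(mulmxA _ (diag_mx _) (diag_mx _)) mulmx_diag.
by apply: eq_diag_conj => i; rewrite !mxE rmorphM.
Qed.

Lemma cM_spectral_funM m (P : 'M[C]_m) d f g (X Y : 'M[R]_m) : P \in unitmx ->
  cM X = spectral_fun P d f -> cM Y = spectral_fun P d g -> cM (X *m Y) = spectral_fun P d (fun x => f x * g x).
Proof. by move=> Pu hX hY; rewrite cMM hX hY; exact: spectral_funM. Qed.

Lemma eq_spectral_fun m (P : 'M[C]_m) (d : 'rV[R]_m) (f g : R -> R) : (forall i, f (d 0 i) = g (d 0 i)) -> spectral_fun P d f = spectral_fun P d g.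
Proof.
by move=> h; apply: eq_diag_conj => i; rewrite !mxE h.
Qed.

Lemma posdef_add m (X Y : 'M[R]_m) : posdef X -> posdef Y -> posdef (X + Y).
Proof.
move=> [XT pX] [YT pY]; split=> [|v v0]; first by rewrite linearD /= XT YT.
by rewrite /bil mulmxDr mulmxDl mxE addr_gt0//; [apply: pX | apply: pY].
Qed.

Lemma bilDm m (X Y : 'M[R]_m) u v : bil (X + Y) u v = bil X u v + bil Y u v.
Proof. by rewrite /bil mulmxDr mulmxDl mxE. Qed.
Lemma bilZm m a (X : 'M[R]_m) u v : bil (a *: X) u v = a * bil X u v.
Proof. by rewrite /bil -scalemxAr -scalemxAl mxE. Qed.
Lemma bil1 m (v : 'rV[R]_m) : bil 1%:M v v = sqn v.
Proof. by rewrite /bil mulmx1 sqnE. Qed.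

Lemma sqn_gt0 m (v : 'rV[R]_m) : v != 0 -> 0 < sqn v.
Proof.
move=> v0; rewrite lt_neqAle sqn_ge0 andbT eq_sym; apply: contraNneq v0 => /eqP.
rewrite /sqn psumr_eq0 => [/allP h0|i _]; last exact: sqr_ge0.
apply/eqP/rowP => i; have := h0 i; rewrite mem_index_enum sqrf_eq0 => /(_ isT)/eqP ->.
by rewrite mxE.
Qed.

Lemma bil_bounded m (X : 'M[R]_m) : exists2 c : R, 0 < c & forall v, `|bil X v v| <= c * sqn v.
Proof.
have [K K0 hK] := sqn_mul_le X; exists (K + 1); first exact: addr_gt0.
move=> v; have -> : bil X v v = \sum_j (v *m X) 0 j * v 0 j.
  by rewrite /bil mxE; apply: eq_bigr => j _; rewrite [v^T _ _]mxE.
apply: (@le_trans _ _ (\sum_j ((v *m X) 0 j ^+ 2 + v 0 j ^+ 2))).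
  apply: le_trans (ler_norm_sum _ _ _) _; apply: ler_sum => j _.
  set a := (v *m X) 0 j; set b := v 0 j.
  have h1 := sqr_ge0 (a + b); have h2 := sqr_ge0 (a - b).
  have h3 := sqr_ge0 a; have h4 := sqr_ge0 b.
  by rewrite ler_norml; apply/andP; split; nra.
by rewrite big_split /= mulrDl mul1r; apply: lerD; [exact: hK | exact: lexx].
Qed.

Lemma mxtrace_sqn m (X : 'M[R]_m) : \tr (X *m X^T) = \sum_i \sum_j X i j ^+ 2.
Proof.
by apply: eq_bigr => i _; rewrite mxE; apply: eq_bigr => j _; rewrite mxE expr2.
Qed.

Lemma mxtrace_sqn_ge0 m (X : 'M[R]_m) : 0 <= \tr (X *m X^T).
Proof. by rewrite mxtrace_sqn; apply: sumr_ge0 => i _; apply: sumr_ge0 => j _; exact: sqr_ge0. Qed.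

Lemma mxtrace_sqn_eq0 m (X : 'M[R]_m) : \tr (X *m X^T) = 0 -> X = 0.
Proof.
rewrite mxtrace_sqn => /eqP; rewrite psumr_eq0 => [/allP h|i _]; last first.
  by apply: sumr_ge0 => j _; exact: sqr_ge0.
apply/matrixP => i j; have := h i; rewrite mem_index_enum => /(_ isT) /=.
rewrite psumr_eq0 => [/allP h'|k _]; last exact: sqr_ge0.
by have := h' j; rewrite mem_index_enum sqrf_eq0 => /(_ isT)/eqP ->; rewrite mxE.
Qed.

Lemma lin1_mxE n (f : 'rV[R]_n -> 'rV[R]_n) :
  (forall a x y, f (a *: x + y) = a *: f x + f y) -> forall v, v *m lin1_mx f = f v.
Proof.
move=> fl v; have f0 : f 0 = 0 by have := fl (-1) 0 0; rewrite scaler0 addr0 scaleN1r addNr.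
have fD x y : f (x + y) = f x + f y by have := fl 1 x y; rewrite !scale1r.
have fZ a x : f (a *: x) = a *: f x by have := fl a x 0; rewrite f0 !addr0.
rewrite [in RHS](row_sum_delta v) (big_morph f fD f0).
apply/rowP => j; rewrite mxE summxE; apply: eq_bigr => i _.
by rewrite fZ !mxE.
Qed.

End SpectralReal.

Section Jordan.
Context {R : realType}.
Local Notation C := R[i].
Context {m n : nat} (A : {linear 'rV[R]_n -> 'M[R]_m}) (A_inj : injective A)
  (A_sym : forall x, (A x)^T = A x) (e : 'rV[R]_n) (Ae : A e = 1%:M).
Context (A_inv : forall x, posdef (A x) -> exists2 y, posdef (A y) & A x *m A y = 1%:M).

(** Hua's identity: X^2 = X - (X^-1 + (1 - X)^-1)^-1 for 0 < X < 1. *)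
Lemma square_small x : posdef (A x) -> posdef (1%:M - A x) -> exists s, A s = A x *m A x.
Proof.
move=> px p1x; have [y1 py1 xy1] := A_inv px.
have p1x' : posdef (A (e - x)) by rewrite linearB Ae.
have [y2 py2 xy2] := A_inv p1x'.
have p12 : posdef (A (y1 + y2)) by rewrite linearD; exact: posdef_add.
have [y3 _ h3] := A_inv p12.
exists (x - y3); rewrite linearB /=; set X := A x in xy1 *.
have yx1 := mulmx1C xy1; have yx2 := mulmx1C xy2.
have e1 : (X - X *m X) *m A (y1 + y2) = 1%:M.
  have eB : X - X *m X = X *m A (e - x) by rewrite linearB Ae mulmxBr mulmx1.
  have eC : X *m A (e - x) = A (e - x) *m X by rewrite linearB Ae mulmxBr mulmxBl mulmx1 mul1mx.
  rewrite linearD mulmxDr {1}eB eC -(mulmxA _ X) xy1 mulmx1 eB -mulmxA xy2 mulmx1.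
  by rewrite linearB Ae subrK.
have -> : A y3 = X - X *m X by rewrite -[A y3]mul1mx -e1 -mulmxA h3 mulmx1.
by rewrite subKr.
Qed.

(** An affine function of X with values strictly between 0 and 1, and square
polynomial in X, reduces to [square_small]. *)
Lemma square_ex x : exists s, A s = A x *m A x.
Proof.
(* The form of X is bounded by c, so that of r (X + c + 1) lies strictly between 0
   and 1. *)
have [c c0 hc] := bil_bounded (A x); pose X := A x; pose r := (2 * (c + 1))^-1.
have c1 : 0 < c + 1 by rewrite addr_gt0.
have r0 : 0 < r by rewrite invr_gt0 mulr_gt0.
pose x' := r *: (x + (c + 1) *: e).
have Ax' : A x' = r *: (X + (c + 1)%:M) by rewrite linearZ linearD linearZ /= Ae scalemx1.
have rc : r * (2 * (c + 1)) = 1 by rewrite mulVf// gt_eqF// mulr_gt0.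
have p1 : posdef (A x').
  split=> // v v0; rewrite Ax' bilZm mulr_gt0// bilDm -scalemx1 bilZm bil1.
  by have := hc v; have := sqn_gt0 v0; rewrite ler_norml => h /andP[h1 _]; lra.
have p2 : posdef (1%:M - A x').
  have -> : 1%:M - A x' = r *: ((c + 1)%:M - X).
    rewrite Ax' (_ : 1%:M = (r * (2 * (c + 1)))%:M); last by rewrite rc.
    by apply/matrixP => i j; rewrite !mxE; case: (i == j); rewrite ?mulr1n ?mulr0n; ring.
  split=> [|v v0].
    by rewrite linearZ linearB /= tr_scalar_mx A_sym.
  rewrite bilZm mulr_gt0// bilDm -scalemx1 bilZm bil1 -scaleN1r bilZm.
  by have := hc v; have := sqn_gt0 v0; rewrite ler_norml => h /andP[_ h1]; lra.
have [s hs] := square_small p1 p2.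
exists (r ^- 2 *: s - (2 * (c + 1)) *: x - (c + 1) ^+ 2 *: e).
rewrite !linearB !linearZ /= hs Ax' Ae -/X.
rewrite -scalemxAl -scalemxAr !scalerA mulmxDl !mulmxDr -!scalar_mxM.
rewrite mul_scalar_mx mul_mx_scalar.
have -> : r ^- 2 * r * r = 1 by rewrite -mulrA -expr2 mulVf// expf_neq0// gt_eqF.
rewrite scale1r; apply/matrixP => i j; rewrite !mxE; ring.
Qed.

Lemma mul_ex x y : exists s, A s = 2^-1 *: (A x *m A y + A y *m A x).
Proof.
have [s hs] := square_ex (x + y); have [s1 hs1] := square_ex x; have [s2 hs2] := square_ex y.
exists (2^-1 *: (s - s1 - s2)); rewrite linearZ !linearB /= hs hs1 hs2 linearD.
rewrite mulmxDl !mulmxDr; congr (_ *: _); apply/matrixP => i j; rewrite !mxE; ring.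
Qed.

(** The symmetrized product of matrices, pulled back to V; [xget] picks the only
preimage. *)
Definition jmul (x y : 'rV[R]_n) : 'rV[R]_n :=
  xget 0 [set s | A s = 2^-1 *: (A x *m A y + A y *m A x)].

Lemma A_jmul x y : A (jmul x y) = 2^-1 *: (A x *m A y + A y *m A x).
Proof.
by rewrite /jmul; case: xgetP => [s _ //|h]; have [s hs] := mul_ex x y; have := h s.
Qed.

Lemma A_jsq x : A (jmul x x) = A x *m A x.
Proof. by rewrite A_jmul half_double. Qed.

Lemma jmul_linear a x y z : jmul (a *: x + y) z = a *: jmul x z + jmul y z.
Proof.
apply: A_inj; rewrite linearP !A_jmul linearP; mxnc; ring.
Qed.

Lemma jmulC x y : jmul x y = jmul y x.
Proof. by apply: A_inj; rewrite !A_jmul addrC. Qed.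

Lemma jmul1 x : jmul e x = x.
Proof.
by apply: A_inj; rewrite A_jmul Ae mulmx1 mul1mx half_double.
Qed.

Lemma jmul_jordan x y : jmul x (jmul (jmul x x) y) = jmul (jmul x x) (jmul x y).
Proof.
apply: A_inj; rewrite (A_jmul x (jmul _ y)) (A_jmul (jmul x x) (jmul x y)) (A_jmul (jmul x x) y) (A_jmul x y) A_jsq.
by mxnc; ring.
Qed.

Lemma jordan_jmul : jordan_algebra jmul e.
Proof. by split; [exact: jmul_linear | exact: jmulC | exact: jmul_jordan | exact: jmul1]. Qed.

Lemma formally_real_jmul : formally_real jmul.
Proof.
move=> s s0 x xs; have : \tr (A (\sum_(y <- s) jmul y y)) = 0 by rewrite s0 linear0 mxtrace0.
rewrite linear_sum /= raddf_sum /= => /eqP; rewrite psumr_eq0 => [/allP/(_ x xs)|y _]; last first.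
  by rewrite A_jsq -{2}A_sym mxtrace_sqn_ge0.
rewrite /= A_jsq -{2}A_sym => /eqP/mxtrace_sqn_eq0 Ax0.
by apply: A_inj; rewrite Ax0 linear0.
Qed.

Definition mul_mx (x : 'rV[R]_n) : 'M[R]_n := lin1_mx (jmul x).
Definition tr_mul (x : 'rV[R]_n) : R := \tr (mul_mx x).

Lemma jmul_linear_r x a y z : jmul x (a *: y + z) = a *: jmul x y + jmul x z.
Proof. by rewrite jmulC jmul_linear (jmulC y) (jmulC z). Qed.

Lemma mul_mxE x v : v *m mul_mx x = jmul x v.
Proof. by apply: lin1_mxE => a y z; exact: jmul_linear_r. Qed.

Lemma trace_formE x y : trace_form jmul x y = tr_mul (jmul x y).
Proof. by []. Qed.

Lemma tr_mul_linear a x y : tr_mul (a *: x + y) = a * tr_mul x + tr_mul y.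
Proof.
have -> : tr_mul (a *: x + y) = \tr (a *: mul_mx x + mul_mx y).
  by congr (\tr _); apply/matrixP => i j; rewrite !mxE jmul_linear !mxE.
by rewrite mxtraceD mxtraceZ.
Qed.

Lemma tr_mul0 : tr_mul 0 = 0.
Proof. by have := tr_mul_linear (-1) 0 0; rewrite scaler0 addr0; lra. Qed.

(** (ab)c - a(bc) is the value at b of D x = (xK - Kx)/4, K = ac - ca, a derivation of
the Jordan algebra.  Multiplication by D b is the commutator of the
multiplication by b with D, so its trace is 0. *)
Lemma tr_mul_assoc a b c : tr_mul (jmul (jmul a b) c) = tr_mul (jmul a (jmul b c)).
Proof.
have [dd ddE] : {dd | forall x, dd x = jmul (jmul a x) c - jmul a (jmul x c)} by exists (fun x => jmul (jmul a x) c - jmul a (jmul x c)).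
pose K := A a *m A c - A c *m A a.
have Add x : A (dd x) = 4^-1 *: (A x *m K - K *m A x).
  by rewrite ddE linearB /= !A_jmul /K; mxnc; field.
have ddl al x y : dd (al *: x + y) = al *: dd x + dd y.
  by apply: A_inj; rewrite linearP !Add linearP; mxnc; ring.
have der x : jmul (dd b) x = dd (jmul b x) - jmul b (dd x).
  apply: A_inj; rewrite linearB /= (A_jmul (dd b)) (A_jmul b (dd x)) !Add A_jmul.
  by mxnc; field.
have e1 : mul_mx (dd b) = mul_mx b *m lin1_mx dd - lin1_mx dd *m mul_mx b.
  apply/row_matrixP => i; rewrite !rowE mul_mxE der mulmxBr !mulmxA mul_mxE !(lin1_mxE ddl) mul_mxE.
  by [].
have : tr_mul (dd b) = 0 by rewrite /tr_mul e1 linearB /= mxtrace_mulC subrr.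
have -> : dd b = (-1) *: jmul a (jmul b c) + jmul (jmul a b) c by rewrite ddE scaleN1r addrC.
by rewrite tr_mul_linear mulN1r addrC => /subr0_eq.
Qed.

(** In the Euclidean structure tr (A u * A v) the operator of multiplication by a^2 has
quadratic form |A a * A u|^2; its trace is the sum of these values over an
orthonormal basis, and they do not all vanish, as A e = 1. *)
Lemma tr_mul_sq_gt0 a : a != 0 -> 0 < tr_mul (jmul a a).
Proof.
move=> a0; pose G : 'M[R]_n := \matrix_(i, j) \tr (A (delta_mx 0 i) *m A (delta_mx 0 j)).
have AS u : A u = \sum_i u 0 i *: A (delta_mx 0 i).
  by rewrite {1}[u]row_sum_delta linear_sum /=; apply: eq_bigr => i _; rewrite linearZ.
have bG u v : bil G u v = \tr (A u *m A v).
  rewrite /bil mxE; under eq_bigr do rewrite mxE mulr_suml.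
  rewrite exchange_big /= (AS u) mulmx_suml raddf_sum /=; apply: eq_bigr => i _.
  rewrite (AS v) mulmx_sumr raddf_sum /=; apply: eq_bigr => k _.
  by rewrite -scalemxAl -scalemxAr !mxtraceZ !mxE; ring.
have pG : posdef G.
  split=> [|v v0]; first by apply/matrixP => i j; rewrite !mxE mxtrace_mulC.
  rewrite bG -{2}A_sym lt_neqAle mxtrace_sqn_ge0 andbT eq_sym.
  by apply: contraNneq v0 => /mxtrace_sqn_eq0 h; apply/eqP/A_inj; rewrite h linear0.
have [P Pu GE] := cholesky pG.
set w := jmul a a; have ww u : bil (mul_mx w *m G) u u = \tr ((A a *m A u) *m (A a *m A u)^T).
  have -> : bil (mul_mx w *m G) u u = bil G (jmul w u) u by rewrite /bil !mulmxA mul_mxE.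
  rewrite bG A_jmul A_jsq -scalemxAl mxtraceZ mulmxDl mxtraceD trmx_mul !A_sym.
  rewrite -[\tr (A u *m _ *m A u)]mxtrace_mulC !mulmxA.
  have e1 : \tr (A a *m A u *m A u *m A a) = \tr (A a *m A a *m A u *m A u).
    by rewrite mxtrace_mulC !mulmxA.
  have e2 : \tr (A u *m A u *m A a *m A a) = \tr (A a *m A a *m A u *m A u).
    by rewrite -mulmxA mxtrace_mulC !mulmxA.
  by rewrite e1 e2; field.
have tE : tr_mul w = \sum_i bil (mul_mx w *m G) (row i (invmx P)) (row i (invmx P)).
  have -> : tr_mul w = \tr (invmx P *m (mul_mx w *m G) *m (invmx P)^T).
    rewrite GE !mulmxA -(mulmxA _ P^T) -trmx_mul mulVmx// trmx1 mulmx1.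
    by rewrite mxtrace_mulC !mulmxA mulmxV// mul1mx.
  apply: eq_bigr => i _; rewrite -bil_delta bil_conj -!rowE; by [].
rewrite tE lt_neqAle sumr_ge0 ?andbT => [|i _]; last by rewrite ww mxtrace_sqn_ge0.
rewrite eq_sym psumr_eq0 => [|i _]; last by rewrite ww mxtrace_sqn_ge0.
apply: contraNN a0 => /allP h.
have z i : A a *m A (row i (invmx P)) = 0.
  by have := h i; rewrite mem_index_enum /= ww => /(_ isT)/eqP/mxtrace_sqn_eq0.
have z' u : A a *m A u = 0.
  rewrite -[u](mulmxK Pu); set v := u *m P.
  have -> : v *m invmx P = \sum_i v 0 i *: row i (invmx P) by rewrite mulmx_sum_row.
  rewrite linear_sum mulmx_sumr big1// => i _.
  by rewrite linearZ /= -scalemxAr z scaler0.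
by apply/eqP/A_inj; have := z' e; rewrite Ae mulmx1 linear0.
Qed.

Lemma trace_form_psb : posdef_symmetric_bilinear (trace_form jmul).
Proof.
split=> [a x y z|x y|x x0]; rewrite ?trace_formE.
- by rewrite jmul_linear tr_mul_linear.
- by rewrite jmulC.
- exact: tr_mul_sq_gt0.
Qed.

Lemma power_ex x k : exists y, A y = iter k (mulmx (A x)) 1%:M.
Proof.
elim: k => [|k [y hy]]; first by exists e.
exists (jmul x y); rewrite A_jmul hy iterS.
have -> : iter k (mulmx (A x)) 1%:M *m A x = A x *m iter k (mulmx (A x)) 1%:M.
  elim: k {y hy} => [|k IH]; first by rewrite mul1mx mulmx1.
  by rewrite !iterS -mulmxA IH.
by rewrite half_double.
Qed.

(** Powers of x stay in the algebra, so polynomials do, and on finitely many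
eigenvalues every function is a polynomial. *)
Lemma func_calc x : exists (P : 'M[C]_m) (d : 'rV[R]_m),
  [/\ P \in unitmx, cM (A x) = spectral_fun P d id,
   forall i, exists a b : 'rV[R]_m, (a != 0) || (b != 0) /\ d 0 i = bil (A x) a a + bil (A x) b b &
   forall f, exists y, cM (A y) = spectral_fun P d f].
Proof.
have [P [d [Pu XE hd]]] := sym_spectral (A_sym x).
have XE' : cM (A x) = spectral_fun P d id.
  by rewrite XE; apply: eq_diag_conj => i; rewrite !mxE.
exists P, d; split=> // f.
have [p hp] := interpolate [seq d 0 i | i <- enum 'I_m] f.
have /choice[pw hpw] := power_ex x.
have pwE k : cM (A (pw k)) = spectral_fun P d (fun t => t ^+ k).
  rewrite hpw; elim: k => [|k IH].
    rewrite /cM map_mx1 /spectral_fun; have -> : \row_i (d 0 i ^+ 0)%:C = const_mx 1 :> 'rV[C]_m.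
      by apply/rowP => i; rewrite !mxE expr0.
    by rewrite diag_const_mx mulmx1 mulVmx.
  by rewrite iterS cMM IH XE' (spectral_funM _ _ _ Pu); apply: eq_spectral_fun => i; rewrite exprS.
exists (\sum_(k < size p) p`_k *: pw k).
rewrite linear_sum /=.
have -> : cM (\sum_(k < size p) A (p`_k *: pw k)) = \sum_(k < size p) (p`_k)%:C *: spectral_fun P d (fun t => t ^+ k).
  rewrite /cM map_mx_sum; apply: eq_bigr => k _.
  by rewrite -pwE linearZ /= /cM map_mxZ.
rewrite /spectral_fun; under eq_bigr do rewrite scalemxAl scalemxAr.
rewrite -mulmx_suml -mulmx_sumr; congr (_ *m _ *m _).
apply/matrixP => i j; rewrite summxE mxE [in RHS]mxE -hp; last by apply: map_f; rewrite mem_enum.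
rewrite horner_coef; under eq_bigr do rewrite !mxE.
case: eqP => [->|_]; last by rewrite mulr0n big1// => k _; rewrite mulr0n mulr0.
by rewrite mulr1n rmorph_sum; apply: eq_bigr => k _; rewrite mulr1n rmorphM.
Qed.

Lemma psd_sqrt x : psd (A x) -> exists q, jmul q q = x.
Proof.
move=> px; have [P [d [Pu XE hd hf]]] := func_calc x.
have [q hq] := hf Num.sqrt; exists q; apply: A_inj; apply: (@cM_inj R).
rewrite A_jsq cMM hq (spectral_funM _ _ _ Pu) XE; apply: eq_spectral_fun => i.
have [a [b [_ ->]]] := hd i; rewrite -expr2 sqr_sqrtr//.
by rewrite addr_ge0// px.
Qed.

Lemma tr_mul_psd_ge0 w : psd (A w) -> 0 <= tr_mul w.
Proof.
move=> /psd_sqrt[q <-]; have [->|q0] := eqVneq q 0; last exact/ltW/tr_mul_sq_gt0.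
by have -> : jmul 0 0 = 0; [apply: A_inj; rewrite A_jsq linear0 mulmx0 | rewrite tr_mul0].
Qed.

Lemma tr_mul_psd_gt0 w : psd (A w) -> w != 0 -> 0 < tr_mul w.
Proof.
move=> /psd_sqrt[q <-] w0; apply: tr_mul_sq_gt0; apply: contraNneq w0 => ->.
by apply/eqP/A_inj; rewrite A_jsq linear0 mulmx0.
Qed.

Lemma pd_sqrt x : posdef (A x) -> exists p p', jmul p p = x /\ A p *m A p' = 1%:M.
Proof.
move=> px; have [P [d [Pu XE hd hf]]] := func_calc x.
have d0 i : 0 < d 0 i.
  have [a [b [ab ->]]] := hd i; case/orP: ab => h.
    by rewrite ltr_wpDr ?posdef_ge0//; apply: px.2.
  by rewrite ltr_wpDl ?posdef_ge0//; apply: px.2.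
have [p hp] := hf Num.sqrt; have [p' hp'] := hf (fun t => (Num.sqrt t)^-1).
exists p, p'; split; [apply: A_inj|]; apply: (@cM_inj R).
  by rewrite A_jsq cMM hp (spectral_funM _ _ _ Pu) XE; apply: eq_spectral_fun => i; rewrite -expr2 sqr_sqrtr// ltW.
rewrite cMM hp hp' (spectral_funM _ _ _ Pu) (@eq_spectral_fun _ _ _ _ _ (fun=> 1)) => [|i]; last first.
  by rewrite divff// gt_eqF// sqrtr_gt0.
rewrite /spectral_fun; have -> : \row_i 1%:C = const_mx 1 :> 'rV[C]_m by apply/rowP => i; rewrite !mxE.
by rewrite diag_const_mx mulmx1 mulVmx// /cM map_mx1.
Qed.

Lemma A_eq0 x : (A x == 0) = (x == 0).
Proof.
by apply/eqP/eqP => [h|->]; [apply: A_inj; rewrite h linear0 | rewrite linear0].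
Qed.

Lemma jinverse_mx x y : A x *m A y = 1%:M -> jordan_inverse jmul e x y.
Proof.
move=> xy; have yx := mulmx1C xy; split; apply: A_inj.
  by rewrite A_jmul xy yx Ae half_double.
rewrite A_jmul A_jsq -mulmxA xy mulmx1 mulmxA yx mul1mx.
by rewrite half_double.
Qed.

Lemma cone_squares : [set x | posdef (A x)] = [set jmul x x | x in [set x | jordan_invertible jmul e x]].
Proof.
apply/seteqP; split=> x /=.
  by move=> /pd_sqrt[p [p' [pp pp']]]; exists p => //; exists p'; exact: jinverse_mx.
move=> [q [y [qy _]] <-]; split=> [|v v0]; first by rewrite A_sym.
rewrite A_jsq; have -> : bil (A q *m A q) v v = sqn (v *m A q).
  by rewrite sqnE /bil trmx_mul A_sym !mulmxA.
apply: sqn_gt0; apply: contraTneq isT => vq.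
have : bil (A (jmul q y)) v v = 0.
  rewrite A_jmul bilZm bilDm /bil !mulmxA vq mul0mx mul0mx mxE add0r.
  have -> : v *m A y *m A q *m v^T = v *m A y *m (v *m A q)^T by rewrite trmx_mul A_sym !mulmxA.
  by rewrite vq trmx0 mulmx0 mxE mulr0.
by rewrite qy Ae bil1 => h; have := sqn_gt0 v0; rewrite h ltxx.
Qed.

Lemma cvg_rowP (K : topologicalType) (T : Type) (F : set_system T) {FF : Filter F} k
   (u : T -> 'rV[K]_k) (l : 'rV[K]_k) :
  (forall i, (u t 0 i) @[t --> F] --> l 0 i) -> u @ F --> l.
Proof.
move=> h B [P Pl PB]; have : \forall t \near F, forall i, P 0 i (u t 0 i).
  by apply: filter_forall => i; apply: h; exact: Pl.
by apply: filterS => t ht; apply: PB => i j; rewrite ord1.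
Qed.

(** The values of the form at a fixed vector depend continuously on x. *)
Lemma closure_psd y : closure [set x | posdef (A x)] y -> psd (A y).
Proof.
move=> cy v; rewrite leNgt; apply/negP => hv.
pose f (x : 'rV[R]_n) := bil (A x) v v.
have fE x : f x = \sum_i x 0 i * bil (A (delta_mx 0 i)) v v.
  rewrite /f {1}[x]row_sum_delta linear_sum /bil mulmx_sumr mulmx_suml summxE; apply: eq_bigr => i _.
  by rewrite linearZ /= -scalemxAr -scalemxAl mxE.
have fc : continuous f.
  move=> x; have -> : f = fun x => \sum_i x 0 i * bil (A (delta_mx 0 i)) v v by apply/funext.
  apply: (@cvg_big R _ +%R 0 xpredT add_continuous _ (nbhs x) _ _ (fun i => x 0 i * bil (A (delta_mx 0 i)) v v) (nbhs_filter x)) => i _.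
  by apply: cvgMr_tmp; exact: coord_continuous.
have : nbhs y (f @^-1` [set t | t < 0]).
  by apply: fc; exact: lt_nbhsl hv.
move=> /cy[x [[_ px] /= fx]].
have [v0|v0] := eqVneq v 0; first by move: hv; rewrite v0 /bil mul0mx mul0mx mxE ltxx.
by have := px v v0; rewrite ltNge ltW.
Qed.

(** A positive semidefinite matrix is the limit of its sums with small multiples
of 1. *)
Lemma psd_closure y : psd (A y) -> closure [set x | posdef (A x)] y.
Proof.
move=> py B By; have h : (fun k => y + mesh k *: e) @ \oo --> y.
  apply: cvg_rowP => i; under eq_fun do rewrite !mxE.
  have h := cvgD (cvg_cst (y 0 i)) (cvgMr_tmp (b := e 0 i) (@cvg_mesh R)).
  by rewrite mul0r addr0 in h; exact: h.
have [N _ hN] := h _ By; exists (y + mesh N *: e); split; last exact: (hN N (leqnn N)).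
split=> [|v v0]; first exact: A_sym.
rewrite linearD linearZ /= Ae bilDm bilZm bil1 ltr_wpDl ?py// mulr_gt0 ?mesh_gt0//.
exact: sqn_gt0.
Qed.

(** The quadratic representation of a special Jordan algebra. *)
Lemma A_quad p y : A (2 *: jmul p (jmul p y) - jmul (jmul p p) y) = A p *m A y *m A p.
Proof. by rewrite linearB linearZ /= !A_jmul; mxnc; field. Qed.

(** For x = p^2 with p invertible, and y semidefinite and nonzero,
tr L (xy) = tr L (pyp), and pyp is again semidefinite and nonzero.  Conversely,
pairing x with the spectral projection E of its eigenvalues <= 0 gives a number
<= 0, so E = 0. *)
Lemma cone_selfdual : [set x | posdef (A x)] = dual_cone (trace_form jmul) [set x | posdef (A x)].
Proof.
apply/seteqP; split=> x /=.
  move=> /pd_sqrt[p [p' [<- pp']]] y /closure_psd py y0; rewrite trace_formE.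
  pose w := 2 *: jmul p (jmul p y) - jmul (jmul p p) y.
  have wE : A w = A p *m A y *m A p := A_quad p y.
  have -> : tr_mul (jmul (jmul p p) y) = tr_mul w.
    rewrite /w addrC -scaleN1r tr_mul_linear -[2 *: _]addr0 tr_mul_linear tr_mul0 tr_mul_assoc; ring.
  apply: tr_mul_psd_gt0.
    by move=> v; rewrite wE -{2}A_sym bil_conj; exact: py.
  rewrite -A_eq0 wE; apply: contraNneq y0 => h; rewrite -A_eq0.
  have p'p := mulmx1C pp'.
  have : A p' *m (A p *m A y *m A p) *m A p' = A y.
    by rewrite !mulmxA p'p mul1mx -mulmxA pp' mulmx1.
  by rewrite h mulmx0 mul0mx => <-.
move=> hx; have [P [d [Pu XE hd hf]]] := func_calc x.
have [E hE] := hf (fun t => if t <= 0 then 1 else 0).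
have EE : A E *m A E = A E.
  by apply: (@cM_inj R); rewrite cMM hE (spectral_funM _ _ _ Pu); apply: eq_spectral_fun => i; case: ifP; rewrite ?mulr1 ?mulr0.
have pE : psd (A E).
  by move=> v; rewrite -EE -{2}A_sym /bil -mulmxA -mulmxA -trmx_mul mulmxA -sqnE sqn_ge0.
have [q hq] := hf (fun t => if t <= 0 then Num.sqrt (- t) else 0).
have xE : jmul x E = - jmul q q.
  have comm : A x *m A E = A E *m A x.
    apply: (@cM_inj R); rewrite (cM_spectral_funM Pu XE hE) (cM_spectral_funM Pu hE XE).
    by apply: eq_spectral_fun => i; rewrite mulrC.
  apply: A_inj; rewrite linearN A_jsq A_jmul -comm half_double; apply: (@cM_inj R).
  have -> : cM (- (A q *m A q)) = - cM (A q *m A q) by rewrite /cM map_mxN.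
  rewrite (cM_spectral_funM Pu XE hE) (cM_spectral_funM Pu hq hq).
  rewrite /spectral_fun -mulNmx -mulmxN -linearN; apply: eq_diag_conj => i.
  rewrite !mxE -rmorphN; congr (_%:C).
  case: ifP => h; last by rewrite mulr0 mul0r oppr0.
  by rewrite mulr1 -expr2 sqr_sqrtr ?opprK// oppr_ge0.
have E0 : E = 0.
  apply/eqP; apply: contraTT isT => E0; have := hx E (psd_closure pE) E0.
  rewrite trace_formE xE -scaleN1r -[_ *: _]addr0 tr_mul_linear tr_mul0 addr0 mulN1r oppr_gt0.
  rewrite ltNge tr_mul_psd_ge0// => v; rewrite A_jsq -{2}A_sym /bil -mulmxA -mulmxA -trmx_mul mulmxA -sqnE.
  exact: sqn_ge0.
have d0 i : 0 < d 0 i.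
  rewrite ltNge; apply/negP => di; have : diag_mx (\row_i ((fun t : R => if t <= 0 then 1 else 0) (d 0 i))%:C) = 0 :> 'M[C]_m.
    have := hE; rewrite E0 linear0 /cM map_mx0 /spectral_fun => /(congr1 (mulmx P)).
    by rewrite mulmx0 -mulmxA mulKVmx// => /(congr1 (mulmx^~ (invmx P))); rewrite mul0mx mulmxK.
  move=> /matrixP/(_ i i); rewrite !mxE eqxx mulr1n di => /eqP; by rewrite oner_eq0.
have [p hp] := hf Num.sqrt; have [p' hp'] := hf (fun t => (Num.sqrt t)^-1).
have pp : jmul p p = x.
  apply: A_inj; apply: (@cM_inj R).
  by rewrite A_jsq cMM hp (spectral_funM _ _ _ Pu) XE; apply: eq_spectral_fun => i; rewrite -expr2 sqr_sqrtr// ltW.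
have pp' : A p *m A p' = 1%:M.
  apply: (@cM_inj R); rewrite cMM hp hp' (spectral_funM _ _ _ Pu) (@eq_spectral_fun _ _ _ _ _ (fun=> 1)) => [|i]; last first.
    by rewrite divff// gt_eqF// sqrtr_gt0.
  rewrite /spectral_fun; have -> : \row_i 1%:C = const_mx 1 :> 'rV[C]_m by apply/rowP => i; rewrite !mxE.
  by rewrite diag_const_mx mulmx1 mulVmx// /cM map_mx1.
have : [set x | posdef (A x)] x; last by [].
by rewrite cone_squares; exists p => //; exists p'; exact: jinverse_mx.
Qed.

Lemma cext_mul_ext z w :
  cext A (mul_ext jmul z w) = 2^-1 *: (cext A z *m cext A w + cext A w *m cext A z).
Proof.
set x := Re_vec z; set y := Im_vec z; set u := Re_vec w; set v := Im_vec w.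
have re : Re_vec (mul_ext jmul z w) = jmul x u - jmul y v.
  by apply/rowP => i; rewrite !mxE !(cReD, cReM) /=; ring.
have im : Im_vec (mul_ext jmul z w) = jmul x v + jmul y u.
  by apply/rowP => i; rewrite !mxE !(cImD, cImM) /=; ring.
have cD (X Y : 'M[R]_m) : cM (X + Y) = cM X + cM Y by exact: map_mxD.
have cN (X : 'M[R]_m) : cM (- X) = - cM X by exact: map_mxN.
have ch (X : 'M[R]_m) : cM (2^-1 *: X) = 2^-1 *: cM X.
  by rewrite /cM map_mxZ fmorphV rmorph_nat.
rewrite /cext re im -/x -/y -/u -/v linearB linearD /= !A_jmul !(cD, cN, ch, cMM).
move: (cM (A x)) (cM (A y)) (cM (A u)) (cM (A v)) => X Y U V.
exact: (jordan_complexify _ _ _ _ (sqr_i R)).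
Qed.

Lemma cext_inj : injective (cext A).
Proof.
move=> z w h; have e1 : Im_vec z = Im_vec w.
  by apply: A_inj; rewrite -!ImMx_cext h.
have e2 : Re_vec z = Re_vec w.
  by apply: A_inj; apply: (@cM_inj R); have := h; rewrite /cext e1 => /addIr.
by rewrite [z]cM_ReIm [w]cM_ReIm -[ReMx z]/(Re_vec z) -[ReMx w]/(Re_vec w) e2 -[ImMx z]/(Im_vec z) e1.
Qed.

Lemma cext_cvec x : cext A (cvec x) = cM (A x).
Proof.
have -> : cext A (cvec x) = cM (A x) + 'i *: cM (A 0).
  by congr (cM (A _) + 'i *: cM (A _)); apply/rowP => i; rewrite !mxE.
by rewrite linear0 /cM map_mx0 scaler0 addr0.
Qed.

Lemma cext_jordan_inverse z w : cext A z *m cext A w = 1%:M ->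
  jordan_inverse (mul_ext jmul) (cvec e) z w.
Proof.
move=> zw; have wz := mulmx1C zw; split; apply: cext_inj.
  by rewrite cext_mul_ext zw wz half_double cext_cvec Ae /cM map_mx1.
by rewrite (cext_mul_ext (mul_ext jmul z z) w) (cext_mul_ext z z) (symmetrized_inverse zw wz).
Qed.

End Jordan.

(** * Topology of the tube *)

Section RowTopology.
Context {R : realType} {n : nat}.
Local Notation C := R[i].
Local Notation Cn := 'rV[R[i]]_n.

Lemma nbhs_mx_normc p q (z : 'M[C]_(p, q)) (B : set 'M[C]_(p, q)) : nbhs z B <->
  exists2 eps : R, 0 < eps & forall w : 'M[C]_(p, q), (forall i k, normc (w i k - z i k) < eps) -> B w.
Proof.
split=> [/nbhs_ballP[eps /= e0 hB]|[eps e0 hB]].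
  have eE : eps = (complex.Re eps)%:C by apply/esym/RRe_real; exact: gtr0_real.
  exists (complex.Re eps); first by move: e0; rewrite eE ltcR.
  move=> w hw; apply: hB; split=> // i k; rewrite -ball_normE /= distrC eE normcE' ltcR.
  exact: hw.
apply/nbhs_ballP; exists (eps%:C); first by rewrite /= ltcR.
move=> w [_ hw]; apply: hB => i k; have := hw i k.
by rewrite -ball_normE /= distrC normcE' ltcR.
Qed.

Lemma cvg_mx_normc p q (T : Type) (F : set_system T) {FF : Filter F} (u : T -> 'M[C]_(p, q)) (l : 'M[C]_(p, q)) :
  (forall i k (eps : R), 0 < eps -> \forall t \near F, normc (u t i k - l i k) < eps) -> u @ F --> l.
Proof.
move=> h B /nbhs_mx_normc[eps e0 hB].
have : \forall t \near F, forall i k, normc (u t i k - l i k) < eps.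
  by apply: filter_forall => i; apply: filter_forall => k; exact: h.
by apply: filterS => t ht; exact: hB.
Qed.

Lemma nbhs_row_normc (z : Cn) (B : set Cn) : nbhs z B <->
  exists2 eps : R, 0 < eps & forall w : Cn, (forall i, normc (w 0 i - z 0 i) < eps) -> B w.
Proof.
split=> [/nbhs_mx_normc[eps e0 hB]|[eps e0 hB]].
  by exists eps => // w hw; apply: hB => i k; rewrite ord1.
by apply: (iffRL (nbhs_mx_normc _ _)); exists eps => // w hw; apply: hB.
Qed.

Lemma cvg_row_normc (T : Type) (F : set_system T) {FF : Filter F} (u : T -> Cn) (l : Cn) :
  (forall i (eps : R), 0 < eps -> \forall t \near F, normc (u t 0 i - l 0 i) < eps) -> u @ F --> l.
Proof. by move=> h; apply: cvg_mx_normc => i k; rewrite ord1; exact: h. Qed.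

Lemma cvg_coord (T : Type) (F : set_system T) {FF : Filter F} (u : T -> Cn) (l : Cn) i (eps : R) :
  u @ F --> l -> 0 < eps -> \forall t \near F, normc (u t 0 i - l 0 i) < eps.
Proof.
move=> h e0; apply: (h [set w : Cn | normc (w 0 i - l 0 i) < eps]).
by apply: (iffRL (nbhs_row_normc _ _)); exists eps => // w /(_ i).
Qed.

Lemma cvg_meshC_dnbhs : (fun k => (mesh k : R)%:C) @ \oo --> (0 : C)^'.
Proof.
move=> B; rewrite /= /dnbhs /within /=.
move=> /nbhs_ballP[eps /= e0 hB].
have eE : eps = (complex.Re eps)%:C by apply/esym/RRe_real; exact: gtr0_real.
have r0 : 0 < complex.Re eps by move: e0; rewrite eE ltcR.
have : \forall k \near \oo, (mesh k : R) < complex.Re eps.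
  have := @cvg_mesh R => /cvgrPdist_lt/(_ _ r0); apply: filterS => k.
  by rewrite sub0r normrN ger0_norm// ltW// mesh_gt0.
apply: filterS => k hk; apply: hB.
  rewrite -ball_normE /= sub0r normrN eE normcE' normc_real ltcR ger0_norm//.
  by rewrite ltW// mesh_gt0.
by rewrite eqE /= negb_and gt_eqF// mesh_gt0.
Qed.

(** The differential of a holomorphic map is a limit along one real sequence of
increments, which avoids limits over the complex parameter. *)
Lemma diff_along (f : Cn -> Cn) (z u : Cn) i : differentiable f z ->
  (fun k => (((mesh k : R)%:C)^-1 *: (f (z + (mesh k)%:C *: u) - f z)) 0 i) @ \oo --> ('d f z u) 0 i.
Proof.
move=> df; have := @diff_derivable _ _ _ f z u df.
rewrite /derivable => h; have e1 := deriveE u df.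
have h2 : (fun h : C => h^-1 *: ((f \o shift z) (h *: u) - f z)) @ (0 : C)^' --> 'd f z u.
  by rewrite -e1.
have h3 := cvg_comp _ _ cvg_meshC_dnbhs h2.
apply: (iffRL (cvg_normcP _ _)) => eps e0.
have h4 := @cvg_coord nat \oo eventually_filter _ _ i eps h3 e0.
apply: filterS h4 => k /=.
by rewrite (addrC _ z).
Qed.

End RowTopology.

Section Tube.
Context {R : realType}.
Local Notation C := R[i].
Context {m n : nat} (A : {linear 'rV[R]_n -> 'M[R]_m}) (A_inj : injective A)
  (A_sym : forall x, (A x)^T = A x) (e : 'rV[R]_n) (Ae : A e = 1%:M).
Local Notation Cn := 'rV[R[i]]_n.
Local Notation D := (tube [set x | posdef (A x)]).

(** A positive definite form dominates a multiple of the squared norm, and the form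
of A depends on x with bounded coefficients. *)
Lemma cone_radius x : posdef (A x) -> exists2 eps : R, 0 < eps &
  forall y : 'rV[R]_n, (forall i, `|y 0 i - x 0 i| < eps) -> posdef (A y).
Proof.
move=> px; have [c c0 hc] := posdef_coercive px.
have /choice[K hK] : forall i : 'I_n, exists k : R, 0 < k /\ forall v, `|bil (A (delta_mx 0 i)) v v| <= k * sqn v.
  by move=> i; have [k k0 hk] := bil_bounded (A (delta_mx 0 i)); exists k.
have K0 : 0 <= \sum_i K i by apply: sumr_ge0 => i _; have [/ltW] := hK i.
exists (c / (\sum_i K i + 1)); first by rewrite divr_gt0// ltr_wpDl.
move=> y hy; split=> [|v v0]; first exact: A_sym.
have -> : A y = A x + \sum_i (y 0 i - x 0 i) *: A (delta_mx 0 i).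
  rewrite -{1}(subrK x y) linearD /= addrC; congr (_ + _).
  rewrite {1}[y - x]row_sum_delta linear_sum; apply: eq_bigr => i _.
  by rewrite linearZ /= !mxE.
rewrite bilDm; have s0 := sqn_gt0 v0.
have sB : bil (\sum_i (y 0 i - x 0 i) *: A (delta_mx 0 i)) v v =
  \sum_i (y 0 i - x 0 i) * bil (A (delta_mx 0 i)) v v.
  rewrite /bil mulmx_sumr mulmx_suml summxE; apply: eq_bigr => i _.
  by rewrite -scalemxAr -scalemxAl mxE.
have : `|\sum_i (y 0 i - x 0 i) * bil (A (delta_mx 0 i)) v v| <=
   c / (\sum_i K i + 1) * (\sum_i K i) * sqn v.
  apply: le_trans (ler_norm_sum _ _ _) _.
  rewrite -mulrA mulr_suml mulr_sumr; apply: ler_sum => i _; rewrite normrM.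
  by apply: ler_pM => //; [apply/ltW/hy | have [_] := hK i].
rewrite sB ler_norml => /andP[h _].
have h2 : c / (\sum_i K i + 1) * (\sum_i K i) < c.
  rewrite mulrAC ltr_pdivrMr ?ltr_wpDl//; nra.
have := hc v; have : c / (\sum_i K i + 1) * (\sum_i K i) * sqn v < c * sqn v by rewrite ltr_pM2r.
by lra.
Qed.

Lemma tube_open : open D.
Proof.
rewrite openE => z Dz; apply: (iffRL (nbhs_row_normc _ _)).
have [eps e0 he] := cone_radius Dz; exists eps => // w hw.
apply: he => i; apply: le_lt_trans (hw i).
have -> : (Im_vec w) 0 i - (Im_vec z) 0 i = complex.Im (w 0 i - z 0 i).
  by rewrite !mxE cImD cImN.
exact: le_Im_normc.
Qed.

Lemma Im_vec_ie : Im_vec ('i *: cvec e : Cn) = e.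
Proof. by apply/rowP => k; rewrite !mxE /= mul0r mul1r add0r. Qed.

Lemma posdef1 : posdef (1%:M : 'M[R]_m).
Proof. by split=> [|v v0]; rewrite ?trmx1// bil1 sqn_gt0. Qed.

Lemma tube_ie : D ('i *: cvec e).
Proof. by rewrite /tube /= Im_vec_ie Ae; exact: posdef1. Qed.

Lemma real_line_continuous (a v : Cn) : continuous (fun t : R => a + t%:C *: v).
Proof.
move=> t; apply: cvg_row_normc => i eps e0.
have h : (fun s : R => s * normc (v 0 i) - t * normc (v 0 i)) @ t --> (0 : R).
  rewrite -(subrr (t * normc (v 0 i))); apply: cvgB; last exact: cvg_cst.
  by apply: cvgMr_tmp; exact: cvg_id.
have /cvgrPdist_lt/(_ _ e0) := h; apply: filterS => s.
rewrite sub0r normrN -mulrBl => hs; apply: le_lt_trans hs.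
have -> : (a + s%:C *: v) 0 i - (a + t%:C *: v) 0 i = (s - t)%:C * v 0 i.
  by rewrite !mxE rmorphB; ring.
by rewrite normcM normc_real normrM (ger0_norm (normc_ge0 _)).
Qed.

(** The tube is convex, hence a union of segments from ie. *)
Lemma tube_connected : connected D.
Proof.
pose b : Cn := 'i *: cvec e.
have -> : D = \bigcup_(z in D) ((fun t : R => b + t%:C *: (z - b)) @` `[0, 1]).
  apply/seteqP; split=> [z Dz|w [z Dz [t /andP[t0 t1] <-]]].
    exists z => //; exists 1; first by rewrite /= in_itv /= ler01 lexx.
    by rewrite scale1r addrC subrK.
  rewrite /tube /=; move: t0 t1; rewrite !bnd_simp => t0 t1.
  have -> : Im_vec (b + t%:C *: (z - b)) = (1 - t) *: e + t *: Im_vec z.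
    rewrite -[in RHS]Im_vec_ie -/b; apply/rowP => k; rewrite !mxE.
    by rewrite !(cImD, cImM, cImN) /=; ring.
  split=> [|v v0]; first exact: A_sym.
  rewrite linearD !linearZ /= Ae bilDm !bilZm bil1.
  have s0 := sqn_gt0 v0; have p0 := Dz.2 v v0.
  have [->|tn0] := eqVneq t 0; first by rewrite subr0 mul1r mul0r addr0.
  rewrite ltr_wpDl//; first by rewrite mulr_ge0// ?subr_ge0// ltW.
  by rewrite mulr_gt0// lt_neqAle eq_sym tn0.
apply: bigcup_connected => [|z Dz].
  exists b => z Dz; exists 0; first by rewrite /= in_itv /= ler01 lexx.
  by rewrite scale0r addr0.
apply: connected_continuous_connected; first exact: segment_connected.
by apply: continuous_subspaceT; exact: real_line_continuous.
Qed.

Lemma tube_domain : domain D.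
Proof. by split; [exact: tube_open | exact: tube_connected | exists ('i *: cvec e); exact: tube_ie]. Qed.

End Tube.

Section MatrixLimits.
Context {R : realType} {T : Type} (F : set_system T) {FF : Filter F}.
Local Notation C := R[i].

Lemma cvg_mulmx p q r (X : T -> 'M[C]_(p, q)) (Y : T -> 'M[C]_(q, r)) (X0 : 'M[C]_(p, q)) (Y0 : 'M[C]_(q, r)) :
  (forall a b, X t a b @[t --> F] --> X0 a b) -> (forall a b, Y t a b @[t --> F] --> Y0 a b) ->
  forall a b, (X t *m Y t) a b @[t --> F] --> (X0 *m Y0) a b.
Proof.
move=> hX hY a b; rewrite [(X0 *m Y0) a b]mxE; under eq_fun do rewrite mxE.
by apply: cvg_sumC => k _; apply: cvgM; [exact: hX | exact: hY].
Qed.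

Lemma cvg_scale_entry (c : C) p q (X : T -> 'M[C]_(p, q)) (X0 : 'M[C]_(p, q)) :
  (forall a b, X t a b @[t --> F] --> X0 a b) ->
  forall a b, (c *: X t) a b @[t --> F] --> (c *: X0) a b.
Proof.
move=> hX a b; rewrite mxZE; under eq_fun do rewrite mxZE.
by apply: cvgMl_tmp; exact: hX.
Qed.

End MatrixLimits.

Section Complexify.
Context {R : realType}.
Local Notation C := R[i].
Context {m n : nat} (A : {linear 'rV[R]_n -> 'M[R]_m}).
Local Notation Cn := 'rV[R[i]]_n.

Lemma cext_sum z : cext A z = \sum_k z 0 k *: cM (A (delta_mx 0 k)).
Proof.
have AE x a b : A x a b = \sum_k x 0 k * A (delta_mx 0 k) a b.
  by rewrite {1}[x]row_sum_delta linear_sum summxE; apply: eq_bigr => k _; rewrite linearZ mxE.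
apply/matrixP => a b; rewrite summxE /cext [LHS]mxE [cM _ _ _]mxE [X in _ + X]mxE [cM _ _ _]mxE.
rewrite (AE (Re_vec z)) (AE (Im_vec z)) !rmorph_sum mulr_sumr -big_split /=.
apply: eq_bigr => k _; rewrite [RHS]mxE [cM _ _ _]mxE [in RHS](complexE (z 0 k)) !rmorphM.
by rewrite [Re_vec _ _ _]mxE [Im_vec _ _ _]mxE mulrA -mulrDl.
Qed.

Lemma cext_linear a z w : cext A (a *: z + w) = a *: cext A z + cext A w.
Proof.
rewrite !cext_sum scaler_sumr -big_split /=; apply: eq_bigr => k _.
by rewrite mxDE mxZE scalerDl scalerA.
Qed.

Lemma cextD z w : cext A (z + w) = cext A z + cext A w.
Proof. by have := cext_linear 1 z w; rewrite !scale1r. Qed.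

Lemma cext0 : cext A 0 = 0.
Proof. by rewrite cext_sum big1// => k _; rewrite [(0 : 'rV[C]_n) _ _]mxE scale0r. Qed.

Lemma cextZ a z : cext A (a *: z) = a *: cext A z.
Proof. by have := cext_linear a z 0; rewrite cext0 !addr0. Qed.

Lemma cextN z : cext A (- z) = - cext A z.
Proof. by rewrite -scaleN1r cextZ scaleN1r. Qed.

Lemma cextB z w : cext A (z - w) = cext A z - cext A w.
Proof. by rewrite cextD cextN. Qed.

Lemma cext_cvg (T : Type) (F : set_system T) {FF : Filter F} (u : T -> Cn) (l : Cn) a b :
  u @ F --> l -> (fun t => cext A (u t) a b) @ F --> cext A l a b.
Proof.
move=> ul; have E z : cext A z a b = \sum_k z 0 k * (A (delta_mx 0 k) a b)%:C.
  by rewrite cext_sum summxE; apply: eq_bigr => k _; rewrite !mxE.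
rewrite E; have -> : (fun t => cext A (u t) a b) = fun t => \sum_k u t 0 k * (A (delta_mx 0 k) a b)%:C.
  by apply/funext => t; exact: E.
apply: cvg_sumC => k _; apply: cvgMr_tmp.
apply: (iffRL (cvg_normcP _ _)) => eps e0; exact: cvg_coord.
Qed.

Lemma conj_cext z : conjM (cext A z) = cext A (conjM z).
Proof.
have iv : Im_vec (conjM z) = - Im_vec z by apply/rowP => k; rewrite !mxE; case: (z 0 k).
have rv : Re_vec (conjM z) = Re_vec z by apply/rowP => k; rewrite !mxE; case: (z 0 k).
rewrite conjME ImMx_cext [in RHS]/cext iv rv linearN.
have -> : cM (- A (Im_vec z)) = - cM (A (Im_vec z)) by exact: map_mxN.
rewrite scalerN; congr (cM _ - _).
by apply/matrixP => a b; rewrite !mxE cReD cReM /= mul0r mul1r oppr0 !addr0.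
Qed.

End Complexify.

Section AffineMaps.
Context {R : realType} {n : nat}.
Local Notation Cn := 'rV[R[i]]_n.

Lemma mulmx_continuous (Q : 'M[R[i]]_n) : continuous (fun w : Cn => w *m Q).
Proof.
move=> w; apply: (@cvg_row_normc _ _ _ _ (nbhs_filter w)) => i.
apply: (iffLR (@cvg_normcP _ _ _ (nbhs_filter w) _ _)).
rewrite mxE; have -> : (fun t : Cn => (t *m Q) 0 i) = fun t => \sum_k t 0 k * Q k i.
  by apply/funext => t; rewrite mxE.
apply: (@cvg_sumC _ _ _ _ (nbhs_filter w)) => k _; apply: cvgMr_tmp.
exact: coord_continuous.
Qed.

Lemma mulmx_differentiable (Q : 'M[R[i]]_n) (w : Cn) : differentiable (fun w : Cn => w *m Q) w.
Proof.
have -> : (fun w : Cn => w *m Q) = mulmxr Q by [].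
by apply: linear_differentiable; exact: mulmx_continuous.
Qed.

Lemma affine_differentiable (a : R[i]) (b : Cn) (w : Cn) : differentiable (fun w : Cn => a *: w + b) w.
Proof.
apply: (@differentiableD _ _ _ (fun w => a *: w) (fun=> b)); last exact: differentiable_cst.
by apply: (@differentiableZ _ _ _ id); exact: ex_diff.
Qed.

End AffineMaps.

(** * The inversion of the tube *)

Lemma opp_inverse_twice (K : comNzRingType) m (N M P : 'M[K]_m) :
  N *m M = - 1%:M -> M *m P = - 1%:M -> P = N.
Proof.
move=> NM MP; have := congr1 (mulmx N) MP.
by rewrite mulmxA NM mulNmx mul1mx mulmxN mulmx1 => /oppr_inj.
Qed.

Section RealParts.
Context {R : realType}.
Local Notation C := R[i].

Lemma ImMx_conj m (X Y : 'M[R]_m) (N : 'M[C]_m) : ImMx (cM X *m N *m cM Y) = X *m ImMx N *m Y.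
Proof.
rewrite {1}(cM_ReIm N) mulmxDr mulmxDl -scalemxAr -scalemxAl -!cMM.
by apply/matrixP => a b; rewrite !mxE cImD cImM /= mul0r mul1r !add0r.
Qed.

Lemma conjM_mul m (X Y : 'M[C]_m) : conjM (X *m Y) = conjM X *m conjM Y.
Proof. exact: map_mxM. Qed.
Lemma conjM_cM m (X : 'M[R]_m) : conjM (cM X) = cM X.
Proof. by apply/matrixP => a b; rewrite !mxE /= oppr0. Qed.
Lemma conjMK m (X : 'M[C]_m) : conjM (conjM X) = X.
Proof. by apply/matrixP => a b; rewrite !mxE; case: (X a b) => x y /=; rewrite opprK. Qed.
Lemma conjM_trmx m (X : 'M[C]_m) : conjM X^T = (conjM X)^T.
Proof. by rewrite /conjM map_trmx. Qed.

Lemma two_i_ImMx m (N : 'M[C]_m) : (2 * 'i : C) *: cM (ImMx N) = N - conjM N.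
Proof.
apply/matrixP => a b; rewrite !mxE; case: (N a b) => x y /=.
by apply/eqP; rewrite eq_complex /=; apply/andP; split; apply/eqP; ring.
Qed.

Lemma two_i_neq0 : (2 * 'i : C) != 0.
Proof.
apply: mulf_neq0; first by rewrite pnatr_eq0.
by rewrite -normc_eq0 normc_i oner_eq0.
Qed.

(** From N - conj N = 2i Im N, multiplied on both sides by M and conj M. *)
Lemma Im_inverse m (N M : 'M[C]_m) : N *m M = - 1%:M -> M *m N = - 1%:M ->
  cM (ImMx M) = conjM M *m cM (ImMx N) *m M /\ cM (ImMx M) = M *m cM (ImMx N) *m conjM M.
Proof.
move=> NM MN; have NM' : conjM N *m conjM M = - 1%:M.
  by rewrite -conjM_mul NM /conjM map_mxN map_mx1.
have MN' : conjM M *m conjM N = - 1%:M.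
  by rewrite -conjM_mul MN /conjM map_mxN map_mx1.
by split; apply: (scalerI two_i_neq0); rewrite scalemxAl scalemxAr !two_i_ImMx;
  rewrite mulmxBr mulmxBl ?MN ?MN' -?mulmxA ?NM ?NM' ?mulNmx ?mulmxN ?mulmx1 ?mul1mx ?opprK addrC ?opprK.
Qed.

End RealParts.

Section Inversion.
Context {R : realType}.
Local Notation C := R[i].
Context {m n : nat} (A : {linear 'rV[R]_n -> 'M[R]_m}) (A_inj : injective A)
  (A_sym : forall x, (A x)^T = A x) (e : 'rV[R]_n) (Ae : A e = 1%:M).
Local Notation Cn := 'rV[R[i]]_n.
Local Notation D := (tube [set x | posdef (A x)]).
Context (j : Cn -> Cn) (j_tube : forall z, D z -> D (j z)) (j_holo : holomorphic_on D j)
  (key : forall z, D z -> cext A z *m cext A (j z) = - 1%:M).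

Lemma inversion_comm z : D z -> cext A (j z) *m cext A z = - 1%:M.
Proof.
move=> Dz; have h : cext A z *m (- cext A (j z)) = 1%:M by rewrite mulmxN key// opprK.
by have := mulmx1C h; rewrite mulNmx => <-; rewrite opprK.
Qed.

Lemma j_involutive z : D z -> j (j z) = z.
Proof.
move=> Dz; apply: (cext_inj A_inj).
exact: opp_inverse_twice (key Dz) (key (j_tube Dz)).
Qed.

Lemma cext_i x : cext A ('i *: cvec x) = 'i *: cM (A x).
Proof. by rewrite cextZ cext_cvec. Qed.

Lemma Im_vec_i x : Im_vec ('i *: cvec x : Cn) = x.
Proof. by apply/rowP => k; rewrite !mxE /= mul0r mul1r add0r. Qed.

Definition cone_inv x := Im_vec (j ('i *: cvec x)).

(** At z = ix the relation reads A x * A (Im (j z)) = 1 in its real part. *)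
Lemma cone_invP x : posdef (A x) -> posdef (A (cone_inv x)) /\ A x *m A (cone_inv x) = 1%:M.
Proof.
move=> px; have Dx : D ('i *: cvec x) by rewrite /tube /= Im_vec_i.
split; first exact: (j_tube Dx).
have := congr1 (@ReMx R m m) (key Dx).
rewrite cext_i -scalemxAl (cM_ReIm (cext A (j _))) ImMx_cext mulmxDr -scalemxAr -!cMM.
move=> /matrixP h; apply/matrixP => a b; have := h a b.
by rewrite !mxE !(cReD, cReM, cReN, cImD, cImM) /= !(mul0r, mul1r, mulr0, add0r, subr0, sub0r, addr0, subrr) => /oppr_inj; case: (a == b).
Qed.

Lemma cext_jE x : posdef (A x) -> cext A (j ('i *: cvec x)) = 'i *: cM (A (cone_inv x)).
Proof.
move=> px; have Dx : D ('i *: cvec x) by rewrite /tube /= Im_vec_i.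
have [_ h] := cone_invP px; have h' := mulmx1C h.
have := congr1 (mulmx (cM (A (cone_inv x)))) (key Dx).
rewrite cext_i mulmxA -scalemxAr -cMM h' /cM map_mx1 -scalemxAl mul1mx mulmxN mulmx1 => e1.
have := congr1 (fun X => 'i *: X) e1; rewrite scalerA -expr2 sqr_i scaleN1r scalerN.
by move=> /oppr_inj.
Qed.

Definition jordan_inv_ex x (px : posdef (A x)) : exists2 y, posdef (A y) & A x *m A y = 1%:M.
Proof. by have [h1 h2] := cone_invP px; exists (cone_inv x). Qed.

(** The complexified action W |-> Y W Y preserves the image of V by [A_quad]. *)
Lemma quad_rep y : exists Q : 'M[C]_n, forall w, cext A (w *m Q) = cM (A y) *m cext A w *m cM (A y).
Proof.
have [q hq] : {q | forall v, A (q v) = A y *m A v *m A y}.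
  exists (fun v => 2 *: jmul A y (jmul A y v) - jmul A (jmul A y y) v) => v.
  exact: (A_quad A_sym Ae jordan_inv_ex).
have ql a u v : q (a *: u + v) = a *: q u + q v.
  by apply: A_inj; rewrite linearP !hq linearP mulmxDr mulmxDl -scalemxAr -scalemxAl.
exists (cM (lin1_mx q)) => w.
have cq x : cext A (cvec x *m cM (lin1_mx q)) = cM (A y) *m cM (A x) *m cM (A y).
  have -> : cvec x *m cM (lin1_mx q) = cvec (q x).
    by rewrite -[cvec x]/(cM x) -cMM (lin1_mxE ql).
  by rewrite cext_cvec hq !cMM.
rewrite [w in LHS]cM_ReIm mulmxDl -scalemxAl cextD cextZ !cq.
by rewrite /cext mulmxDr mulmxDl -scalemxAr -scalemxAl.
Qed.

End Inversion.

(** * The invariant metric and the symmetries *)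

Section Metric.
Context {R : realType}.
Local Notation C := R[i].
Context {m n : nat} (A : {linear 'rV[R]_n -> 'M[R]_m}) (A_inj : injective A)
  (A_sym : forall x, (A x)^T = A x).
Local Notation Cn := 'rV[R[i]]_n.
Local Notation D := (tube [set x | posdef (A x)]).

Definition im_inv (z : Cn) : 'M[C]_m := cM (invmx (A (Im_vec z))).

(** The matrix of the Hermitian form tr (Y^-1 U Y^-1 conj W), Y = A (Im z), see
[cone_metricE]. *)
Definition cone_metric (z : Cn) : 'M[C]_n :=
  \matrix_(a, b) \tr (im_inv z *m cM (A (delta_mx 0 a)) *m im_inv z *m cM (A (delta_mx 0 b))).

Lemma cone_metricE z u v :
  hform (cone_metric z) u v = \tr (im_inv z *m cext A u *m im_inv z *m conjM (cext A v)).
Proof.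
rewrite conj_cext /hform mxE.
under eq_bigr do rewrite mxE mulr_suml.
rewrite exchange_big (cext_sum A u) mulmx_sumr !mulmx_suml raddf_sum; apply: eq_bigr => a _ /=.
rewrite cext_sum mulmx_sumr raddf_sum; apply: eq_bigr => b _ /=.
rewrite -!scalemxAr -!scalemxAl !mxtraceZ !mxE; ring.
Qed.

Lemma cext_symmetric u : (cext A u)^T = cext A u.
Proof. by rewrite linearD linearZ /= -!cMT !A_sym. Qed.

Lemma mxtrace_herm_gt0 k (W : 'M[C]_k) : W^T = W -> W != 0 -> 0 < \tr (W *m conjM W).
Proof.
move=> WT W0.
have -> : \tr (W *m conjM W) = (\sum_a \sum_b (complex.Re (W a b) ^+ 2 + complex.Im (W a b) ^+ 2))%:C.
  rewrite rmorph_sum; apply: eq_bigr => a _; rewrite mxE rmorph_sum; apply: eq_bigr => b _.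
  rewrite mxE -[in W b a]WT mxE; case: (W a b) => x y /=.
  by apply/eqP; rewrite eq_complex /=; apply/andP; split; apply/eqP; ring.
have ge0 a b : 0 <= complex.Re (W a b) ^+ 2 + complex.Im (W a b) ^+ 2 by rewrite addr_ge0 ?sqr_ge0.
rewrite ltcR lt_neqAle eq_sym sumr_ge0 ?andbT => [|a _]; last by apply: sumr_ge0 => b _; exact: ge0.
rewrite psumr_eq0 => [|a _]; last by apply: sumr_ge0 => b _; exact: ge0.
apply: contraNN W0 => /allP h; apply/eqP/matrixP => a b; rewrite [RHS]mxE.
have := h a; rewrite mem_index_enum => /(_ isT) /=.
rewrite psumr_eq0 => [/allP/(_ b)|b' _]; last exact: ge0.
rewrite mem_index_enum => /(_ isT) /=; rewrite paddr_eq0 ?sqr_ge0// !sqrf_eq0 => /andP[/eqP p /eqP q].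
by apply/eqP; rewrite eq_complex p q !eqxx.
Qed.

Lemma posdef_inv k (X : 'M[R]_k) : posdef X -> exists2 T : 'M[R]_k, T \in unitmx & invmx X = T *m T^T.
Proof.
move=> /cholesky[T Tu ->]; exists (invmx T)^T; first by rewrite unitmx_tr unitmx_inv.
rewrite trmxK; apply: invmx_uniq; rewrite -mulmxA.
by rewrite (mulmxA _ (invmx T)^T) -trmx_mul mulVmx// trmx1 mul1mx mulmxV.
Qed.

(** With Y^-1 = S S^T the value at u is the squared norm of S^T U S. *)
Lemma cone_metric_posdef z : D z ->
  (forall u v, hform (cone_metric z) v u = conjc (hform (cone_metric z) u v)) /\
  (forall u, u != 0 -> 0 < hform (cone_metric z) u u).
Proof.
move=> Dz; split=> [u v|u u0].
  have conj_tr (X : 'M[C]_m) : conjc (\tr X) = \tr (conjM X).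
    by rewrite /mxtrace rmorph_sum; apply: eq_bigr => a _; rewrite mxE.
  rewrite !cone_metricE conj_tr !conjM_mul conjM_cM conjMK.
  by rewrite -(mulmxA _ _ (conjM _)) mxtrace_mulC !mulmxA.
have [T Tu hT] := posdef_inv Dz.
rewrite cone_metricE /im_inv hT cMM cMT; set S := cM T.
have Su : S \in unitmx by rewrite /S /cM map_unitmx.
set W := S^T *m cext A u *m S.
have -> : \tr (S *m S^T *m cext A u *m (S *m S^T) *m conjM (cext A u)) = \tr (W *m conjM W).
  rewrite /W !conjM_mul conjM_trmx conjM_cM -/S !mulmxA.
  by rewrite [RHS]mxtrace_mulC !mulmxA.
apply: mxtrace_herm_gt0.
  by rewrite /W !trmx_mul trmxK cext_symmetric mulmxA.
apply: contraNneq u0 => h; apply/eqP/(cext_inj A_inj); rewrite cext0.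
have STu : S^T \in unitmx by rewrite unitmx_tr.
have := congr1 (fun X => invmx S^T *m X *m invmx S) h.
by rewrite mulmx0 mul0mx /W !mulmxA mulVmx// mul1mx mulmxK.
Qed.

End Metric.

(** The factorization X^2 + 1 = (X - i)(X + i) for N and B in place of X and 1. *)
Lemma cayley_factor (K : comNzRingType) k (ii : K) (N B B' : 'M[K]_k) :
  ii ^+ 2 = -1 -> N *m B' *m N = - B -> B *m B' = 1%:M -> B' *m B = 1%:M ->
  (N - ii *: B) *m (B' *m (N + ii *: B)) = 0.
Proof.
move=> i2 NN BB B'B; rewrite mulmxA mulmxBl mulmxDr !mulmxBl NN.
rewrite -!scalemxAl -!scalemxAr BB mul1mx -(mulmxA N) B'B mulmx1 scalerA -expr2 i2 scaleN1r.
by rewrite mul1mx opprK -opprD (addrC B) addNr.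
Qed.

(** The two descriptions of the transformed inverse imaginary part, B' N* P N B' and
B' N P N* B' with N* for Nc, are used in the two places where it occurs; with this
choice all factors cancel. *)
Lemma isometry_trace (K : comNzRingType) k (B B' P U V N M Nc Mc : 'M[K]_k) :
  B *m B' = 1%:M -> B' *m B = 1%:M -> N *m M = - 1%:M -> M *m N = - 1%:M ->
  Nc *m Mc = - 1%:M -> Mc *m Nc = - 1%:M ->
  \tr (B' *m Nc *m P *m N *m B' *m (B *m M *m U *m M *m B) *m
       (B' *m N *m P *m Nc *m B') *m (B *m Mc *m V *m Mc *m B)) = \tr (P *m U *m P *m V).
Proof.
move=> BB' B'B NM MN NMc MNc.
have c1 (X : 'M[K]_k) : X *m B' *m B = X by rewrite -mulmxA B'B mulmx1.
have c2 (X : 'M[K]_k) : X *m B *m B' = X by rewrite -mulmxA BB' mulmx1.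
have c3 (X : 'M[K]_k) : X *m N *m M = - X by rewrite -mulmxA NM mulmxN mulmx1.
have c4 (X : 'M[K]_k) : X *m M *m N = - X by rewrite -mulmxA MN mulmxN mulmx1.
have c5 (X : 'M[K]_k) : X *m Nc *m Mc = - X by rewrite -mulmxA NMc mulmxN mulmx1.
rewrite !mulmxA !c1 c2 c3 !mulNmx c4 !mulNmx c5 !mulNmx !opprK raddfN /=.
rewrite mxtrace_mulC !mulmxA BB' mul1mx mxtrace_mulC !mulmxA MNc.
by rewrite !mulNmx mul1mx raddfN opprK.
Qed.

Lemma inverse_difference (K : comNzRingType) k (t : K) (N N' J J' U : 'M[K]_k) :
  J *m N = - 1%:M -> N' *m J' = - 1%:M -> N' = N + t *: U ->
  J' - J = t *: (J *m U *m J').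
Proof.
move=> JN N'J' hN; have := congr1 (mulmx J) N'J'.
rewrite hN mulmxDl mulmxDr mulmxA JN mulNmx mul1mx mulmxN mulmx1.
by rewrite -scalemxAl -scalemxAr mulmxA => h; rewrite -h addrA subrr add0r.
Qed.

Lemma congr_difference (K : comNzRingType) k (B X Y Z : 'M[K]_k) :
  (B *m X *m B + Z) - (B *m Y *m B + Z) = B *m (X - Y) *m B.
Proof. by rewrite mulmxBr mulmxBl opprD addrACA subrr addr0. Qed.

Lemma congr_inverse (K : comNzRingType) k (B B' P Y N M Nc Mc : 'M[K]_k) :
  B' *m B = 1%:M -> N *m M = - 1%:M -> Nc *m Mc = - 1%:M -> P *m Y = 1%:M ->
  (B' *m Nc *m P *m N *m B') *m (B *m (M *m Y *m Mc) *m B) = 1%:M.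
Proof.
move=> B'B NM NMc PY; rewrite -!mulmxA (mulmxA B' B) B'B mul1mx (mulmxA N M) NM mulNmx mul1mx.
rewrite mulmxN (mulmxA P Y) PY mul1mx !mulmxN (mulmxA Nc Mc) NMc mulNmx mul1mx mulmxN opprK.
exact: B'B.
Qed.

Section Symmetry.
Context {R : realType}.
Local Notation C := R[i].
Context {m n : nat} (A : {linear 'rV[R]_n -> 'M[R]_m}) (A_inj : injective A)
  (A_sym : forall x, (A x)^T = A x) (e : 'rV[R]_n) (Ae : A e = 1%:M).
Local Notation Cn := 'rV[R[i]]_n.
Local Notation D := (tube [set x | posdef (A x)]).
Context (j : Cn -> Cn) (j_tube : forall z, D z -> D (j z)) (j_holo : holomorphic_on D j)
  (key : forall z, D z -> cext A z *m cext A (j z) = - 1%:M).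
Context (a : Cn) (Da : D a) (Q : 'M[C]_n).
Let B := cM (A (Im_vec a)).
Context (hQ : forall w, cext A (w *m Q) = B *m cext A w *m B).

Let x0 : Cn := cvec (Re_vec a).

(** Conjugation by the real translation to x0 reduces to the point i y0, where Q
represents W |-> A y0 * W * A y0 and sends j(i y0) = i y0^-1 to i y0. *)
Definition sym_at z := j (z - x0) *m Q + x0.

Lemma Im_subx0 z : Im_vec (z - x0) = Im_vec z.
Proof. by apply/rowP => k; rewrite !mxE cImD cImN /= subr0. Qed.
Lemma Im_addx0 z : Im_vec (z + x0) = Im_vec z.
Proof. by apply/rowP => k; rewrite !mxE cImD /= addr0. Qed.

Lemma tube_sub z : D z -> D (z - x0).
Proof. by rewrite /tube /= Im_subx0. Qed.

Lemma B_unit : B \in unitmx.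
Proof.
have [T Tu hT] := cholesky Da.
by rewrite /B hT /cM map_unitmx unitmx_mul unitmx_tr Tu.
Qed.

Lemma Im_sym z : A (Im_vec (sym_at z)) = A (Im_vec a) *m A (Im_vec (j (z - x0))) *m A (Im_vec a).
Proof.
rewrite /sym_at Im_addx0 -[A (Im_vec (_ *m Q))]ImMx_cext hQ.
by rewrite ImMx_conj ImMx_cext.
Qed.

Lemma posdef_congr k (X Y : 'M[R]_k) : X^T = X -> X \in unitmx -> posdef Y -> posdef (X *m Y *m X).
Proof.
move=> XT Xu [YT pY]; split=> [|v v0]; first by rewrite !trmx_mul XT YT mulmxA.
rewrite -{2}XT bil_conj; apply: pY; apply: contraNneq v0 => /(congr1 (mulmx^~ (invmx X))).
by rewrite mulmxK// mul0mx => ->.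
Qed.

Lemma sym_tube z : D z -> D (sym_at z).
Proof.
move=> Dz; rewrite /tube /= Im_sym; apply: posdef_congr; [exact: A_sym| |].
  by have := B_unit; rewrite /B /cM map_unitmx.
exact: (j_tube (tube_sub Dz)).
Qed.

Lemma cext_symE z : cext A (sym_at z) = B *m cext A (j (z - x0)) *m B + cext A x0.
Proof. by rewrite /sym_at cextD hQ. Qed.

Lemma sym_involutive z : D z -> sym_at (sym_at z) = z.
Proof.
move=> Dz; apply: (cext_inj A_inj); rewrite cext_symE.
have Dw := tube_sub (sym_tube Dz).
have hw : cext A (sym_at z - x0) = B *m cext A (j (z - x0)) *m B by rewrite cextB cext_symE addrK.
set w := sym_at z - x0 in Dw hw *.
have k1 := key Dw; rewrite hw in k1.
have k2 := inversion_comm key (tube_sub Dz).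
have Bu := B_unit.
have -> : B *m cext A (j w) *m B = cext A (z - x0).
  have h1 : cext A (j (z - x0)) *m (B *m cext A (j w) *m B) = - 1%:M.
    have k4 : B *m (- (cext A (j (z - x0)) *m B *m cext A (j w))) = 1%:M.
      by rewrite mulmxN !mulmxA k1 opprK.
    have k5 := mulmx1C k4; apply: oppr_inj; rewrite opprK -mulNmx !mulmxA.
    by rewrite mulNmx in k5; rewrite !mulNmx; exact: k5.
  have k3 := key (tube_sub Dz).
  have := congr1 (mulmx (cext A (z - x0))) h1.
  by rewrite mulmxA k3 mulNmx mul1mx mulmxN mulmx1 => /oppr_inj.
by rewrite cextB subrK.
Qed.

Lemma a_sub : cext A (a - x0) = 'i *: B.
Proof.
by rewrite cextB cext_cvec /cext addrC addrA addNr add0r.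
Qed.

Lemma sym_fixed_base : sym_at a = a.
Proof.
apply: (cext_inj A_inj); rewrite cext_symE.
have := key (tube_sub Da); rewrite a_sub -scalemxAl => k1.
have -> : B *m cext A (j (a - x0)) *m B = 'i *: B.
  have := congr1 (fun X => 'i *: (X *m B)) k1.
  by rewrite -scalemxAl scalerA -expr2 sqr_i scaleN1r mulNmx mul1mx scalerN => /oppr_inj.
by rewrite -a_sub cextB subrK.
Qed.

(** A fixed point N = A (z - x0) satisfies N B^-1 N = - B, which factors as
(N - iB) B^-1 (N + iB) = 0; the last factor is invertible because its imaginary
part is positive definite. *)
Lemma sym_fixed_unique z : D z -> sym_at z = z -> z = a.
Proof.
move=> Dz hz; have Du := tube_sub Dz; have Bu := B_unit.
set N := cext A (z - x0).
have hN : B *m cext A (j (z - x0)) *m B = N by rewrite /N -[in RHS]hz cextB cext_symE addrK.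
have k2 := inversion_comm key Du; rewrite -/N in k2.
have e1 : N *m invmx B *m N = - B.
  rewrite -{1}hN mulmxK// -mulmxA k2 mulmxN mulmx1; by [].
have i2 (X : 'M[C]_m) : ('i : C) *: ('i *: X) = - X by rewrite scalerA -expr2 sqr_i scaleN1r.
have e2 : (N - 'i *: B) *m (invmx B *m (N + 'i *: B)) = 0.
  exact: (cayley_factor (sqr_i R) e1 (mulmxV Bu) (mulVmx Bu)).
have pu : N + 'i *: B \in unitmx.
  rewrite -a_sub /N -cextD; apply: siegel_unit; apply: siegel_cext; first exact: A_sym.
  have -> : Im_vec (z - x0 + (a - x0)) = Im_vec z + Im_vec a.
    by rewrite -[Im_vec z]Im_subx0 -[Im_vec a]Im_subx0; apply/rowP => k; rewrite !mxE cImD.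
  by rewrite linearD; exact: posdef_add.
have wu : invmx B *m (N + 'i *: B) \in unitmx by rewrite unitmx_mul unitmx_inv Bu pu.
have := congr1 (mulmx^~ (invmx (invmx B *m (N + 'i *: B)))) e2.
rewrite mul0mx mulmxK// => /eqP; rewrite subr_eq0 -a_sub => /eqP/(cext_inj A_inj).
by move=> /addIr.
Qed.

Lemma sub_differentiable z : differentiable (fun z : Cn => z - x0) z.
Proof.
have -> : (fun z : Cn => z - x0) = (fun z => 1 *: z + (- x0)) by apply/funext => w; rewrite scale1r.
exact: affine_differentiable.
Qed.

Lemma sym_holo : holomorphic_on D sym_at.
Proof.
move=> z Dz; apply: (@differentiableD _ _ _ (fun z => j (z - x0) *m Q) (fun=> x0)).
  apply: (@differentiable_comp _ _ _ _ (fun z => j (z - x0)) (fun w => w *m Q)).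
    apply: (@differentiable_comp _ _ _ _ (fun z => z - x0) j); first exact: sub_differentiable.
    by apply: j_holo; exact: tube_sub.
  exact: mulmx_differentiable.
exact: differentiable_cst.
Qed.

Lemma inversion_difference z w (t : C) u : D z -> D w -> cext A w = cext A z + t *: cext A u ->
  cext A (j w) - cext A (j z) = t *: (cext A (j z) *m cext A u *m cext A (j w)).
Proof.
move=> Dz Dw; exact: inverse_difference (inversion_comm key Dz) (key Dw).
Qed.

Lemma tube_nbhs z : D z -> nbhs z D.
Proof. by move=> Dz; apply: open_nbhs_nbhs; split => //; exact: tube_open. Qed.

Lemma sub_j_continuous z : D z -> (fun w => j (w - x0)) @ z --> j (z - x0).
Proof.
move=> Dz; apply: (@differentiable_continuous _ _ _ z (fun w => j (w - x0))).
apply: (@differentiable_comp _ _ _ _ (fun z => z - x0) j); first exact: sub_differentiable.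
by apply: j_holo; exact: tube_sub.
Qed.

(** Differentiating - N^-1 gives N^-1 U N^-1; the limit is taken in the exact
formula for difference quotients of the inverse. *)
Lemma sym_diff z u : D z -> cext A ('d sym_at z u) =
  B *m cext A (j (z - x0)) *m cext A u *m cext A (j (z - x0)) *m B.
Proof.
move=> Dz; apply/matrixP => c d; set J := fun w => cext A (j (w - x0)).
have lim1 : (fun k => cext A (((mesh k : R)%:C)^-1 *: (sym_at (z + (mesh k)%:C *: u) - sym_at z)) c d)
    @ \oo --> cext A ('d sym_at z u) c d.
  apply: cext_cvg; apply: cvg_row_normc => i; apply: (iffLR (cvg_normcP _ _)).
  have h := @diff_along _ _ sym_at z u i (sym_holo Dz).
  exact: h.
have zk : (fun k => z + (mesh k : R)%:C *: u) @ \oo --> z.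
  have := @real_line_continuous R n z u 0; rewrite /continuous_at scale0r addr0 => h.
  exact: cvg_comp (@cvg_mesh R) h.
have Dk : \forall k \near \oo, D (z + (mesh k : R)%:C *: u) := zk _ (tube_nbhs Dz).
have jk : (fun k => j (z + (mesh k : R)%:C *: u - x0)) @ \oo --> j (z - x0).
  exact: cvg_comp zk (sub_j_continuous Dz).
have lim2 : (fun k => (B *m J z *m cext A u *m J (z + (mesh k : R)%:C *: u) *m B) c d)
    @ \oo --> (B *m J z *m cext A u *m J z *m B) c d.
  apply: cvg_mulmx => a1 a2; last exact: cvg_cst.
  apply: cvg_mulmx => a3 a4; first exact: cvg_cst.
  exact: cext_cvg.
apply: (ccvg_unique lim1); move: lim2; apply: cvg_trans; apply: near_eq_cvg.
apply: filterS Dk => k Dk; congr (fun_of_matrix _ c d).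
rewrite cextZ cextB !cext_symE congr_difference.
have hw : cext A (z + (mesh k : R)%:C *: u - x0) = cext A (z - x0) + (mesh k : R)%:C *: cext A u.
  by rewrite -cextZ -cextD addrAC.
rewrite (inversion_difference (tube_sub Dz) (tube_sub Dk) hw) -scalemxAr -scalemxAl scalerA.
have t0 : (mesh k : R)%:C != 0 :> C by rewrite eqE /= negb_and gt_eqF// mesh_gt0.
by rewrite (mulVf t0) scale1r 2!mulmxA.
Qed.

Lemma sym_isometry : isometry_on D (cone_metric A) sym_at.
Proof.
move=> z Dz u v; rewrite !cone_metricE !sym_diff//.
set N := cext A (z - x0); set M := cext A (j (z - x0)).
have Du := tube_sub Dz; have NM : N *m M = - 1%:M := key Du.
have MN : M *m N = - 1%:M := inversion_comm key Du.
have NMc : conjM N *m conjM M = - 1%:M by rewrite -conjM_mul NM /conjM map_mxN map_mx1.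
have MNc : conjM M *m conjM N = - 1%:M by rewrite -conjM_mul MN /conjM map_mxN map_mx1.
have Bu := B_unit; have BB' := mulmxV Bu; have B'B := mulVmx Bu.
have [i1 i2] := Im_inverse NM MN.
have NY : ImMx N = A (Im_vec z) by rewrite ImMx_cext Im_subx0.
have Yu : A (Im_vec z) \in unitmx by have [T Tu ->] := cholesky Dz; rewrite unitmx_mul unitmx_tr Tu.
have PY : im_inv A z *m cM (ImMx N) = 1%:M by rewrite /im_inv NY -cMM mulVmx// /cM map_mx1.
set P := im_inv A z in PY *.
have Ysu : A (Im_vec (sym_at z)) \in unitmx.
  by have [T Tu ->] := cholesky (sym_tube Dz); rewrite unitmx_mul unitmx_tr Tu.
have YsE : cM (A (Im_vec (sym_at z))) = B *m cM (ImMx M) *m B.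
  by rewrite Im_sym !cMM ImMx_cext.
have PsE X : X *m (B *m cM (ImMx M) *m B) = 1%:M -> im_inv A (sym_at z) = X.
  rewrite -YsE => h; rewrite -[LHS]mul1mx -h -mulmxA /im_inv -cMM mulmxV// /cM map_mx1.
  exact: mulmx1.
have P1 : im_inv A (sym_at z) = invmx B *m conjM N *m P *m N *m invmx B.
  by apply: PsE; rewrite i2; exact: (congr_inverse B'B NM NMc PY).
have P2 : im_inv A (sym_at z) = invmx B *m N *m P *m conjM N *m invmx B.
  by apply: PsE; rewrite i1; exact: (congr_inverse B'B NMc NM PY).
rewrite {1}P1 P2 !conjM_mul (conjM_cM (A (Im_vec a))) -/B.
exact: (isometry_trace _ _ _ BB' B'B NM MN NMc MNc).
Qed.

End Symmetry.

(** * Smoothness of the metric *)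

Section Smooth.
Context {R : realType}.
Local Notation C := R[i].
Context {m n : nat} (A : {linear 'rV[R]_n -> 'M[R]_m}) (A_inj : injective A)
  (A_sym : forall x, (A x)^T = A x).
Local Notation Cn := 'rV[R[i]]_n.
Local Notation D := (tube [set x | posdef (A x)]).
Context (j : Cn -> Cn) (j_tube : forall z, D z -> D (j z)) (j_holo : holomorphic_on D j)
  (key : forall z, D z -> cext A z *m cext A (j z) = - 1%:M).

(** The functions generated by the entries of Y^-1, Y = A (Im z).  This family is
stable under real directional derivatives since d(Y^-1) = - Y^-1 dY Y^-1, which
proves smoothness without computing higher derivatives. *)
Inductive inverse_polynomial : (Cn -> C) -> Prop :=
| ip_cst c : inverse_polynomial (fun=> c)
| ip_inv a b : inverse_polynomial (fun z => im_inv A z a b)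
| ip_add f g : inverse_polynomial f -> inverse_polynomial g ->
    inverse_polynomial (fun z => f z + g z)
| ip_mul f g : inverse_polynomial f -> inverse_polynomial g ->
    inverse_polynomial (fun z => f z * g z).

Lemma ip_sum (I : Type) (r : seq I) (F : I -> Cn -> C) :
  (forall i, inverse_polynomial (F i)) -> inverse_polynomial (fun z => \sum_(i <- r) F i z).
Proof.
move=> hF; elim: r => [|i r IH].
  have -> : (fun z => \sum_(i <- [::]) F i z) = fun=> 0 by apply/funext => z; rewrite big_nil.
  exact: ip_cst.
have -> : (fun z => \sum_(i <- i :: r) F i z) = fun z => F i z + \sum_(i <- r) F i z.
  by apply/funext => z; rewrite big_cons.
exact: ip_add.
Qed.

Lemma ip_mulmx p q r (X : Cn -> 'M[C]_(p, q)) (Y : Cn -> 'M[C]_(q, r)) :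
  (forall a b, inverse_polynomial (fun z => X z a b)) ->
  (forall a b, inverse_polynomial (fun z => Y z a b)) ->
  forall a b, inverse_polynomial (fun z => (X z *m Y z) a b).
Proof.
move=> hX hY a b; have -> : (fun z => (X z *m Y z) a b) = fun z => \sum_k X z a k * Y z k b.
  by apply/funext => z; rewrite mxE.
by apply: ip_sum => k; exact: ip_mul.
Qed.

Lemma ip_cone_metric a b : inverse_polynomial (fun z => cone_metric A z a b).
Proof.
have -> : (fun z => cone_metric A z a b) = fun z => \sum_c
  (im_inv A z *m cM (A (delta_mx 0 a)) *m im_inv A z *m cM (A (delta_mx 0 b))) c c.
  by apply/funext => z; rewrite mxE.
apply: ip_sum => c; apply: ip_mulmx => [c1 c2|c1 c2]; last exact: ip_cst.
apply: ip_mulmx => [c3 c4|c3 c4]; last exact: ip_inv.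
by apply: ip_mulmx => [c5 c6|c5 c6]; [exact: ip_inv | exact: ip_cst].
Qed.

(** j maps iY to i Y^-1, so the continuity of Y^-1 follows from that of j. *)
Lemma im_invE z : D z -> im_inv A z = (- 'i) *: cext A (j ('i *: cvec (Im_vec z))).
Proof.
move=> Dz; rewrite (cext_jE j_tube key Dz) scalerA mulNr -expr2 sqr_i opprK scale1r.
by congr cM; apply: invmx_uniq; have [_] := cone_invP j_tube key Dz.
Qed.

Lemma Im_line_continuous z : (fun w : Cn => 'i *: cvec (Im_vec w) : Cn) @ z --> ('i *: cvec (Im_vec z) : Cn).
Proof.
apply: (@cvg_row_normc _ _ _ _ (nbhs_filter z)) => i eps e0.
have h := @cvg_coord _ _ _ _ (nbhs_filter z) (fun w : Cn => w) z i eps (fun B => id) e0.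
apply: filterS h => w; apply: le_lt_trans.
have -> : ('i *: cvec (Im_vec w) : Cn) 0 i - ('i *: cvec (Im_vec z) : Cn) 0 i =
   'i * (complex.Im (w 0 i - z 0 i))%:C.
  by rewrite !mxE cImD cImN rmorphB mulrBr.
by rewrite normcM normc_i mul1r normc_real le_Im_normc.
Qed.

Lemma im_inv_continuous z a b : D z -> (fun w => im_inv A w a b) @ z --> im_inv A z a b.
Proof.
move=> Dz; rewrite (im_invE Dz).
have Diz : D ('i *: cvec (Im_vec z)) by rewrite /tube /= Im_vec_i.
have jc : (fun w => j ('i *: cvec (Im_vec w))) @ z --> j ('i *: cvec (Im_vec z)).
  have jc0 := differentiable_continuous (j_holo Diz).
  by move=> B /jc0 hB; exact: (@Im_line_continuous z _ hB).
have := @cvg_scale_entry _ _ _ (nbhs_filter z) (- 'i) _ _ _ _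
  (fun a b => @cext_cvg _ _ _ A _ _ (nbhs_filter z) _ _ a b jc) a b.
apply: cvg_trans; apply: (@near_eq_cvg _ _ _ (nbhs_filter z)).
have Dn : \forall w \near z, D w by exact: (tube_nbhs A_sym Dz).
move: Dn; apply: filterS => w Dw.
by rewrite (im_invE Dw).
Qed.

Lemma cvg_line z v : (fun t : R => z + t%:C *: v) @ (0 : R)^' --> (z : Cn).
Proof.
have := @real_line_continuous R n z v 0; rewrite /continuous_at scale0r addr0 => h.
exact: cvg_comp (@nbhs_dnbhs _ (0 : R)) h.
Qed.

Lemma inverse_quotient (K : comUnitRingType) k (t : K) (P P' Y Y' U : 'M[K]_k) :
  t \is a GRing.unit -> P *m Y = 1%:M -> Y' *m P' = 1%:M -> Y' = Y + t *: U ->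
  t^-1 *: (P' - P) = -1 *: (P *m U *m P').
Proof.
move=> tu PY YP hY; have := congr1 (mulmx P) YP.
rewrite hY mulmxDl mulmxDr mulmxA PY mul1mx mulmx1 -scalemxAl -scalemxAr mulmxA => h.
by rewrite -{1}h opprD addrA subrr sub0r scalerN scalerA mulVr// scale1r scaleN1r.
Qed.

Lemma inverse_polynomial_deriv f : inverse_polynomial f ->
  (forall z, D z -> f w @[w --> z] --> f z) /\
  (forall v, exists2 f', inverse_polynomial f' & forall z, D z ->
     (t^-1)%:C * (f (z + t%:C *: v) - f z) @[t --> (0 : R)^'] --> f' z).
Proof.
elim=> [c|a b|f1 f2 _ [c1 d1] _ [c2 d2]|f1 f2 s1 [c1 d1] s2 [c2 d2]].
- split=> [z _|v]; first exact: (@cvg_cst _ c _ _ (nbhs_filter z)).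
  exists (fun=> 0) => [|z _]; first exact: ip_cst.
  by under eq_fun do rewrite subrr mulr0; exact: cvg_cst.
- split=> [z|v]; first exact: im_inv_continuous.
  exists (fun z => -1 * (im_inv A z *m cM (A (Im_vec v)) *m im_inv A z) a b) => [|z Dz].
    apply: ip_mul; first exact: ip_cst.
    apply: ip_mulmx => [a1 b1|a1 b1]; last exact: ip_inv.
    by apply: ip_mulmx => a2 b2; [exact: ip_inv | exact: ip_cst].
  have h : (fun t : R => (-1 *: (im_inv A z *m cM (A (Im_vec v)) *m im_inv A (z + t%:C *: v))) a b)
    @ (0 : R)^' --> (-1 *: (im_inv A z *m cM (A (Im_vec v)) *m im_inv A z)) a b.
    apply: cvg_scale_entry => a1 b1; apply: cvg_mulmx => a2 b2; first exact: cvg_cst.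
    by move=> B /(im_inv_continuous Dz) hB; exact: (@cvg_line z v _ hB).
  rewrite mxZE in h; move: h; apply: cvg_trans; apply: near_eq_cvg.
  have Dt : \forall t \near (0 : R)^', D (z + t%:C *: v) := cvg_line v (tube_nbhs A_sym Dz).
  have t0 : \forall t \near (0 : R)^', t != 0 by exact: nbhs_dnbhs_neq.
  move: Dt t0; apply: filterS2 => t Dt t0.
  have tu : (t%:C : C) \is a GRing.unit by rewrite unitfE eqE /= negb_and t0.
  have unitD w : D w -> A (Im_vec w) \in unitmx.
    by move=> Dw; have [T Tu ->] := cholesky Dw; rewrite unitmx_mul unitmx_tr Tu.
  rewrite -(@inverse_quotient _ _ t%:C _ _ (cM (A (Im_vec z))) (cM (A (Im_vec (z + t%:C *: v))))).
  + by rewrite mxZE fmorphV mxDE mxNE.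
  + exact: tu.
  + by rewrite /im_inv -cMM mulVmx ?unitD// /cM map_mx1.
  + by rewrite /im_inv -cMM mulmxV ?unitD// /cM map_mx1.
  + have -> : Im_vec (z + t%:C *: v) = t *: Im_vec v + Im_vec z.
      by apply/rowP => i; rewrite !mxE cImD cImM /= mul0r addr0 addrC.
    by rewrite linearP addrC; apply/matrixP => i k; rewrite !mxE rmorphD rmorphM.
- split=> [z Dz|v]; first exact: (cvgD (c1 z Dz) (c2 z Dz)).
  have [g1 i1 h1] := d1 v; have [g2 i2 h2] := d2 v.
  exists (fun z => g1 z + g2 z) => [|z Dz]; first exact: ip_add.
  have -> : (fun t : R => (t^-1)%:C * (f1 (z + t%:C *: v) + f2 (z + t%:C *: v) - (f1 z + f2 z))) =
    (fun t : R => (t^-1)%:C * (f1 (z + t%:C *: v) - f1 z) + (t^-1)%:C * (f2 (z + t%:C *: v) - f2 z)).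
    by apply/funext => t; rewrite -mulrDr opprD addrACA.
  exact: (cvgD (h1 z Dz) (h2 z Dz)).
- split=> [z Dz|v]; first exact: (cvgM (c1 z Dz) (c2 z Dz)).
  have [g1 i1 h1] := d1 v; have [g2 i2 h2] := d2 v.
  exists (fun z => g1 z * f2 z + f1 z * g2 z) => [|z Dz].
    by apply: ip_add; apply: ip_mul.
  have l2 : (fun t : R => f2 (z + t%:C *: v)) @ (0 : R)^' --> f2 z.
    by move=> B /(c2 z Dz) hB; exact: (@cvg_line z v _ hB).
  have -> : (fun t : R => (t^-1)%:C * (f1 (z + t%:C *: v) * f2 (z + t%:C *: v) - f1 z * f2 z)) =
    (fun t : R => (t^-1)%:C * (f1 (z + t%:C *: v) - f1 z) * f2 (z + t%:C *: v) +
       f1 z * ((t^-1)%:C * (f2 (z + t%:C *: v) - f2 z))).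
    by apply/funext => t; move: (f1 _) (f1 z) (f2 _) (f2 z) (t^-1)%:C => x1 y1 x2 y2 s; ring.
  exact: (cvgD (cvgM (h1 z Dz) l2) (cvgMl_tmp (h2 z Dz))).
Qed.

Lemma cone_metric_smooth : real_smooth_on D (cone_metric A).
Proof.
exists [set F | forall a b, inverse_polynomial (fun z => F z a b)]; first exact: ip_cone_metric.
move=> F hF; split=> [z Dz|v].
  apply: (@cvg_mx_normc _ _ _ _ _ (nbhs_filter z)) => a b.
  apply: (iffLR (@cvg_normcP _ _ _ (nbhs_filter z) _ _)).
  by have [h _] := inverse_polynomial_deriv (hF a b); exact: h.
have /choice[G hG] : forall ab : 'I_n * 'I_n, exists g, inverse_polynomial g /\ forall z, D z ->
    (t^-1)%:C * (F (z + t%:C *: v) ab.1 ab.2 - F z ab.1 ab.2) @[t --> (0 : R)^'] --> g z.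
  by move=> [a b]; have [_ /(_ v)[g g1 g2]] := inverse_polynomial_deriv (hF a b); exists g.
exists (fun z => \matrix_(a, b) G (a, b) z) => [a b|z Dz].
  have -> : (fun z => (\matrix_(a, b) G (a, b) z) a b) = G (a, b) by apply/funext => z; rewrite mxE.
  by have [] := hG (a, b).
apply: cvg_mx_normc => a b; apply: (iffLR (cvg_normcP _ _)).
rewrite mxE; have [_ /(_ z Dz)] := hG (a, b); apply: cvg_trans; apply: near_eq_cvg.
by apply: nearW => t /=; rewrite mxZE mxDE mxNE.
Qed.

End Smooth.

(** * The bounded realization *)

Section Bounded.
Context {R : realType}.
Local Notation C := R[i].
Context {m n : nat} (A : {linear 'rV[R]_n -> 'M[R]_m}) (A_inj : injective A)
  (A_sym : forall x, (A x)^T = A x) (e : 'rV[R]_n) (Ae : A e = 1%:M).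
Local Notation Cn := 'rV[R[i]]_n.
Local Notation D := (tube [set x | posdef (A x)]).
Context (j : Cn -> Cn) (j_tube : forall z, D z -> D (j z)) (j_holo : holomorphic_on D j)
  (key : forall z, D z -> cext A z *m cext A (j z) = - 1%:M).

Lemma sqr_le_self (t u : R) : 0 <= t -> 0 <= u -> u <= 1 -> t ^+ 2 <= u -> t <= 1.
Proof. by move=> t0 u0 u1 tu; rewrite leNgt; apply/negP => t1; nra. Qed.
Lemma sqr_le1 (t : R) : 0 <= t -> t ^+ 2 <= t -> t <= 1.
Proof. by move=> t0 tu; rewrite leNgt; apply/negP => t1; nra. Qed.

(** For a row u of M the vector u N is minus a basis vector, and |u|^2 is at most
the imaginary part of the Hermitian form of N at u, that is, the imaginary part of
an entry of u. *)
Lemma resolvent_bound (N M : 'M[C]_m) : N^T = N ->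
  (forall u : 'rV[R]_m, sqn u <= bil (ImMx N) u u) -> M *m N = - 1%:M ->
  forall a b, normc (M a b) <= 1.
Proof.
move=> NT hN MN a; set u := row a M.
have uN : u *m N = - delta_mx 0 a by rewrite -row_mul MN; apply/rowP => b; rewrite !mxE eqxx eq_sym.
have uE b : u 0 b = M a b by rewrite mxE.
have h1 : complex.Im (bil N u (conjM u)) = complex.Im (M a a).
  rewrite /bil uN mulNmx -rowE !mxE; case: (M a a) => x y /=.
  by rewrite opprK.
have h2 : \sum_b normc (M a b) ^+ 2 <= complex.Im (M a a).
  rewrite -h1 (Im_herm u NT); apply: le_trans (lerD (hN _) (hN _)).
  rewrite /sqn -big_split /=; apply: ler_sum => b _.
  rewrite !mxE; case: (M a b) => x y /=.
  by rewrite sqr_sqrtr// addr_ge0// sqr_ge0.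
have le1 b : normc (M a b) ^+ 2 <= normc (M a a).
  apply: le_trans (le_trans (ler_norm _) (le_Im_normc _)); apply: le_trans h2.
  rewrite (bigD1 b)//= lerDl; apply: sumr_ge0 => k _; exact: sqr_ge0.
have aa1 : normc (M a a) <= 1.
  exact: sqr_le1 (normc_ge0 _) (le1 a).
by move=> b; exact: sqr_le_self (normc_ge0 _) (normc_ge0 _) aa1 (le1 b).
Qed.

(** The injective map A has a left inverse, whose complexification recovers z from
the entries of its matrix. *)
Lemma coordinate_bound : exists2 K : R, 0 <= K & forall z,
  (forall a b, normc (cext A z a b) <= 1) -> forall i, normc (z 0 i) <= K.
Proof.
pose L : 'M[R]_(n, m * m) := lin1_mx (mxvec \o A).
have LE x : x *m L = mxvec (A x) by rewrite mul_rV_lin1.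
have /row_freeP[M LM] : row_free L.
  rewrite -kermx_eq0; apply/rowV0P => x /sub_kermxP; rewrite LE => h.
  by apply: A_inj; rewrite linear0; apply: (can_inj mxvecK); rewrite h linear0.
exists (\sum_i \sum_k normc ((M k i)%:C : C)).
  by apply: sumr_ge0 => i _; apply: sumr_ge0 => k _; exact: normc_ge0.
move=> z hz i.
have zE : z = mxvec (cext A z) *m cM M.
  have cL x : cvec x = mxvec (cM (A x)) *m cM M.
    have -> : mxvec (cM (A x)) = cM (mxvec (A x)) by rewrite /cM map_mxvec.
    by rewrite -LE -cMM -mulmxA LM mulmx1.
  rewrite /cext linearD linearZ /= mulmxDl -scalemxAl -!cL; exact: cM_ReIm.
rewrite zE mxE; apply: le_trans (normc_sum _ _ _) _.
apply: (@le_trans _ _ (\sum_k normc ((M k i)%:C : C))).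
  apply: ler_sum => k _; rewrite normcM [(cM M) k i]mxE ler_piMl ?normc_ge0//.
  by case/mxvec_indexP: k => a b; rewrite mxvecE.
by rewrite (bigD1 i)// lerDl; apply: sumr_ge0 => i' _; apply: sumr_ge0 => k _; exact: normc_ge0.
Qed.

Let ie : Cn := 'i *: cvec e.
Let c2 : C := 2 * 'i.

(** On matrices Z |-> 1 - 2i (Z + i)^-1 = (Z - i)(Z + i)^-1. *)
Definition cayley z := c2 *: j (z + ie) + cvec e.
Definition cayley_inv w := j (c2^-1 *: (w - cvec e)) - ie.

(** Membership is expressed through the inverse map, which makes openness a matter
of continuity. *)
Definition cayley_image : set Cn := [set w | D (c2^-1 *: (w - cvec e)) /\ D (cayley_inv w)].

Lemma tube_add_ie z : D z -> D (z + ie).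
Proof.
move=> Dz; rewrite /tube /=; have -> : Im_vec (z + ie) = Im_vec z + e.
  by rewrite -[in RHS](@Im_vec_i R n e); apply/rowP => k; rewrite !mxE cImD.
by rewrite linearD Ae; apply: posdef_add => //; exact: posdef1.
Qed.

Lemma cayleyK z : D z -> cayley_image (cayley z) /\ cayley_inv (cayley z) = z.
Proof.
move=> Dz; have Dz' := tube_add_ie Dz.
have e1 : c2^-1 *: (cayley z - cvec e) = j (z + ie).
  by rewrite /cayley addrK scalerA mulVf ?scale1r//; exact: two_i_neq0.
have e2 : cayley_inv (cayley z) = z.
  by rewrite /cayley_inv e1 (j_involutive A_inj j_tube key)// addrK.
by split=> //; split; [rewrite e1; exact: j_tube | rewrite e2].
Qed.

Lemma cayley_invK w : cayley_image w -> D (cayley_inv w) /\ cayley (cayley_inv w) = w.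
Proof.
move=> [Du Dg]; split=> //; rewrite /cayley /cayley_inv subrK (j_involutive A_inj j_tube key)//.
by rewrite scalerA mulfV ?scale1r ?subrK//; exact: two_i_neq0.
Qed.

Lemma cayley_holo : holomorphic_on D cayley.
Proof.
move=> z Dz; apply: (@differentiable_comp _ _ _ _ (fun z => j (z + ie)) (fun w : Cn => c2 *: w + cvec e)).
  apply: (@differentiable_comp _ _ _ _ (fun z => z + ie) j).
    have -> : (fun z : Cn => z + ie) = (fun z => 1 *: z + ie) by apply/funext => w; rewrite scale1r.
    exact: affine_differentiable.
  by apply: j_holo; exact: tube_add_ie.
exact: affine_differentiable.
Qed.

Lemma cayley_inv_differentiable w : D (c2^-1 *: (w - cvec e)) -> differentiable cayley_inv w.
Proof.
move=> Du; apply: (@differentiable_comp _ _ _ _ (fun w => j (c2^-1 *: (w - cvec e))) (fun w : Cn => w - ie)).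
  apply: (@differentiable_comp _ _ _ _ (fun w => c2^-1 *: (w - cvec e)) j); last exact: j_holo.
  have -> : (fun w : Cn => c2^-1 *: (w - cvec e)) = (fun w => c2^-1 *: w + - (c2^-1 *: cvec e)).
    by apply/funext => x; rewrite scalerBr.
  exact: affine_differentiable.
have -> : (fun z : Cn => z - ie) = (fun z => 1 *: z + - ie) by apply/funext => x; rewrite scale1r.
exact: affine_differentiable.
Qed.

Lemma cayley_image_open : open cayley_image.
Proof.
rewrite openE => w [Du Dg].
have c1 : {for w, continuous (fun w : Cn => c2^-1 *: (w - cvec e))}.
  have -> : (fun w : Cn => c2^-1 *: (w - cvec e)) = (fun w => c2^-1 *: w + - (c2^-1 *: cvec e)).
    by apply/funext => x; rewrite scalerBr.
  apply: differentiable_continuous; exact: affine_differentiable.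
have c3 := differentiable_continuous (cayley_inv_differentiable Du).
have n1 := c1 _ (tube_nbhs A_sym Du); have n2 := c3 _ (tube_nbhs A_sym Dg).
exact: (@filterI _ _ (nbhs_filter w) _ _ n1 n2).
Qed.

Lemma cayley_image_connected : connected cayley_image.
Proof.
have -> : cayley_image = cayley @` D.
  apply/seteqP; split=> [w hw|_ [z Dz <-]]; last by have [] := cayleyK Dz.
  by have [h1 h2] := cayley_invK hw; exists (cayley_inv w).
apply: connected_continuous_connected; first exact: (tube_connected A_sym Ae).
apply: continuous_in_subspaceT => z /set_mem Dz.
exact: differentiable_continuous (cayley_holo Dz).
Qed.

Lemma cayley_bounded_coord : exists2 K : R, 0 <= K &
  forall w, cayley_image w -> forall i, normc (w 0 i) <= K.
Proof.
have [K K0 hK] := coordinate_bound.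
exists (2 * K + \sum_i normc ((cvec e : Cn) 0 i)).
  by rewrite addr_ge0 ?mulr_ge0//; apply: sumr_ge0 => i _; exact: normc_ge0.
move=> w hw i; have [Dz wE] := cayley_invK hw; set z := cayley_inv w in Dz wE.
have Dz' := tube_add_ie Dz.
have hz : normc (j (z + ie) 0 i) <= K.
  apply: hK; apply: (@resolvent_bound (cext A (z + ie))).
  - by have [] := siegel_cext A_sym Dz'.
  - move=> u; rewrite ImMx_cext; have -> : Im_vec (z + ie) = Im_vec z + e.
      by rewrite -[in RHS](@Im_vec_i R n e); apply/rowP => k; rewrite !mxE cImD.
    by rewrite linearD Ae bilDm bil1 lerDr posdef_ge0.
  - exact: (inversion_comm key Dz').
rewrite -wE /cayley mxDE mxZE; apply: le_trans (le_normcD _ _) _; apply: lerD.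
  rewrite !normcM normc_i mulr1; have -> : normc (2 : C) = 2 by rewrite -[2 in LHS](rmorph_nat (real_complex R)) normc_real ger0_norm.
  by rewrite ler_pM2l.
by rewrite (bigD1 i)// lerDl; apply: sumr_ge0 => k _; exact: normc_ge0.
Qed.

Lemma cayley_image_bounded : bounded_set cayley_image.
Proof.
have [K K0 hK] := cayley_bounded_coord.
exists (K%:C); split; first by rewrite complex_real.
move=> x Kx w hw; rewrite /= [leLHS]mx_normE.
have x0 : 0 <= x by apply: le_trans (ltW Kx); rewrite lecR.
rewrite [leRHS](_ : x = (NngNum x0)%:num)// num_le; apply/bigmax_leP; split=> //= -[a b] _.
rewrite -num_le /=; apply: le_trans (ltW Kx).
by rewrite ord1 normcE' lecR; exact: hK.
Qed.

Lemma tube_symmetric : hermitian_symmetric_domain D.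
Proof.
split; first exact: (tube_domain A_sym Ae).
  exists cayley_image; split.
  - split; [exact: cayley_image_open | exact: cayley_image_connected|].
    by exists (cayley ie); have [] := cayleyK (tube_ie Ae).
  - exact: cayley_image_bounded.
  - exists cayley, cayley_inv; split.
    + exact: cayley_holo.
    + by move=> w [Du _]; exact: cayley_inv_differentiable.
    + exact: cayleyK.
    + exact: cayley_invK.
exists (cone_metric A).
  split; first exact: (cone_metric_smooth A_sym j_tube j_holo key).
  by move=> z; exact: (cone_metric_posdef A_inj A_sym).
move=> a Da; have [Q hQ] := quad_rep A_inj A_sym Ae j_tube key (Im_vec a).
exists (sym_at j a Q); split.
- exact: sym_holo.
- move=> z Dz; split; first exact: (sym_tube A_sym j_tube Da hQ Dz).
  exact: (sym_involutive A_inj A_sym j_tube key Da hQ Dz).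
- exact: (sym_isometry A_sym j_tube j_holo key Da hQ).
- exact: (sym_fixed_base A_inj key Da hQ).
- have Dn : \forall z \near a^', D z by apply: nbhs_dnbhs; exact: tube_nbhs.
  have an : \forall z \near a^', z != a by exact: nbhs_dnbhs_neq.
  move: Dn an; apply: filterS2 => z Dz za; apply: contraNneq za => h.
  by apply/eqP; exact: (sym_fixed_unique A_inj A_sym key Da hQ Dz h).
Qed.

End Bounded.

Theorem theorem12 (R : realType) (m n : nat) (m_gt0 : (0 < m)%N)
    (rho : 'rV[R]_m -> 'rV[R]_m -> R)
    (rho_psb : posdef_symmetric_bilinear rho)
    (psi : {linear 'rV[R[i]]_n -> 'M[R[i]]_m})
    (psi_inj : injective psi)
    (psi_sa : preserves_real_selfadjoint rho psi)
    (e : 'rV[R]_n)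
    (e_cone : cone rho psi e)
    (psi_e : psi (cvec e) = 1%:M)
    (j : 'rV[R[i]]_n -> 'rV[R[i]]_n)
    (j_tube : forall z, tube (cone rho psi) z -> tube (cone rho psi) (j z))
    (j_holo : holomorphic_on (tube (cone rho psi)) j)
    (j_nonaffine : ~ affine_on (tube (cone rho psi)) j)
    (j_invol : forall z, tube (cone rho psi) z -> j (j z) = z)
    (j_ie : j ('i *: cvec e) = 'i *: cvec e)
    (dj_ie : forall v, 'd j ('i *: cvec e) v = - v)
    (h : 'rV[R[i]]_n -> R[i])
    (h_holo : holomorphic_on (tube (cone rho psi)) h)
    (h_neq0 : forall z, tube (cone rho psi) z -> h z != 0)
    (theta_j : forall L : set 'rV[R]_m, full_rank_lattice L ->
      exists c : R[i], forall z, tube (cone rho psi) z ->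
        theta rho psi (dual_lattice rho L) (j z) 0 =
        c * h z * theta rho psi L z 0) :
  hermitian_symmetric_domain (tube (cone rho psi)) /\
  exists mul : 'rV[R]_n -> 'rV[R]_n -> 'rV[R]_n,
    [/\ jordan_algebra mul e /\ formally_real mul,
        posdef_symmetric_bilinear (trace_form mul),
        cone rho psi = dual_cone (trace_form mul) (cone rho psi),
        cone rho psi = [set mul x x | x in [set x | jordan_invertible mul e x]] &
        forall z, tube (cone rho psi) z ->
          exists2 w, jordan_inverse (mul_ext mul) (cvec e) z w & j z = - w].
Proof.
have [T Tu TE] := cholesky (gram_posdef rho_psb).
have phi_linear : linear (orth_op psi T) by exact: orth_op_linear.
pose phi : {linear 'rV[R]_n -> 'M[R]_m} := HB.pack (orth_op psi T) (GRing.isLinear.Build _ _ _ _ _ phi_linear).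
have phi_inj : injective phi by exact: (orth_op_inj psi_sa Tu psi_inj).
have phi_sym x : (phi x)^T = phi x by exact: (orth_op_sym rho_psb psi_sa Tu TE).
have phi_e : phi e = 1%:M by exact: (orth_op_unit Tu psi_e).
have coneE : cone rho psi = [set x | posdef (phi x)].
  by apply/seteqP; split=> x; [apply: (iffLR (cone_orth_op _ _ _ _ _)) | apply: (iffRL (cone_orth_op _ _ _ _ _))].
have key z : tube (cone rho psi) z -> cext phi z *m cext phi (j z) = - 1%:M.
  exact: (theta_j_inverse m_gt0 rho_psb psi_sa Tu TE e_cone psi_e j_tube j_ie h_neq0 theta_j).
move: j_tube j_holo key; rewrite !coneE => tube_j holo_j key.
split; first exact: (tube_symmetric phi_inj phi_sym phi_e tube_j holo_j key).
have inv := @jordan_inv_ex _ _ _ _ _ tube_j key.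
exists (jmul phi); split.
- split; first exact: (jordan_jmul phi_inj phi_sym phi_e inv).
  exact: (formally_real_jmul phi_inj phi_sym phi_e inv).
- exact: (trace_form_psb phi_inj phi_sym phi_e inv).
- exact: (cone_selfdual phi_inj phi_sym phi_e inv).
- exact: (cone_squares phi_inj phi_sym phi_e inv).
- move=> z Dz; exists (- j z); last by rewrite opprK.
  apply: (cext_jordan_inverse phi_inj phi_sym phi_e inv).
  by rewrite cextN mulmxN key// opprK.
Qed.
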